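(* Let $T\in\mathbb R^{n^m}$ be a symmetric tensor of order $m$ such that $T = \sum_{i\in [k]}w_i \cdot v_i^{\otimes m}$ for some vectors $v_1,\ldots,v_k \in \mathbb R^n$ and scalars $w_1,\ldots, w_k \neq 0$. Let $\operatorname{Span}\{v_i\}$ have incoherence $\mu$ and dimension $r$. If $4\cdot\mu\cdot r\cdot m/n < 1$, then there is an algorithm which, given exact access to all multilinear entries of $T$, returns the full tensor $T$ in time $\tilde O(n^{m+1})$.
   Context: A string (index) $X\in[n]^m$ is multilinear if all its $m$ elements are distinct; the multilinear entries of $T$ are the entries $T(X)$ with $X$ multilinear. A subspace $U\subseteq\mathbb R^n$ of dimension $r$ is incoherent with parameter $\mu$ if $\max_{i\in[n]}\|\mathrm{Proj}_U(e_i)\|^2\le \mu\frac{r}{n}$, where $e_i$ is the $i$-th standard basis vector. $\tilde O$ hides polylogarithmic factors. *)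

(* Defs.v *)
From HB Require Import structures.
From mathcomp Require Import all_boot all_order all_algebra.
From mathcomp Require Import reals.

Set Implicit Arguments.
Unset Strict Implicit.
Unset Printing Implicit Defensive.

Import Order.TTheory GRing.Theory Num.Theory.

Local Open Scope ring_scope.

Definition tensor (R : Type) (n m : nat) := m.-tuple 'I_n -> R.

Definition multilinear (n m : nat) (X : m.-tuple 'I_n) : bool := uniq X.

Definition symmetric_tensor (R : Type) (n m : nat) (T : tensor R n m) : Prop :=
  forall X Y : m.-tuple 'I_n, perm_eq X Y -> T X = T Y.

Definition tpower (R : realType) (n : nat) (v : 'rV[R]_n) (m : nat) :
  tensor R n m := fun X => \prod_(j < m) v 0 (tnth X j).

Arguments tpower {R n} v m X.

(* Subspaces of R^n are row spaces of matrices, as in mxalgebra. *)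
Definition span_mx (R : realType) (n k : nat) (v : 'I_k -> 'rV[R]_n) : 'M[R]_(k, n) :=
  \matrix_(i < k) v i.

(* [kermx U^T] is the orthogonal complement of the row space of [U], so this
   is the orthogonal projection onto that row space; it acts on row vectors by
   right multiplication. *)
Definition orthoproj (R : realType) (n k : nat) (U : 'M[R]_(k, n)) : 'M[R]_n :=
  proj_mx <<U>>%MS (kermx U^T).

Definition normsq (R : realType) (n : nat) (x : 'rV[R]_n) : R :=
  \sum_(j < n) x 0 j ^+ 2.

Definition incoherent (R : realType) (n k : nat) (mu : R) (U : 'M[R]_(k, n)) : Prop :=
  forall i : 'I_n,
    normsq (delta_mx 0 i *m orthoproj U) <= mu * ((\rank U)%:R / n%:R).

(* Algorithms are programs for a real random-access machine, with
   finitely many unbounded arrays of naturals and of reals (arrays are named by naturals; a scalar is a cell of an array).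
   Real arithmetic and comparisons are exact and cost 1 each; the only real
   constants are 0 and 1, and no operation turns a real into a natural.
   Naturals, which serve as loop counters and addresses, are charged their bit
   length (logarithmic cost), so that no computation can be hidden in large
   integers. *)

Inductive nexp : Type :=
| NConst of nat
| NGet (a : nat) (i : nexp)
| NAdd of nexp & nexp
| NSub of nexp & nexp
| NMul of nexp & nexp
| NDiv of nexp & nexp
| NMod of nexp & nexp.

Inductive rexp : Type :=
| RZero
| ROne
| RGet (a : nat) (i : nexp)
| RAdd of rexp & rexp
| RSub of rexp & rexp
| RMul of rexp & rexp
| RDiv of rexp & rexp.

Inductive bexp : Type :=
| BNLe of nexp & nexp
| BRLe of rexp & rexp
| BNot of bexp
| BAnd of bexp & bexp.

Inductive cmd : Type :=
| CSkip
| CNSet (a : nat) (i e : nexp)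
| CRSet (a : nat) (i : nexp) (e : rexp)
| CSeq of cmd & cmd
| CIf of bexp & cmd & cmd
| CWhile of bexp & cmd.

Record state (R : Type) := State {
  nmem : nat -> nat -> nat;
  rmem : nat -> nat -> R }.

Definition update (A : Type) (f : nat -> nat -> A) (a i : nat) (x : A) :
  nat -> nat -> A :=
  fun b j => if (b == a) && (j == i) then x else f b j.

Section Semantics.
Variable R : realType.
Implicit Types s : state R.

Fixpoint neval s (e : nexp) : nat :=
  match e with
  | NConst c => c
  | NGet a i => nmem s a (neval s i)
  | NAdd e1 e2 => (neval s e1 + neval s e2)%N
  | NSub e1 e2 => (neval s e1 - neval s e2)%N
  | NMul e1 e2 => (neval s e1 * neval s e2)%N
  | NDiv e1 e2 => (neval s e1 %/ neval s e2)%N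
  | NMod e1 e2 => (neval s e1 %% neval s e2)%N
  end.

Definition bitlen (x : nat) : nat := (trunc_log 2 x).+1.

Fixpoint ncost s (e : nexp) : nat :=
  (bitlen (neval s e) +
   match e with
   | NConst _ => 0
   | NGet _ i => ncost s i
   | NAdd e1 e2 | NSub e1 e2 | NMul e1 e2 | NDiv e1 e2 | NMod e1 e2 =>
       ncost s e1 + ncost s e2
   end)%N.

Fixpoint reval s (e : rexp) : R :=
  match e with
  | RZero => 0
  | ROne => 1
  | RGet a i => rmem s a (neval s i)
  | RAdd e1 e2 => reval s e1 + reval s e2
  | RSub e1 e2 => reval s e1 - reval s e2
  | RMul e1 e2 => reval s e1 * reval s e2
  | RDiv e1 e2 => reval s e1 / reval s e2
  end.

Fixpoint rcost s (e : rexp) : nat :=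
  match e with
  | RZero | ROne => 1
  | RGet _ i => (ncost s i).+1
  | RAdd e1 e2 | RSub e1 e2 | RMul e1 e2 | RDiv e1 e2 =>
      (rcost s e1 + rcost s e2).+1
  end.

Fixpoint beval s (b : bexp) : bool :=
  match b with
  | BNLe e1 e2 => (neval s e1 <= neval s e2)%N
  | BRLe e1 e2 => reval s e1 <= reval s e2
  | BNot b1 => ~~ beval s b1
  | BAnd b1 b2 => beval s b1 && beval s b2
  end.

Fixpoint bcost s (b : bexp) : nat :=
  match b with
  | BNLe e1 e2 => (ncost s e1 + ncost s e2).+1
  | BRLe e1 e2 => (rcost s e1 + rcost s e2).+1
  | BNot b1 => (bcost s b1).+1
  | BAnd b1 b2 => (bcost s b1 + bcost s b2).+1
  end.

(* [exec s c s' t]: started in [s], the program [c] halts in [s'] in time [t]. *)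
Inductive exec : state R -> cmd -> state R -> nat -> Prop :=
| ExecSkip s : exec s CSkip s 1
| ExecNSet s a i e :
    exec s (CNSet a i e)
      (State (update (nmem s) a (neval s i) (neval s e)) (rmem s))
      (ncost s i + ncost s e).+1
| ExecRSet s a i e :
    exec s (CRSet a i e)
      (State (nmem s) (update (rmem s) a (neval s i) (reval s e)))
      (ncost s i + rcost s e).+1
| ExecSeq s s1 s2 c1 c2 t1 t2 :
    exec s c1 s1 t1 -> exec s1 c2 s2 t2 -> exec s (CSeq c1 c2) s2 (t1 + t2)
| ExecIfTrue s s1 b c1 c2 t :
    beval s b -> exec s c1 s1 t -> exec s (CIf b c1 c2) s1 (bcost s b + t)
| ExecIfFalse s s1 b c1 c2 t :
    ~~ beval s b -> exec s c2 s1 t -> exec s (CIf b c1 c2) s1 (bcost s b + t)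
| ExecWhileFalse s b c :
    ~~ beval s b -> exec s (CWhile b c) s (bcost s b)
| ExecWhileTrue s s1 s2 b c t1 t2 :
    beval s b -> exec s c s1 t1 -> exec s1 (CWhile b c) s2 t2 ->
    exec s (CWhile b c) s2 (bcost s b + t1 + t2).

End Semantics.

Definition address (n m : nat) (X : m.-tuple 'I_n) : nat :=
  (\sum_(j < m) tnth X j * n ^ j)%N.

(* [n] and [m] are the first two cells of integer array 0.  Real array 0 holds
   the multilinear entries of [T]; nothing is assumed about any other real cell,
   in particular about the cells addressed by indices that are not
   multilinear. *)
Definition multilinear_input (R : realType) (n m : nat) (T : tensor R n m)
    (s : state R) : Prop :=
  [/\ forall a i, nmem s a i =
        (if a == 0 then if i == 0 then n else if i == 1 then m else 0 else 0)%N
    & forall X : m.-tuple 'I_n, multilinear X -> rmem s 0%N (address X) = T X].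

Definition full_output (R : realType) (n m : nat) (T : tensor R n m)
    (s : state R) : Prop :=
  forall X : m.-tuple 'I_n, rmem s 1%N (address X) = T X.

(* The bound O~(n^d): a constant times n^d times a power of log(n^d), the latter
   rounded up to [d * bitlen n] so as not to vanish at [n = 1]. *)
Definition soft_bound (C c n d : nat) : nat :=
  (C * n ^ d * (d * bitlen n) ^ c)%N.

(* Main.v *)
(** Fixing all positions of a multi-index but [p] and [q] cuts [T] into symmetric
    matrices [M = B^T D B], where the rows of [B] span [Span {v_i}]. Entries with [r]
    repetitions are obtained from those with fewer by completing the diagonals of
    these slices, rows and columns indexed by values that occur at the fixed
    positions being cleared first, with one such value exempted in turn. Incoherence
    bounds the dimension of the vectors of the span supported on a set [S] by
    [#|S| / (4 m)], and so that of the vectors of the row space of a cleared slice by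
    [#|S| / 8].

    Completing the diagonal of [M]: let [d] be a guess that is 0 on the set [Z] of
    unknown coordinates, and [e] its error. Row reduction of [[1 | M + diag e]]
    computes a space [X] of vectors killed by [M + diag e]: a known coordinate of
    the product is eliminated outright; for an unknown one the guess is changed so
    that it vanishes at a pivot row, and if it still does not vanish on the whole
    space, then it is independent of the corresponding coordinate of the vector, and
    both are eliminated. Each of the latter steps lowers the rank by two but gives up
    a single coordinate, so that few are given up and [X] has large rank on [Z].

    On [X] one has [x M = - x diag e], so the wrong coordinates of [X] span a space of
    the same dimension as vectors in the row space of [M]. Picking [4 b] bases of the
    coordinates in [Z] on [X], each greedily by increasing load (number of previous
    picks), the total of [2 ^ load] over the wrong coordinates grows at most by 9/8
    per basis, so no wrong coordinate is picked [2 b] times when [b > log n]. As the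
    bases are large, at least half of [Z] is picked that often and becomes known;
    after [b] such stages the diagonal is known. *)

Require Import Defs.
From mathcomp Require Import all_boot all_order all_algebra.
From mathcomp Require Import reals.
From mathcomp Require Import zify ring lra.

Set Implicit Arguments.
Unset Strict Implicit.
Unset Printing Implicit Defensive.

Import Order.TTheory GRing.Theory Num.Theory.

Local Open Scope ring_scope.

(** * Linear algebra of diagonal completion *)

Section Completion.
Variables (F : fieldType) (n : nat).
Implicit Types (S Z I : {set 'I_n}) (T X : 'M[F]_n).

(** Its row space is the space of vectors supported on [S], and right multiplication by it restricts
    vectors to [S]; conditions on supports thus become statements about ranks of row spaces. *)
Definition coordmx S : 'M[F]_n := diag_mx (\row_i (i \in S)%:R).

Lemma mul_coordmxE p (A : 'M[F]_(p, n)) S i j :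
  (A *m coordmx S) i j = if j \in S then A i j else 0.
Proof. by rewrite mul_mx_diag !mxE; case: ifP; rewrite ?mulr1 ?mulr0. Qed.

Lemma mul_coordmx0P p (A : 'M[F]_(p, n)) S :
  reflect (forall j, j \in S -> col j A = 0) (A *m coordmx S == 0).
Proof.
apply: (iffP eqP) => [A0 j jS | A0].
  by apply/colP => i; move/matrixP/(_ i j): A0; rewrite mul_coordmxE jS !mxE.
apply/matrixP => i j; rewrite mul_coordmxE !mxE; case: ifP => // jS.
by have /colP/(_ i) := A0 j jS; rewrite !mxE.
Qed.

Lemma tr_coordmx S : (coordmx S)^T = coordmx S.
Proof. exact: tr_diag_mx. Qed.

Lemma mul_coordmx_coordmx S S' : coordmx S *m coordmx S' = coordmx (S :&: S').
Proof.
apply/matrixP=> i j; rewrite mul_coordmxE !mxE inE.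
by case: eqVneq => [->|_]; rewrite ?mulr0n ?if_same //; case: (j \in S'); rewrite ?andbT ?andbF.
Qed.

Lemma sub_coordmxP p (A : 'M[F]_(p, n)) S :
  reflect (A *m coordmx S = A) (A <= coordmx S)%MS.
Proof.
apply: (iffP idP) => [/submxP[B ->] | <-]; last exact: submxMl.
by rewrite -mulmxA mul_coordmx_coordmx setIid.
Qed.

Lemma sub_coordmx p (A : 'M[F]_(p, n)) S :
  (forall i j, j \notin S -> A i j = 0) -> (A <= coordmx S)%MS.
Proof.
move=> A0; apply/sub_coordmxP/matrixP => i j; rewrite mul_coordmxE.
by case: ifPn => // /A0 ->.
Qed.

(** A sum of [#|S|] matrices of rank at most one gives the upper bound. It is sharp because it also
    holds for the complement, and the two projections add up to the identity. *)
Lemma rank_coordmx S : \rank (coordmx S) = #|S|.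
Proof.
have le1 S' : (\rank (coordmx S') <= #|S'|)%N.
  have -> : coordmx S' =
      \sum_(i in S') (delta_mx i 0 : 'M_(n, 1)) *m (delta_mx 0 i : 'M_(1, n)).
    apply/matrixP=> i j; rewrite summxE !mxE.
    under eq_bigr => k _ do rewrite mul_delta_mx mxE.
    case: (eqVneq i j) => [->|ij]; last first.
      rewrite big1 // => k _; case: (eqVneq i k) => //= ik.
      by rewrite -ik eq_sym (negPf ij).
    rewrite big_mkcond (bigD1 j) //= big1 ?addr0.
      by case: ifP; rewrite ?eqxx.
    by move=> k kj; case: ifP => //; rewrite eq_sym (negPf kj).
  apply: (leq_trans (n := \sum_(i in S') 1)); last by rewrite sum1_card.
  elim/big_rec2: _ => [|i k M _ IH]; first by rewrite mxrank0.
  rewrite (leq_trans (mxrank_add _ _)) // leq_add // mul_delta_mx.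
  by rewrite mxrank_delta.
apply/eqP; rewrite eqn_leq le1 /=.
have : (n <= \rank (coordmx S) + \rank (coordmx (~: S)))%N.
  rewrite -[X in (X <= _)%N](mxrank1 F n).
  have -> : 1%:M = coordmx S + coordmx (~: S).
    apply/matrixP=> i j; rewrite !mxE inE.
    by case: eqVneq => [->|_]; case: (j \in S); rewrite /= ?mulr1n ?mulr0n ?addr0 ?add0r.
  exact: mxrank_add.
have := le1 (~: S); have := cardsC S; rewrite card_ord.
by move: (\rank _) (\rank _) #|_| #|_| => a b c e; lia.
Qed.

(** If [X *m w] vanishes or has pivot [f], this intersects the row space of [X]
    with the kernel of [w]. *)
Definition elimv m p (X : 'M[F]_(m, p)) (f : 'I_m) (w : 'cV[F]_p) :=
  X - ((X *m w) f 0)^-1 *: ((X *m w) *m row f X).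

Section Elim.
Variables (m p : nat) (X : 'M[F]_(m, p)) (f : 'I_m) (w : 'cV[F]_p).
Hypothesis pivot : X *m w != 0 -> (X *m w) f 0 != 0.

Lemma mul_elimv : elimv X f w *m w = 0.
Proof.
rewrite mulmxBl -scalemxAl -(mulmxA (X *m w)) -row_mul.
have [->|/pivot nz] := eqVneq (X *m w) 0; first by rewrite mul0mx scaler0 subr0.
have -> : row f (X *m w) = ((X *m w) f 0)%:M.
  by apply/matrixP=> i j; rewrite !mxE !ord1 eqxx mulr1n.
by rewrite mul_mx_scalar scalerA mulVf // scale1r subrr.
Qed.

Lemma elimv_sub : (elimv X f w <= X)%MS.
Proof.
by rewrite addmx_sub // eqmx_opp scalemx_sub // mulmx_sub // row_sub.
Qed.

Lemma sub_elimv (h : 'rV_p) : (h <= X)%MS -> h *m w = 0 -> (h <= elimv X f w)%MS.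
Proof.
case/submxP=> a ->; rewrite -mulmxA => aw0; apply/submxP; exists a.
by rewrite mulmxBr -scalemxAr mulmxA aw0 mul0mx scaler0 subr0.
Qed.

Lemma rank_elimv_lt : X *m w != 0 -> (\rank (elimv X f w) < \rank X)%N.
Proof.
move=> nz; apply: rank_ltmx; rewrite /ltmx elimv_sub /=.
apply: contra nz => /submxP[B ->]; rewrite -mulmxA mul_elimv mulmx0; exact/eqP.
Qed.

Lemma rank_elimv_ge : (\rank X <= (\rank (elimv X f w)).+1)%N.
Proof.
set R := ((X *m w) f 0)^-1 *: ((X *m w) *m row f X).
have eX : elimv X f w + R = X by rewrite subrK.
rewrite -[in X in (X <= _)%N]eX (leq_trans (mxrank_add _ _)) // addnC -add1n.
rewrite leq_add2r (leq_trans (mxrank_scale _ _)) //.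
by rewrite (leq_trans (mxrankM_maxl _ _)) // rank_leq_col.
Qed.

End Elim.

(** Row operations commute with right multiplication, so eliminating in [X *m B] amounts to
    eliminating in [X]. *)
Lemma elimvM m p q (X : 'M[F]_(m, p)) (B : 'M_(p, q)) f w :
  elimv (X *m B) f w = elimv X f (B *m w) *m B.
Proof.
by rewrite /elimv mulmxBl -scalemxAl row_mul !mulmxA.
Qed.

End Completion.

(** * Rank and load estimates for one stage of diagonal completion *)

Section Stage.
Variables (F : fieldType) (n : nat) (T : 'M[F]_n).
Hypothesis symT : T^T = T.
Local Notation E := (coordmx F).
Implicit Types (S Z I P : {set 'I_n}).

Lemma col_sub0 m1 m2 (X : 'M[F]_(m1, n)) (Y : 'M_(m2, n)) j :
  (X <= Y)%MS -> col j Y = 0 -> col j X = 0.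
Proof. by case/submxP=> B -> Y0; rewrite colE -mulmxA -colE Y0 mulmx0. Qed.

(** Rank-nullity for [T] on the row space of [X]: the image lies in [T :&: E Z]. *)
Lemma rank_sub_known (X : 'M[F]_n) Z :
  (X *m T <= E Z)%MS ->
  (\rank X <= \rank (T :&: E Z)%MS + \rank (kermx T))%N.
Proof.
move=> XZ; rewrite -(mxrank_mul_ker X T) leq_add ?mxrankS ?capmxSr //.
by rewrite sub_capmx submxMl.
Qed.

Lemma rank_ker_free I :
  (\rank (kermx T) <= \rank (kermx T :&: kermx (E I))%MS + #|I|)%N.
Proof.
rewrite -(mxrank_mul_ker (kermx T) (E I)) addnC leq_add2l.
by rewrite (leq_trans (mxrankM_maxr _ _)) // rank_coordmx.
Qed.

(** The space [N] of kernel vectors vanishing on [I] has dimension at least [n - \rank T - #|I|].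
    Those of its vectors that also vanish on [Z] are orthogonal to [T + E Z], so they span at most
    [n - \rank (T + E Z)] dimensions; the difference is a lower bound for the rank of [N] on [Z]. *)
Lemma rank_coord_ge (X : 'M[F]_n) Z I :
    (kermx T :&: kermx (E I) <= X)%MS ->
  (#|Z| <= \rank (X *m E Z) + #|I| + \rank (T :&: E Z)%MS)%N.
Proof.
move=> NX; set N := (_ :&: _)%MS in NX.
have := mxrank_mul_ker N (E Z); have := rank_ker_free I; rewrite -/N.
have : (\rank (N *m E Z) <= \rank (X *m E Z))%N by rewrite mxrankS ?submxMr.
have : (\rank (N :&: kermx (E Z)) + \rank (T + E Z)%MS <= n)%N.
  set W := (_ :&: _)%MS.
  have WT : W *m T = 0.
    by apply/sub_kermxP; rewrite (submx_trans (capmxSl _ _)) ?capmxSl.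
  have WE : W *m E Z = 0 by apply/sub_kermxP; rewrite capmxSr.
  (* By the symmetry of [T], its left kernel is the orthogonal complement of its row space. *)
  have : col_mx T (E Z) *m W^T = 0.
    apply: trmx_inj; rewrite trmx_mul trmxK tr_col_mx symT tr_coordmx.
    by rewrite mul_mx_row WT WE row_mx0 trmx0.
  by move/mulmx0_rank_max; rewrite -addsmxE mxrank_tr addnC.
have := mxrank_sum_cap T (E Z); rewrite rank_coordmx mxrank_ker.
have := rank_leq_row T.
move: (\rank _) (\rank _) (\rank _) (\rank _) (\rank _) (\rank _) (\rank _).
move=> *; lia.
Qed.

Variables (e : 'rV[F]_n) (Z : {set 'I_n}) (X0 : 'M[F]_n).
Hypothesis e0 : forall i, i \notin Z -> e 0 i = 0.
Hypothesis X0ker : X0 *m (T + diag_mx e) = 0.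

(** An error at a coordinate where [X0] vanishes is left out: such a coordinate is never picked, so
    its guess is never trusted. *)
Definition wrong : {set 'I_n} := [set i in Z | (e 0 i != 0) && (col i X0 != 0)].

(** On [X] the product with [T] is minus the product with [diag_mx e], so it is supported on [P]
    while lying in the row space of [T]. Errors are nonzero on [wrong], hence no rank of [X] on
    [wrong] is lost in this product. *)
Lemma rank_wrong (X : 'M[F]_n) P :
    (X <= X0)%MS -> (forall i, i \in wrong -> i \notin P -> col i X = 0) ->
  (\rank (X *m E wrong) <= \rank (T :&: E P)%MS)%N.
Proof.
move=> XX0 XP.
have eXT : X *m T = - (X *m diag_mx e).
  apply/eqP; rewrite -addr_eq0 -mulmxDr.
  by case/submxP: XX0 => B ->; rewrite -mulmxA X0ker mulmx0.
have Xw0 i : i \notin wrong -> e 0 i != 0 -> col i X = 0.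
  move=> iw ei; apply: col_sub0 XX0 _; apply/eqP; apply: contraR iw => ci.
  by rewrite inE ei ci !andbT; apply: contraR ei => /e0 ->.
apply: (@leq_trans (\rank (X *m T))); last first.
  rewrite mxrankS // sub_capmx submxMl /= eXT eqmx_opp.
  apply: sub_coordmx => i j jP; rewrite mul_mx_diag mxE.
  have [->|ej] := eqVneq (e 0 j) 0; first by rewrite mulr0.
  have /colP/(_ i) : col j X = 0.
    by have [/XP->|/Xw0->] := boolP (j \in wrong).
  by rewrite !mxE => ->; rewrite mul0r.
rewrite eXT mxrank_opp.
(* Scaling columns by the inverse errors recovers the restriction of [X] to [wrong]. *)
have -> : X *m E wrong =
    X *m diag_mx e *m diag_mx (\row_i (if i \in wrong then (e 0 i)^-1 else 0)).
  apply/matrixP=> i j; rewrite mul_coordmxE !mul_mx_diag !mxE.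
  case: ifP; last by rewrite mulr0.
  by rewrite inE => /and3P[_ ej _]; rewrite mulfK.
exact: mxrankM_maxl.
Qed.

Hypothesis incohT : forall S, (8 * \rank (T :&: E S)%MS <= #|S|)%N.

(** Progress of a pass that picks a basis of the coordinates in [Z] on the row
    space of [X0] by increasing load; [l] and [k] are the current load and
    coordinate, [C] the coordinates already picked. *)
Record pass_inv (ld : 'I_n -> nat) (l k : nat) (X : 'M[F]_n) (C : {set 'I_n}) :
  Prop := PassInv {
  pass_sub : (X <= X0)%MS;
  pass_done : forall i, i \in Z -> (ld i < l)%N || (ld i == l) && (i < k)%N ->
    col i X = 0;
  pass_rank : (\rank X0 <= \rank X + #|C|)%N;
  pass_pick : forall i, i \in C ->
    [/\ i \in Z, (ld i <= l)%N, col i X = 0 & col i X0 != 0];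
  pass_wrong : forall h, (h <= l)%N ->
    (8 * (#|[set i in C :&: wrong | h <= ld i]| + \rank (X *m E wrong)) <=
      #|[set i in wrong | h <= ld i]|)%N }.

Lemma pass_start ld : pass_inv ld 0 0 X0 set0.
Proof.
split=> // [i _|||h].
- by rewrite ltn0 andbF.
- by rewrite cards0 addn0.
- by move=> i; rewrite inE.
- rewrite leqn0 => /eqP->.
  rewrite [X in (8 * (X + _))%N](_ : _ = 0%N) ?add0n; last first.
    by apply/eqP; rewrite cards_eq0; apply/eqP/setP=> i; rewrite !inE.
  rewrite [X in (_ <= X)%N](_ : _ = #|wrong|); last first.
    by apply: eq_card => i; rewrite !inE andbT.
  apply: leq_trans (incohT _); rewrite leq_mul2l /=.
  by apply: rank_wrong => // i ->.
Qed.

(** No pick so far has load above [l], and [X] vanishes by now at all coordinates of [Z] of load at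
    most [l]. For the new threshold [l.+1], [rank_wrong] therefore applies with [P] the wrong
    coordinates of larger load, and [incohT] supplies the factor 8. *)
Lemma pass_level ld l X C : pass_inv ld l n X C -> pass_inv ld l.+1 0 X C.
Proof.
case=> sX dX rX pX wX; split=> // [i iZ|i /pX[]|h].
- rewrite andbF orbF ltnS leq_eqVlt orbC => ldi; apply: dX => //.
  by rewrite ltn_ord andbT.
- by split=> //; lia.
- rewrite leq_eqVlt => /predU1P[->|]; last exact: wX.
  rewrite [X in (8 * (X + _))%N](_ : _ = 0%N) ?add0n; last first.
    apply/eqP; rewrite cards_eq0; apply/eqP/setP=> i; rewrite !inE.
    apply/negP => /andP[/andP[/pX[_ ? _ _] _]]; lia.
  apply: leq_trans (incohT _); rewrite leq_mul2l /=.
  apply: rank_wrong => // i iw; rewrite inE iw /= -leqNgt => ldi; apply: dX.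
    by move: iw; rewrite inE => /andP[].
  by rewrite ltn_ord andbT orbC -leq_eqVlt.
Qed.

Lemma pass_skip ld l X C (i : 'I_n) :
    pass_inv ld l i X C -> (i \in Z -> ld i = l -> col i X = 0) ->
  pass_inv ld l i.+1 X C.
Proof.
case=> sX dX rX pX wX iX; split=> // j jZ; rewrite ltnS (leq_eqVlt j).
case: (eqVneq j i) => [ji|ji].
  rewrite -ji in iX; case: (eqVneq (ld j) l) => [/(iX jZ)//|ldj].
  by rewrite orbF => ?; apply: dX; rewrite // (negPf ldj) /= orbF.
by rewrite (_ : (j == i :> nat) = false) //=; [exact: dX | exact/negbTE].
Qed.

(** A pick costs at most one dimension of [X]. If the picked coordinate is wrong, the rank of [X] on
    [wrong] drops strictly, which pays in [pass_wrong] for the new element of [C]. *)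
Lemma pass_add ld l X C (i f : 'I_n) :
    pass_inv ld l i X C -> i \in Z -> ld i = l -> X f i != 0 ->
  pass_inv ld l i.+1 (elimv X f (delta_mx i 0)) (i |: C) /\ i \notin C.
Proof.
case=> sX dX rX pX wX iZ ldi Xfi.
have ci : col i X != 0.
  by apply: contraNneq Xfi => /colP/(_ f); rewrite !mxE => ->.
have iC : i \notin C by apply: contra ci => /pX[_ _ -> _].
have piv : X *m delta_mx i (0 : 'I_1) != 0 -> (X *m delta_mx i 0) f (0 : 'I_1) != 0.
  by rewrite -colE mxE.
set X' := elimv _ _ _; have X'X : (X' <= X)%MS by exact: elimv_sub.
have ciX' : col i X' = 0 by rewrite colE; exact: mul_elimv.
split=> //; split.
- exact: submx_trans sX.
- move=> j jZ; rewrite ltnS (leq_eqVlt j).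
  have [-> _ //|ji] := eqVneq j i.
  rewrite (_ : (j == i :> nat) = false) /=; last exact/negbTE.
  by move/(dX j jZ); exact: col_sub0 X'X.
- by rewrite cardsU1 iC addnA addn1 (leq_trans rX) // leq_add2r rank_elimv_ge.
- move=> j; rewrite !inE => /predU1P[->|/pX[jZ ldj cj cj0]].
    split; rewrite // ?ldi //; apply: contra ci => /eqP c0.
    by apply/eqP; apply: col_sub0 sX c0.
  by split=> //; apply: col_sub0 X'X cj.
move=> h hl; apply: leq_trans (wX h hl); rewrite leq_mul2l /=.
have rX' : (\rank (X' *m E wrong) <= \rank (X *m E wrong))%N.
  by rewrite mxrankS // submxMr.
have [iw|iw] := boolP (i \in wrong); last first.
  apply: leq_add rX'; apply: subset_leq_card; apply/subsetP=> j.
  rewrite !inE => /andP[/andP[/predU1P[->|->]]]; last by move=> -> ->.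
  by move: iw; rewrite inE => /negPf->.
apply: (@leq_trans (#|[set j in C :&: wrong | (h <= ld j)%N]|.+1 +
                    \rank (X' *m E wrong))).
  rewrite leq_add2r -[leqRHS]add1n -(cards1 i).
  apply: leq_trans (leq_card_setU _ _); apply: subset_leq_card.
  apply/subsetP=> j; rewrite !inE => /andP[/andP[/predU1P[->|->]]]; rewrite ?eqxx //.
  by move=> -> ->; rewrite orbT.
rewrite addSnnS leq_add2l; apply: rank_ltmx; rewrite ltmxErank ?submxMr //=.
(* With equal ranks the restrictions of [X] and [X'] to [wrong] would span the same space, and
   column [i] of [X] would vanish along with that of [X']. *)
rewrite ltn_neqAle rX' andbT; apply: contra ci => /eqP rE.
have : (X *m E wrong <= X' *m E wrong)%MS.
  by have /mxrank_leqif_sup/leqifP := submxMr (E wrong) X'X; case: ifP => // _; rewrite rE ltnn.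
move/col_sub0 => /(_ i); rewrite !colE -!mulmxA.
have -> : E wrong *m delta_mx i (0 : 'I_1) = delta_mx i 0.
  apply/colP=> j; rewrite mul_diag_mx !mxE.
  by case: (eqVneq j i) => [->|_]; rewrite ?iw ?mulr0 ?mul1r.
by rewrite -!colE ciX' => ->.
Qed.

(** At the end [X] vanishes on [Z], so the picks account for the whole rank of [X0] on [Z]. The
    weighted bound comes from the bounds in [pass_wrong] by summation by parts over the thresholds
    [h]. *)
Lemma pass_stop ld l X C :
    pass_inv ld l 0 X C -> (forall i, i \in Z -> (ld i < l)%N) ->
  (\rank (X0 *m E Z) <= #|C|)%N /\
  (8 * \sum_(i in C :&: wrong) 2 ^ ld i <= \sum_(i in wrong) 2 ^ ld i)%N.
Proof.
case=> sX dX rX pX wX ldl; split.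
  have XZ : X *m E Z = 0.
    by apply/eqP/mul_coordmx0P => j jZ; apply: dX; rewrite ?ldl.
  have : (\rank X <= \rank (X0 :&: kermx (E Z))%MS)%N.
    by rewrite mxrankS // sub_capmx sX; apply/sub_kermxP.
  have := mxrank_mul_ker X0 (E Z); move: rX.
  by move: (\rank _) (\rank _) (\rank _) (\rank _) => *; lia.
(* The increments of the powers of 2: a coordinate of load [k] collects [a h] for every [h <= k]. *)
pose a h := if h is h'.+1 then (2 ^ h')%N else 1%N.
have powE k : (k <= l)%N -> (2 ^ k = \sum_(h < l.+1) a h * (h <= k))%N.
  move=> kl; rewrite -(big_mkord xpredT (fun h => a h * (h <= k))%N).
  rewrite (big_cat_nat (n := k.+1)) //= addnC big_nat_cond big1 ?add0n; last first.
    by move=> h; case: leqP; rewrite ?muln0 //; lia.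
  elim: k kl => [|k IH] kl; first by rewrite big_nat1.
  rewrite big_nat_recr //= leqnn muln1.
  rewrite expnS mul2n -addnn; congr addn; rewrite IH 1?ltnW //.
  by apply: eq_big_nat => h /andP[_ hk]; rewrite -ltnS hk leqW.
have sumE (A : {set 'I_n}) : A \subset Z ->
    (\sum_(i in A) 2 ^ ld i =
      \sum_(h < l.+1) a h * #|[set i in A | h <= ld i]|)%N.
  move=> /subsetP AZ; under eq_bigr => i iA do rewrite powE ?(ltnW (ldl i _)) ?AZ //.
  rewrite exchange_big /=; apply: eq_bigr => h _.
  rewrite -big_distrr /=; congr muln; rewrite -sum1_card big_mkcond [RHS]big_mkcond.
  by apply: eq_bigr => i _; rewrite inE; case: ifP => //=; case: leqP.
have wZ : wrong \subset Z by apply/subsetP=> i; rewrite inE => /andP[].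
rewrite !sumE ?(subset_trans (subsetIr _ _)) // big_distrr /=.
apply: leq_sum => h _; rewrite mulnCA leq_mul2l; apply/orP; right.
by apply: leq_trans (wX h _); rewrite ?leq_mul2l ?leq_addr // -ltnS.
Qed.

(** Of the coordinates in [wrong], those picked in a round carry at most an eighth
    of the total of [2 ^ ld], so this total grows by at most 9/8. *)
Record load_inv (r : nat) (ld : 'I_n -> nat) : Prop := LoadInv {
  load_le : forall i, (ld i <= r)%N;
  load_pos : forall i, (0 < ld i)%N -> (i \in Z) && (col i X0 != 0);
  load_sum : (r * \rank (X0 *m E Z) <= \sum_(i in Z) ld i)%N;
  load_wrong : (8 ^ r * \sum_(i in wrong) 2 ^ ld i <= 9 ^ r * #|wrong|)%N }.

Lemma load_inv0 ld : (forall i, ld i = 0%N) -> load_inv 0 ld.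
Proof.
move=> ld0; split=> [i|i||]; rewrite ?ld0 //.
by under eq_bigr => i _ do rewrite ld0; rewrite sum1_card.
Qed.

Lemma load_invS r ld ld' l X C :
    load_inv r ld -> pass_inv ld l 0 X C -> (r < l)%N ->
    (forall i, ld' i = (ld i + (i \in C))%N) ->
  load_inv r.+1 ld'.
Proof.
case=> ler pos sm wr pi rl ld'E.
have [rZ wZ] := pass_stop pi (fun i _ => leq_ltn_trans (ler i) rl).
have CZ : C \subset Z by apply/subsetP=> i /(pass_pick pi)[].
split.
- by move=> i; rewrite ld'E; have := ler i; case: (_ \in _); lia.
- move=> i; rewrite ld'E; case: (boolP (i \in C)) => [/(pass_pick pi)[-> _ _ ->]//|_].
  by rewrite addn0; apply: pos.
- under eq_bigr => i _ do rewrite ld'E.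
  rewrite big_split /= mulSn addnC leq_add //; apply: leq_trans rZ _.
  rewrite -sum1_card big_mkcond [leqRHS]big_mkcond; apply: leq_sum => i _.
  by case: ifP => // /(subsetP CZ) ->.
(* A pick doubles the weight of its coordinate, so the total grows by the old weight of the wrong
   picks. *)
have -> : (\sum_(i in wrong) 2 ^ ld' i =
    \sum_(i in wrong) 2 ^ ld i + \sum_(i in C :&: wrong) 2 ^ ld i)%N.
  rewrite [X in (_ + X)%N]big_mkcond [X in (X + _)%N]big_mkcond [LHS]big_mkcond.
  rewrite -big_split; apply: eq_bigr => i _; rewrite ld'E !inE.
  by case: (i \in C); case: ifP => //=; rewrite ?addn1 ?addn0 // expnS mul2n addnn.
move: (\sum_(i in wrong) _)%N (\sum_(i in C :&: wrong) _)%N wr wZ => S S1 wr wZ.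
rewrite expnSr -mulnA mulnDr (leq_trans (_ : _ <= 8 ^ r * (9 * S))%N) //.
  by rewrite leq_mul2l; apply/orP; right; lia.
by rewrite mulnCA (expnS 9) -mulnA leq_mul2l.
Qed.

(** A wrong coordinate of load at least [2 * b] would give [8 ^ (4 * b) * 2 ^ (2 * b) <= 9 ^ (4 * b)
    * n], hence [2 ^ b <= n], because [9 ^ 4 * 2 <= 8 ^ 4 * 2 ^ 2]. For the count, [#|I|] and the
    rank of [T :&: E Z] are at most [#|Z| / 8], so the loads in [Z] add up to at least
    [3 * b * #|Z|], while each is at most [4 * b]. *)
Lemma load_end b ld I : (n < 2 ^ b)%N -> load_inv (4 * b) ld ->
    (kermx T :&: kermx (E I) <= X0)%MS -> (#|I| <= \rank (T :&: E Z)%MS)%N ->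
  (forall i, i \in Z -> (2 * b <= ld i)%N -> e 0 i = 0) /\
  (2 * #|[set i in Z | ld i < 2 * b]| <= #|Z|)%N.
Proof.
move=> nb [ler pos sm wr] NX Iu; split.
  move=> i iZ ldi; apply/eqP; apply: contraTT nb => ei; rewrite -leqNgt.
  have n0 : (0 < n)%N by case: (n) i {iZ ldi ei} => [[]|].
  have [->//|b0] := posnP b.
  have /pos/andP[_ ci] : (0 < ld i)%N by apply: leq_trans ldi; rewrite muln_gt0.
  have iw : i \in wrong by rewrite inE iZ ei ci.
  have : (8 ^ (4 * b) * 2 ^ (2 * b) <= 9 ^ (4 * b) * n)%N.
    apply: leq_trans (leq_trans wr _).
      by rewrite leq_mul2l (bigD1 i) //= (leq_trans _ (leq_addr _ _)) ?orbT ?leq_exp2l.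
    by rewrite leq_mul2l (leq_trans (max_card _)) ?card_ord ?orbT.
  rewrite !expnM -expnMn => le1; rewrite leqNgt; apply/negP => nb.
  have : ((9 ^ 4) ^ b * n < (9 ^ 4 * 2) ^ b)%N.
    by rewrite [ltnRHS]expnMn ltn_pmul2l ?expn_gt0.
  rewrite ltnNge => /negP; apply; apply: leq_trans le1.
  have c : (9 ^ 4 * 2 <= 8 ^ 4 * 2 ^ 2)%N by lia.
  by rewrite leq_exp2r.
(* For [b = 0] the hypothesis forces [n = 0], and there is no coordinate at all. *)
have [b0|b0] := posnP b.
  by rewrite b0 expn0 in nb; rewrite (_ : #|_| = 0%N) //; apply: eq_card0 => i;
    have := ltn_ord i; lia.
have uZ := incohT Z; have := rank_coord_ge Z NX; set Z' := [set i in Z | _].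
have : (\sum_(i in Z) ld i + 2 * b * #|Z'| <= 4 * b * #|Z|)%N.
  rewrite -!sum1_card !big_distrr /= [X in (X + _)%N]big_mkcond.
  rewrite [X in (_ + X)%N]big_mkcond [leqRHS]big_mkcond -big_split /=.
  apply: leq_sum => i _; rewrite inE; case: (i \in Z) => //=.
  by case: ifP; have := ler i; lia.
move: sm uZ Iu; move: (\sum_(i in Z) _)%N #|Z'| #|Z| #|I| (\rank _) (\rank _).
move=> s z' z i u r; nia.
Qed.

End Stage.

(** * Incoherence *)

Section Leverage.
Variable R : realType.

Lemma mxtrace_mulT_ge0 m n (A : 'M[R]_(m, n)) : 0 <= \tr (A^T *m A).
Proof.
apply: sumr_ge0 => i _; rewrite mxE; apply: sumr_ge0 => j _.
by rewrite mxE -expr2 sqr_ge0.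
Qed.

Lemma mulmxT_eq0 m n (A : 'M[R]_(m, n)) : A *m A^T = 0 -> A = 0.
Proof.
move=> /matrixP A0; apply/matrixP=> i j; move: (A0 i i); rewrite !mxE => /eqP.
rewrite psumr_eq0 => [/allP/(_ j)|? _]; last by rewrite mxE -expr2 sqr_ge0.
by rewrite mem_index_enum mxE -expr2 sqrf_eq0 => /(_ isT)/eqP.
Qed.

Section Proj.
Variables (k n : nat) (U : 'M[R]_(k, n)).
Local Notation P := (orthoproj U).

Lemma orthoproj_cap : (<<U>> :&: kermx U^T)%MS = 0.
Proof.
set A := (_ :&: _)%MS.
have /submxP[B AE] : (A <= U)%MS by rewrite (submx_trans (capmxSl _ _)) ?genmxE.
have : A *m U^T = 0 by apply/sub_kermxP; exact: capmxSr.
by move=> AU; apply: mulmxT_eq0; rewrite {2}AE trmx_mul mulmxA AU mul0mx.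
Qed.

Lemma orthoproj_full p (W : 'M[R]_(p, n)) : (W <= <<U>> + kermx U^T)%MS.
Proof.
apply: submx_full; rewrite /row_full; apply/eqP.
have := mxrank_sum_cap <<U>>%MS (kermx U^T).
rewrite orthoproj_cap mxrank0 addn0 => ->.
by rewrite genmxE mxrank_ker mxrank_tr subnKC // rank_leq_col.
Qed.

Lemma orthoproj_id p (W : 'M[R]_(p, n)) : (W <= U)%MS -> W *m P = W.
Proof. by move=> WU; rewrite proj_mx_id ?orthoproj_cap ?genmxE. Qed.

(** The rows of [1 - P] are orthogonal to [U], which contains the rows of [P], so [(1 - P) *m P^T]
    vanishes. Symmetry and idempotence of [P] both follow from this identity. *)
Lemma orthoproj_tr_mul : P *m P^T = P.
Proof.
have /submxP[B PE] : (P <= U)%MS.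
  by rewrite -[P]mul1mx (submx_trans (proj_mx_sub _ _ _)) ?genmxE.
have : (1%:M - P) *m U^T = 0.
  apply/sub_kermxP; rewrite -[X in _ - X]mul1mx.
  by apply: proj_mx_compl_sub; exact: orthoproj_full.
move=> QU; apply: trmx_inj; apply/eqP; rewrite trmx_mul trmxK -subr_eq0.
rewrite -oppr_eq0 opprB -{1}[P^T]mul1mx -mulmxBl.
by rewrite {2}PE trmx_mul mulmxA QU mul0mx.
Qed.

Lemma orthoproj_tr : P^T = P.
Proof. by rewrite -[in LHS]orthoproj_tr_mul trmx_mul trmxK orthoproj_tr_mul. Qed.

(** The leverage scores are the diagonal entries of the projection; sums of them can then be
    compared with traces. *)
Lemma normsq_orthoproj i : normsq (delta_mx 0 i *m P) = P i i.
Proof.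
rewrite -[in RHS]orthoproj_tr_mul [in RHS]mxE; apply: eq_bigr => j _.
by rewrite -rowE !mxE expr2.
Qed.

(** The orthogonal projection onto [W] has trace [\rank W] and is dominated by
    the compression of [P] to the coordinates in [S]. *)
Lemma rank_le_leverage p (W : 'M[R]_(p, n)) (S : {set 'I_n}) :
    (W <= U)%MS -> (W <= coordmx R S)%MS ->
  (\rank W)%:R <= \sum_(i in S) normsq (delta_mx 0 i *m P).
Proof.
move=> WU WS; set D := coordmx R S in WS *.
have := row_base_free W; have := eq_row_base W; move: (row_base W) => B eB freeB.
under eq_bigr => i _ do rewrite normsq_orthoproj.
have BP : B *m P = B by apply: orthoproj_id; rewrite eB.
have PT := orthoproj_tr; have PP : P *m P = P by rewrite -{2}PT orthoproj_tr_mul.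
move: (orthoproj U) BP PT PP => P0 BP PT PP.
have BD : B *m D = B by apply/sub_coordmxP; rewrite eB.
have DT : D^T = D by exact: tr_coordmx.
have uB : B *m B^T \in unitmx.
  rewrite -row_free_unit; apply: inj_row_free => v vB.
  apply: (row_free_inj freeB); rewrite mul0mx.
  by apply: mulmxT_eq0; rewrite trmx_mul -!mulmxA (mulmxA B) (mulmxA v) vB mul0mx.
(* [Q] is the orthogonal projection onto the row space of [W], written through the Gram matrix of
   the basis [B]; [M] is the compression of the projection onto [U]. *)
pose Q := B^T *m invmx (B *m B^T) *m B; pose M := D *m P0 *m D.
have QT : Q^T = Q by rewrite /Q !trmx_mul trmxK trmx_inv trmx_mul trmxK mulmxA.
have BM : B *m M = B by rewrite /M (mulmxA B (D *m P0) D) (mulmxA B D P0) BD BP BD.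
have QM : Q *m M = Q by rewrite /Q -(mulmxA _ B) BM.
have QQ : Q *m Q = Q.
  by rewrite {2}/Q /Q !mulmxA -(mulmxA _ B B^T) mulmxKV.
have MT : M^T = M by rewrite /M !trmx_mul PT DT mulmxA.
have MQ : M *m Q = Q by apply: trmx_inj; rewrite trmx_mul QT MT QM.
(* A factor exhibiting [M - Q] as positive semidefinite: it equals [C^T *m C], so its trace is
   nonnegative. *)
pose C := P0 *m D *m (1%:M - Q).
have CC : C^T *m C = M - Q.
  rewrite /C !trmx_mul PT DT linearB /= QT trmx1.
  rewrite -!mulmxA (mulmxA P0 P0) PP.
  rewrite (mulmxA D P0) (mulmxA (D *m P0) D) -/M mulmxBr mulmx1 MQ mulmxBl mul1mx.
  by rewrite mulmxBr QM QQ subrr subr0.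
have trQ : \tr Q = (\rank W)%:R.
  by rewrite /Q mxtrace_mulC mulmxA mulmxV // mxtrace1.
have := mxtrace_mulT_ge0 C; rewrite CC linearB /= trQ subr_ge0 => le1.
apply: le_trans le1 _; rewrite /mxtrace [leRHS]big_mkcond /=.
apply: ler_sum => i _; rewrite /M mul_coordmxE mul_diag_mx !mxE.
by case: (i \in S) => //; rewrite mul1r.
Qed.

(** Each of the [#|S|] leverage scores is at most [mu] times [\rank U / n], and [4 * m] times that
    is less than 1. Positive rank makes [S] nonempty, which gives strictness. *)
Lemma incoherent_rank (m : nat) (mu : R) (S : {set 'I_n}) :
    incoherent mu U -> 4 * mu * (\rank U)%:R * m%:R / n%:R < 1 ->
    (0 < \rank (U :&: coordmx R S)%MS)%N ->
  (4 * m * \rank (U :&: coordmx R S)%MS < #|S|)%N.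
Proof.
move=> incU lt1 w0; have := rank_le_leverage (capmxSl U _) (capmxSr _ (coordmx R S)).
have : (\rank (U :&: coordmx R S)%MS <= #|S|)%N.
  by rewrite -(rank_coordmx R S) mxrankS // capmxSr.
move: (\rank _) w0 => w w0 wS le1; rewrite -(ltr_nat R).
have : w%:R <= #|S|%:R * (mu * ((\rank U)%:R / n%:R)) :> R.
  apply: le_trans le1 _; rewrite -sumr_const mulr_suml.
  by apply: ler_sum => i _; rewrite mul1r.
have S0 : 0 < #|S|%:R :> R by rewrite ltr0n (leq_trans w0).
move/(ler_wpM2l (ler0n R (4 * m))); rewrite -natrM => /le_lt_trans; apply.
rewrite -[ltRHS]mulr1 mulrCA ltr_pM2l //; apply: le_lt_trans lt1.
by rewrite natrM; lra.
Qed.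

End Proj.
End Leverage.

Local Close Scope ring_scope.

(** * Programs with counted loops *)

(** Loops are counted, so that running times can be read off the syntax:
    [PFor x a p] runs [p] with the scalar [x] ranging below the scalar [a], a scalar
    being cell 0 of an array. *)
Inductive prog : Type :=
| PN (a : nat) (i e : nexp)
| PR (a : nat) (i : nexp) (e : rexp)
| PSeq of prog & prog
| PIf of bexp & prog & prog
| PFor (x a : nat) of prog
| PSkip.

Definition var (a : nat) : nexp := NGet a (NConst 0).

Fixpoint compile (p : prog) : cmd :=
  match p with
  | PN a i e => CNSet a i e
  | PR a i e => CRSet a i e
  | PSeq p q => CSeq (compile p) (compile q)
  | PIf b p q => CIf b (compile p) (compile q)
  | PFor x a p =>
      CSeq (CNSet x (NConst 0) (NConst 0))
        (CWhile (BNot (BNLe (var a) (var x)))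
          (CSeq (compile p) (CNSet x (NConst 0) (NAdd (var x) (NConst 1)))))
  | PSkip => CSkip
  end.

Fixpoint nmods (p : prog) : seq nat :=
  match p with
  | PN a _ _ => [:: a]
  | PR _ _ _ | PSkip => [::]
  | PSeq p q | PIf _ p q => nmods p ++ nmods q
  | PFor x _ p => x :: nmods p
  end.

Fixpoint rmods (p : prog) : seq nat :=
  match p with
  | PR a _ _ => [:: a]
  | PN _ _ _ | PSkip => [::]
  | PSeq p q | PIf _ p q => rmods p ++ rmods q
  | PFor _ _ p => rmods p
  end.

(** [cs] collects the loop bounds. They must stay constant throughout the program, and a counter
    must not be touched by its own body, so that iteration counts are known before the run. *)
Fixpoint well_scoped (cs : seq nat) (p : prog) : bool :=
  match p with
  | PN a _ _ => a \notin cs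
  | PR _ _ _ | PSkip => true
  | PSeq p q | PIf _ p q => well_scoped cs p && well_scoped cs q
  | PFor x a p =>
      [&& a \in cs, x \notin cs, x \notin nmods p & well_scoped cs p]
  end.

(** Expressions whose value does not exceed the values already in memory;
    [ps] lists scalars known to be positive. *)
Fixpoint small (ps : seq nat) (e : nexp) : bool :=
  match e with
  | NConst c => c <= 1
  | NGet _ _ => true
  | NSub e _ | NDiv e _ => small ps e
  | NMod e (NGet x (NConst 0)) => (x \in ps) || small ps e
  | NMod e _ => small ps e
  | NAdd _ _ | NMul _ _ => false
  end.

Fixpoint all_small (ps : seq nat) (p : prog) : bool :=
  match p with
  | PN _ _ e => small ps e
  | PR _ _ _ | PSkip => true
  | PSeq p q | PIf _ p q => all_small ps p && all_small ps q
  | PFor _ _ p => all_small ps p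
  end.

Fixpoint nsize (e : nexp) : nat :=
  match e with
  | NConst c => c.+1
  | NGet _ i => (nsize i).+1
  | NAdd e1 e2 | NSub e1 e2 | NMul e1 e2 | NDiv e1 e2 | NMod e1 e2 =>
      (nsize e1 + nsize e2).+1
  end.

Fixpoint rsize (e : rexp) : nat :=
  match e with
  | RZero | ROne => 1
  | RGet _ i => (nsize i).+1
  | RAdd e1 e2 | RSub e1 e2 | RMul e1 e2 | RDiv e1 e2 => (rsize e1 + rsize e2).+1
  end.

Fixpoint bsize (b : bexp) : nat :=
  match b with
  | BNLe e1 e2 => (nsize e1 + nsize e2).+1
  | BRLe e1 e2 => (rsize e1 + rsize e2).+1
  | BNot b => (bsize b).+1
  | BAnd b1 b2 => (bsize b1 + bsize b2).+1
  end.

(** The running time of [p] is bounded by [overhead p] times the largest product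
    [loop_weight] of nested loop bounds times the word length. *)
Fixpoint overhead (p : prog) : nat :=
  match p with
  | PN _ i e => (nsize i ^ 2 + nsize e ^ 2).+1
  | PR _ i e => (nsize i ^ 2 + rsize e ^ 2).+1
  | PSeq p q => overhead p + overhead q
  | PIf b p q => bsize b ^ 2 + (overhead p + overhead q)
  | PFor _ _ p => overhead p + 80
  | PSkip => 1
  end.

(** The [+ 1] pays for initializing the counter and for the final failing test, which occur even
    when the bound is 0. *)
Fixpoint loop_weight (val : nat -> nat) (p : prog) : nat :=
  match p with
  | PN _ _ _ | PR _ _ _ | PSkip => 1
  | PSeq p q | PIf _ p q => maxn (loop_weight val p) (loop_weight val q)
  | PFor _ a p => val a * loop_weight val p + 1
  end.

Lemma overhead_gt0 p : 0 < overhead p.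
Proof. by elim: p => //= *; lia. Qed.

Lemma loop_weight_gt0 val p : 0 < loop_weight val p.
Proof. by elim: p => //= *; lia. Qed.

Lemma well_scoped_nmods cs p : well_scoped cs p -> {in nmods p, forall a, a \notin cs}.
Proof.
elim: p => //= [a i e acs b|p IHp q IHq|b p IHp q IHq|x a p IH].
- by rewrite inE => /eqP->.
- by case/andP=> /IHp wp /IHq wq a; rewrite mem_cat => /orP[/wp|/wq].
- by case/andP=> /IHp wp /IHq wq a; rewrite mem_cat => /orP[/wp|/wq].
by case/and4P=> _ xcs _ /IH wp b; rewrite inE => /predU1P[->|/wp].
Qed.

(** * Denotation of programs, loop rules, and running time *)

Section Den.
Variable R : realType.
Implicit Types s : state R.

Definition nset s a i x := State (update (nmem s) a i x) (rmem s).

Fixpoint loop (f : state R -> state R) (x k : nat) s :=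
  if k is k'.+1 then
    let s' := f (loop f x k' s) in nset s' x 0 (nmem s' x 0).+1
  else nset s x 0 0.

(** A loop bound is read once, on entry, whereas the compiled loop reads it at every test; the two
    agree on well-scoped programs. *)
Fixpoint den (p : prog) s : state R :=
  match p with
  | PN a i e => nset s a (neval s i) (neval s e)
  | PR a i e => State (nmem s) (update (rmem s) a (neval s i) (reval s e))
  | PSeq p q => den q (den p s)
  | PIf b p q => if beval s b then den p s else den q s
  | PFor x a p => loop (den p) x (nmem s a 0) s
  | PSkip => s
  end.

Lemma nmem_den p s a i : a \notin nmods p -> nmem (den p s) a i = nmem s a i.
Proof.
elim: p s => //= [b j e s|p IHp q IHq s|b p IHp q IHq s|x b p IH s].
- by rewrite inE /update => /negPf->.
- by rewrite mem_cat negb_or => /andP[ap aq]; rewrite IHq // IHp.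
- by rewrite mem_cat negb_or => /andP[ap aq]; case: ifP; rewrite ?IHq ?IHp.
rewrite inE negb_or => /andP[/negPf ax ap].
elim: (nmem s b 0) => [|k IHk] /=; first by rewrite /update ax.
by rewrite {1}/update ax /= IH.
Qed.

Lemma rmem_den p s a i : a \notin rmods p -> rmem (den p s) a i = rmem s a i.
Proof.
elim: p s => //= [b j e s|p IHp q IHq s|b p IHp q IHq s|x b p IH s ap].
- by rewrite inE /update => /negPf->.
- by rewrite mem_cat negb_or => /andP[ap aq]; rewrite IHq // IHp.
- by rewrite mem_cat negb_or => /andP[ap aq]; case: ifP; rewrite ?IHq ?IHp.
by elim: (nmem s b 0) => //= k IHk; rewrite IH.
Qed.

Lemma nmem_loop f x k s : (forall s', nmem (f s') x 0 = nmem s' x 0) ->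
  nmem (loop f x k s) x 0 = k.
Proof. by move=> fx; elim: k => /= [|k IH]; rewrite /update !eqxx //= fx IH. Qed.

Section Loops.
Variables (I : nat -> state R -> Prop) (N x a : nat) (p : prog) (s : state R).
Hypotheses (xp : x \notin nmods p) (aN : nmem s a 0 = N) (I0 : I 0 (nset s x 0 0)).

Definition loop_pre k s' := [/\ I k s', nmem s' x 0 = k,
  forall b i, b \notin x :: nmods p -> nmem s' b i = nmem s b i &
  forall b i, b \notin rmods p -> rmem s' b i = rmem s b i].

Lemma loop_preP :
    (forall k s', k < N -> loop_pre k s' -> I k.+1 (nset (den p s') x 0 k.+1)) ->
  forall k, k <= N -> loop_pre k (loop (den p) x k s).
Proof.
move=> IS; elim=> [_|k IHk kN].
  split=> //= [|b i]; first by rewrite /update !eqxx.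
  by rewrite inE negb_or /update => /andP[/negPf->].
have [Ik lk fr frr] := IHk (ltnW kN); rewrite /= nmem_den // lk.
split=> /=; first by apply: IS.
- by rewrite /update !eqxx.
- move=> b i bxp; rewrite /update; move: (bxp); rewrite inE negb_or => /andP[/negPf-> bp] /=.
  by rewrite nmem_den // fr.
by move=> b i bp; rewrite rmem_den // frr.
Qed.

(** The invariant rule for loops. The framing of everything that the body does not modify is
    provided to the induction step, so that invariants only need to mention what changes. *)
Lemma den_for :
    (forall k s', k < N -> I k s' -> nmem s' x 0 = k ->
      (forall b i, b \notin x :: nmods p -> nmem s' b i = nmem s b i) ->
      (forall b i, b \notin rmods p -> rmem s' b i = rmem s b i) ->
      I k.+1 (nset (den p s') x 0 k.+1)) ->
  I N (den (PFor x a p) s).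
Proof.
move=> IS; rewrite /= aN.
suff [] : loop_pre N (loop (den p) x N s) by [].
by apply: loop_preP => // k s' kN [*]; apply: IS.
Qed.
End Loops.

Lemma den_if b p q s :
  den (PIf b p q) s = if beval s b then den p s else den q s.
Proof. by []. Qed.

Lemma den_seq p q s : den (PSeq p q) s = den q (den p s).
Proof. by []. Qed.

Section Cost.
Variable beta : nat.
Hypothesis beta_gt0 : 0 < beta.

Definition word_sized s := forall a i, nmem s a i < 2 ^ beta.

(** Only stored naturals have to fit in a word; intermediate values are controlled by the size of
    the expression. *)
Fixpoint safe (p : prog) s : Prop :=
  match p with
  | PN _ _ e => neval s e < 2 ^ beta
  | PR _ _ _ | PSkip => True
  | PSeq p q => safe p s /\ safe q (den p s)
  | PIf b p q => if beval s b then safe p s else safe q s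
  | PFor x a p => forall k, k < nmem s a 0 -> safe p (loop (den p) x k s)
  end.

Lemma safe_for (I : nat -> state R -> Prop) N x a p s :
    x \notin nmods p -> nmem s a 0 = N -> I 0 (nset s x 0 0) ->
    (forall k s', k < N -> I k s' -> nmem s' x 0 = k ->
      (forall b i, b \notin x :: nmods p -> nmem s' b i = nmem s b i) ->
      safe p s' /\ I k.+1 (nset (den p s') x 0 k.+1)) ->
  safe (PFor x a p) s /\ I N (den (PFor x a p) s).
Proof.
move=> xp aN I0 IS; split; last first.
  by apply: (den_for (I := I)) => // k s' kN Ik sk fr _; case: (IS k s').
have pre : forall k, k <= N -> loop_pre I x p s k (loop (den p) x k s).
  by apply: loop_preP => // k s' kN [Ik sk fr _]; case: (IS k s').
by rewrite /= aN => k kN; have [Ik sk fr _] := pre k (ltnW kN); case: (IS _ _ kN Ik sk fr).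
Qed.

Lemma word_sized_nset s a i x :
  word_sized s -> x < 2 ^ beta -> word_sized (nset s a i x).
Proof. by move=> ws xb b j /=; rewrite /update; case: ifP. Qed.

(** Bit lengths at most add up under multiplication, and the extra node absorbs the carry of an
    addition. *)
Lemma neval_bound s e : word_sized s -> neval s e < 2 ^ (beta * nsize e).
Proof.
move=> ws; have pow_le a b : a <= b -> 2 ^ a <= 2 ^ b by rewrite leq_exp2l.
have sz e' : 0 < beta * nsize e' by rewrite muln_gt0 beta_gt0; case: e'.
have mulS e1 e2 : 2 ^ (beta * nsize e1) * 2 ^ (beta * nsize e2) <=
    2 ^ (beta * (nsize e1 + nsize e2).+1).
  by rewrite -expnD -mulnDr pow_le // leq_mul2l leqW ?orbT.
have lt1 e1 e2 : 2 ^ (beta * nsize e1) <= 2 ^ (beta * (nsize e1 + nsize e2).+1).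
  by rewrite pow_le // leq_mul2l -addSn (leq_trans _ (leq_addr _ _)) ?leqnSn ?orbT.
elim: e => /= [c|a i _|e1 IH1 e2 IH2|e1 IH1 e2 _|e1 IH1 e2 IH2|e1 IH1 e2 _|e1 IH1 e2 _].
- by apply: leq_trans (ltn_expl c (ltnSn 1)) (pow_le _ _ _); nia.
- by apply: leq_trans (ws _ _) _; rewrite pow_le // leq_pmulr.
- apply: leq_trans (mulS e1 e2); move: (pow_le 1 _ (sz e1)) (pow_le 1 _ (sz e2)).
  by rewrite expn1; move: IH1 IH2; set x := 2 ^ _; set y := 2 ^ _; nia.
- by apply: leq_trans (lt1 e1 e2); apply: leq_ltn_trans IH1; exact: leq_subr.
- by apply: leq_trans (mulS e1 e2); rewrite ltn_mul.
- by apply: leq_trans (lt1 e1 e2); apply: leq_ltn_trans IH1; exact: leq_div.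
- by apply: leq_trans (lt1 e1 e2); apply: leq_ltn_trans IH1; exact: leq_mod.
Qed.

Lemma bitlen_le x k : 0 < k -> x < 2 ^ k -> bitlen x <= k.
Proof.
case: k => // k _; rewrite /bitlen ltnS; case: x => [|x] xk; first by rewrite trunc_log0.
by rewrite -ltnS -(ltn_exp2l _ _ (ltnSn 1)) (leq_ltn_trans (trunc_logP _ _)).
Qed.

(** Each node is charged at most [beta] times the size of its subexpression, and there are at most
    [nsize e] nodes; hence the square. *)
Lemma ncost_le s e : word_sized s -> ncost s e <= beta * nsize e ^ 2.
Proof.
move=> ws; have bl e' : bitlen (neval s e') <= beta * nsize e'.
  by apply: bitlen_le (neval_bound _ ws); rewrite muln_gt0 beta_gt0; case: e'.
elim: e => [c|a i IH|e1 IH1 e2 IH2|e1 IH1 e2 IH2|e1 IH1 e2 IH2|e1 IH1 e2 IH2|e1 IH1 e2 IH2];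
  set e := (X in ncost _ X); have := bl e; rewrite [ncost _ _]/= [nsize _]/= -/e;
  move: (bitlen _) => ? ?; nia.
Qed.

Lemma rcost_le s e : word_sized s -> rcost s e <= beta * rsize e ^ 2.
Proof.
move=> ws; elim: e => [||a i|e1 IH1 e2 IH2|e1 IH1 e2 IH2|e1 IH1 e2 IH2|e1 IH1 e2 IH2] /=.
- by nia.
- by nia.
- by have := ncost_le i ws; nia.
- by nia.
- by nia.
- by nia.
- by nia.
Qed.

Lemma bcost_le s b : word_sized s -> bcost s b <= beta * bsize b ^ 2.
Proof.
move=> ws; elim: b => [e1 e2|e1 e2|b IH|b1 IH1 b2 IH2] /=.
- by have := ncost_le e1 ws; have := ncost_le e2 ws; nia.
- by have := rcost_le e1 ws; have := rcost_le e2 ws; nia.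
- by nia.
- by nia.
Qed.

(** By induction on the program. Bodies of loops leave the scalars in [cs] alone, so the test of the
    while loop always compares the counter with the same value, given by [val]. *)
Lemma exec_den cs val p s : well_scoped cs p -> {in cs, forall a, nmem s a 0 = val a} ->
    word_sized s -> safe p s ->
  word_sized (den p s) /\ exists2 t, exec s (compile p) (den p s) t &
    t <= beta * (overhead p * loop_weight val p).
Proof.
have agree_den q s' : well_scoped cs q -> {in cs, forall a, nmem s' a 0 = val a} ->
    {in cs, forall a, nmem (den q s') a 0 = val a}.
  move=> wq ag a acs; rewrite nmem_den ?ag //.
  by apply: contraL acs => /(well_scoped_nmods wq).
elim: p s => [a i e|a i e|p IHp q IHq|b p IHp q IHq|x a p IH|] s /=.
- move=> _ _ ws sf; split; first exact: word_sized_nset.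
  eexists; first exact: ExecNSet.
  by have := ncost_le i ws; have := ncost_le e ws; nia.
- move=> _ _ ws _; split=> //; eexists; first exact: ExecRSet.
  by have := ncost_le i ws; have := rcost_le e ws; nia.
- move=> /andP[wp wq] ag ws [sp sq].
  have [ws1 [t1 e1 l1]] := IHp _ wp ag ws sp.
  have [ws2 [t2 e2 l2]] := IHq _ wq (agree_den _ _ wp ag) ws1 sq.
  split=> //; eexists; first exact: ExecSeq e1 e2.
  rewrite (leq_trans (leq_add l1 l2)) // -mulnDr leq_mul2l mulnDl.
  by rewrite leq_add ?leq_mul2l ?leq_maxl ?leq_maxr ?orbT.
- move=> /andP[wp wq] ag ws; have lb := bcost_le b ws; have := overhead_gt0 p.
  have := overhead_gt0 q; have := loop_weight_gt0 val p; have := loop_weight_gt0 val q.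
  case: ifP => sb w1 w2 o1 o2.
    move=> /(IHp _ wp ag ws)[ws1 [t1 e1 l1]]; split=> //.
    eexists; first exact: ExecIfTrue e1.
    move: lb l1 w1 w2 o1 o2; set w := maxn _ _; have : loop_weight val p <= w by exact: leq_maxl.
    by move: w (loop_weight _ _) (loop_weight _ _) (overhead _) (overhead _) (bsize b) => *; nia.
  move=> /(IHq _ wq ag ws)[ws1 [t1 e1 l1]]; split=> //.
  eexists; first by apply: ExecIfFalse e1; rewrite sb.
  move: lb l1 w1 w2 o1 o2; set w := maxn _ _; have : loop_weight val q <= w by exact: leq_maxr.
  by move: w (loop_weight _ _) (loop_weight _ _) (overhead _) (overhead _) (bsize b) => *; nia.
- case/and4P=> acs xcs xp wp ag ws sf; rewrite (ag a acs) in sf *.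
  set tst := BNot _; set body := CSeq (compile p) _.
  have ws0 : word_sized (nset s x 0 0) by apply: word_sized_nset; rewrite ?expn_gt0.
  have ax : (a == x) = false by apply/negbTE; apply: contraNneq xcs => <-.
  pose st k := loop (den p) x k s; set N := val a.
  have agk k : {in cs, forall b, nmem (st k) b 0 = val b}.
    elim: k => [|k IHk] b bcs /=; rewrite /update.
      have -> : (b == x) = false by apply/negbTE; apply: contraNneq xcs => <-.
      exact: ag.
    have -> : (b == x) = false by apply/negbTE; apply: contraNneq xcs => <-.
    exact: agree_den.
  have xk k : nmem (st k) x 0 = k.
    by apply: nmem_loop => // s'; exact: nmem_den.
  have Nb : N < 2 ^ beta by rewrite /N -(ag a acs); exact: ws.
  (* 64 covers the overhead of one iteration: a test of size 6, an index of size 1, a sum of size 5,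
     all squared, and the unit charges of the counter update. *)
  pose tb := beta * (overhead p * loop_weight val p + 64).
  have step k : k < N -> word_sized (st k) ->
      word_sized (st k.+1) /\
      exists2 t, exec (st k) body (st k.+1) t & bcost (st k) tst + t <= tb.
    move=> kN wsk; have [ws1 [t1 e1 l1]] := IH _ wp (agk k) wsk (sf k kN).
    have x1 : nmem (den p (st k)) x 0 = k by rewrite nmem_den // xk.
    split; first by apply: word_sized_nset => //; rewrite x1 (leq_ltn_trans kN).
    eexists.
      have -> : st k.+1 = nset (den p (st k)) x (neval (den p (st k)) (NConst 0))
         (neval (den p (st k)) (NAdd (var x) (NConst 1))) by rewrite /= addn1.
      by rewrite /body; apply: ExecSeq e1 _; exact: ExecNSet.
    have := ncost_le (NConst 0) ws1; have := ncost_le (NAdd (var x) (NConst 1)) ws1.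
    have := bcost_le tst wsk; rewrite /tb; move: l1.
    move: (ncost _ _) (ncost _ _) (bcost _ _) (_ * loop_weight _ _) => c1 c2 c3 ow.
    by rewrite /=; nia.
  have wsk k : k <= N -> word_sized (st k).
    by elim: k => // k IHk kN; apply: (step k kN (IHk (ltnW kN))).1.
  (* Induction on the number [j] of iterations left; [6 ^ 2] is for the last test, which fails. *)
  have run j k : k + j = N -> exists2 t,
      exec (st k) (CWhile tst body) (st N) t & t <= j * tb + beta * 6 ^ 2.
    elim: j k => [|j IHj] k kj.
      rewrite addn0 in kj; rewrite kj; eexists.
        by apply: ExecWhileFalse; rewrite /= xk agk // leqnn.
      exact: bcost_le tst (wsk N (leqnn N)).
    have kN : k < N by lia.
    have [_ [t1 e1 l1]] := step k kN (wsk k (ltnW kN)).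
    have [|t2 e2 l2] := IHj k.+1; first by lia.
    eexists; first by apply: ExecWhileTrue e1 e2; rewrite /= xk agk // -ltnNge.
    by rewrite mulSn -!addnA; lia.
  split; first exact: wsk.
  have [t et lt] := run N 0 (add0n _).
  eexists; first by apply: ExecSeq et; exact: ExecNSet.
  have := ncost_le (NConst 0) ws; move: lt; rewrite /tb [nsize _]/=.
  have := loop_weight_gt0 val p; have := overhead_gt0 p; rewrite -/N.
  by move: (ncost _ _) (loop_weight _ _) (overhead _) => c w o; nia.
- by move=> _ _ ws _; split=> //; exists 1; [exact: ExecSkip | nia].
Qed.

Lemma small_bound ps s e : small ps e -> {in ps, forall x, 0 < nmem s x 0} ->
  word_sized s -> neval s e < 2 ^ beta.
Proof.
move=> + pos ws.
have b2 : 1 < 2 ^ beta by rewrite -{1}(expn0 2) ltn_exp2l.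
elim: e => [c|a i _|e1 _ e2 _|e1 IH1 e2 _|e1 _ e2 _|e1 IH1 e2 _|e1 IH1 e2 _] //=.
- by move=> c1; exact: leq_ltn_trans b2.
- by move/IH1; apply: leq_ltn_trans; exact: leq_subr.
- by move/IH1; apply: leq_ltn_trans; exact: leq_div.
have md x : neval s e1 < 2 ^ beta -> neval s e1 %% x < 2 ^ beta.
  by apply: leq_ltn_trans; exact: leq_mod.
case: e2 => [c|x i|? ?|? ?|? ?|? ?|? ?]; try by move/IH1/md; apply.
case: i => [[|c]|? ?|? ?|? ?|? ?|? ?|? ?]; try by move/IH1/md; apply.
case/orP=> [xps|]; last by move/IH1/md; apply.
by apply: leq_trans (ltn_pmod _ (pos x xps)) (ltnW (ws x 0)).
Qed.

(** Safety is thus decided by computation on the syntax. Programs meet the condition by reducing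
    sums modulo a positive scalar that exceeds them: the value is unchanged, and its bound becomes
    visible. *)
Lemma small_safe cs ps p s : well_scoped cs p -> all_small ps p -> {subset ps <= cs} ->
    {in ps, forall x, 0 < nmem s x 0} -> word_sized s ->
  safe p s /\ word_sized (den p s).
Proof.
move=> + + pc; elim: p s => [a i e|a i e|p IHp q IHq|b p IHp q IHq|x a p IH|] s //=.
- move=> _ se pos ws; have := small_bound se pos ws; split=> //.
  exact: word_sized_nset.
- move=> /andP[wp wq] /andP[mp mq] pos ws.
  have fr y : y \in cs -> nmem (den p s) y 0 = nmem s y 0.
    by move=> ycs; rewrite nmem_den //; apply: contraL ycs => /(well_scoped_nmods wp).
  have [sp ws1] := IHp s wp mp pos ws.
  have [|sq ws2] := IHq _ wq mq _ ws1.
    by move=> y yps; rewrite fr ?pc ?pos.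
  by [].
- move=> /andP[wp wq] /andP[mp mq] pos ws.
  by case: ifP => _; [exact: IHp | exact: IHq].
case/and4P=> acs xcs xp wp mp pos ws; pose st k := loop (den p) x k s.
have frk k y : y \in cs -> nmem (st k) y 0 = nmem s y 0.
  move=> ycs; have yx : (y == x) = false by apply/negbTE; apply: contraNneq xcs => <-.
  elim: k => [|k IHk] /=; rewrite /update yx //= nmem_den //.
  by apply: contraL ycs => /(well_scoped_nmods wp).
have step k : k <= nmem s a 0 ->
    word_sized (st k) /\ (forall j, j < k -> safe p (st j)).
  elim: k => [_|k IHk kN].
    by split=> //; apply: word_sized_nset; rewrite ?expn_gt0.
  have [wsk sfk] := IHk (ltnW kN).
  have [|sp ws1] := IH (st k) wp mp _ wsk.
    by move=> y yps; rewrite frk ?pc ?pos.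
  split; last by move=> j; rewrite ltnS leq_eqVlt => /predU1P[->|/sfk].
  apply: word_sized_nset => //.
  rewrite nmem_den // nmem_loop //; last by move=> s'; exact: nmem_den.
  exact: leq_ltn_trans kN (ws a 0).
have [wsN sfN] := step _ (leqnn _).
by split=> // k kN; exact: sfN.
Qed.

End Cost.
End Den.

Local Open Scope ring_scope.

(** * The completion program *)

Notation "p ;; q" := (PSeq p q) (at level 90, right associativity).

Definition rneq0 (e : rexp) : bexp := BNot (BAnd (BRLe e RZero) (BRLe RZero e)).
Definition neq (e1 e2 : nexp) : bexp := BAnd (BNLe e1 e2) (BNLe e2 e1).

(** Integer arrays 1-11 hold the values listed in [constants]; [known], [load] and
    [excl] are indexed by coordinates, and the other integer arrays are used as
    scalars. Real array [rG] is an [n] by [n + n] matrix stored by rows. *)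
Notation vn := 1%N (only parsing).
Notation vn2 := 2%N (only parsing).
Notation vm := 3%N (only parsing).
Notation vm1 := 4%N (only parsing).
Notation vnm := 5%N (only parsing).
Notation vsl := 6%N (only parsing).
Notation vb := 7%N (only parsing).
Notation vt := 8%N (only parsing).
Notation vt1 := 9%N (only parsing).
Notation vnn := 10%N (only parsing).
Notation pw := 11%N (only parsing).
Notation xi := 12%N (only parsing).
Notation xj := 13%N (only parsing).
Notation xf := 14%N (only parsing).
Notation xk := 15%N (only parsing).
Notation xr := 16%N (only parsing).
Notation vrow := 17%N (only parsing).
Notation known := 18%N (only parsing).
Notation load := 19%N (only parsing).
Notation excl := 20%N (only parsing).
Notation xround := 21%N (only parsing).
Notation xlevel := 22%N (only parsing).
Notation xstage := 23%N (only parsing).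
Notation base := 24%N (only parsing).
Notation xp := 25%N (only parsing).
Notation xq := 26%N (only parsing).
Notation xv := 27%N (only parsing).
Notation xsl := 28%N (only parsing).
Notation xsweep := 29%N (only parsing).
Notation xz := 30%N (only parsing).
Notation xh := 31%N (only parsing).

Notation rin := 0%N (only parsing).
Notation rout := 1%N (only parsing).
Notation rG := 2%N (only parsing).
Notation rsave := 3%N (only parsing).
Notation rdiag := 4%N (only parsing).
Notation rpiv := 5%N (only parsing).
Notation rmu := 6%N (only parsing).

Definition Gcell (i j : nexp) : nexp := NAdd (NMul i (var vn2)) j.
Definition Gget (i j : nexp) : rexp := RGet rG (Gcell i j).

(** Row 0 is the default when column [vrow] vanishes; a division by the pivot is then a division by
    0, which yields 0. *)
Definition find_pivot : prog :=
  PN xf (NConst 0) (NConst 0) ;;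
  PFor xj vn
    (PIf (rneq0 (Gget (var xj) (var vrow))) (PN xf (NConst 0) (var xj)) PSkip).

(** The pivot row and the multiplier are saved first, since the inner loop overwrites the cells from
    which they are computed. *)
Definition elim_row : prog :=
  find_pivot ;;
  PFor xi vn2 (PR rpiv (var xi) (Gget (var xf) (var xi))) ;;
  PFor xj vn
    (PR rmu (NConst 0) (RDiv (Gget (var xj) (var vrow)) (RGet rpiv (var vrow))) ;;
     PFor xi vn2
       (PR rG (Gcell (var xj) (var xi))
          (RSub (Gget (var xj) (var xi))
             (RMul (RGet rmu (NConst 0)) (RGet rpiv (var xi)))))).

Definition addr_exp (i j : nexp) : nexp :=
  NAdd (NAdd (var base) (NMul i (NGet pw (var xp)))) (NMul j (NGet pw (var xq))).

Definition is_zero (a : nat) (i : nexp) : bexp := BNLe (NGet a i) (NConst 0).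

Definition ycol : nexp := NAdd (var vn) (var xk).

Definition init_entry : prog :=
  PIf (neq (var xk) (var xi))
    (PR rG (Gcell (var xk) (var xi)) ROne ;;
     PR rG (Gcell (var xk) (NAdd (var vn) (var xi))) (RGet rdiag (var xi)))
    (PR rG (Gcell (var xk) (var xi)) RZero ;;
     PIf (BAnd (is_zero excl (var xk)) (is_zero excl (var xi)))
       (PR rG (Gcell (var xk) (NAdd (var vn) (var xi)))
          (RGet rout (addr_exp (var xk) (var xi))))
       (PR rG (Gcell (var xk) (NAdd (var vn) (var xi))) RZero)).

Definition init_rows : prog := PFor xk vn (PFor xi vn init_entry).

Definition elim_known : prog :=
  PFor xk vn
    (PIf (is_zero known (var xk)) PSkip
       (PN vrow (NConst 0) (NMod ycol (var vn2)) ;; elim_row)).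

(** Changing the guess at [k] by some [c] adds [c] times column [k] to column [n + k]; the guess is
    chosen to cancel the latter at a pivot row of the former. *)
Definition shear : prog :=
  PN vrow (NConst 0) (var xk) ;; find_pivot ;;
  PR rdiag (var xk)
    (RSub RZero (RDiv (Gget (var xf) ycol) (Gget (var xf) (var xk)))) ;;
  PFor xr vn
    (PR rG (Gcell (var xr) ycol)
       (RAdd (Gget (var xr) ycol)
          (RMul (RGet rdiag (var xk)) (Gget (var xr) (var xk))))).

Definition elim_unknown_step : prog :=
  shear ;;
  PN vrow (NConst 0) (NMod ycol (var vn2)) ;; find_pivot ;;
  PIf (rneq0 (Gget (var xf) (var vrow)))
    (PN vrow (NConst 0) (var xk) ;; elim_row ;;
     PN vrow (NConst 0) (NMod ycol (var vn2)) ;; elim_row)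
    PSkip.

Definition elim_unknown : prog :=
  PFor xk vn (PIf (is_zero known (var xk)) elim_unknown_step PSkip).

Definition pass_step : prog :=
  PIf (BAnd (is_zero known (var xk)) (neq (NGet load (var xk)) (var xlevel)))
    (PN vrow (NConst 0) (var xk) ;; find_pivot ;;
     PIf (rneq0 (Gget (var xf) (var vrow)))
       (PN load (var xk) (NMod (NAdd (NGet load (var xk)) (NConst 1)) (var vt1)) ;;
        elim_row)
       PSkip)
    PSkip.

Definition pass : prog :=
  PFor xr vnn (PR rG (var xr) (RGet rsave (var xr))) ;;
  PFor xlevel vt (PFor xk vn pass_step).

Definition rounds : prog :=
  PFor xk vn (PN load (var xk) (NConst 0)) ;;
  PFor xr vnn (PR rsave (var xr) (RGet rG (var xr))) ;;
  PFor xround vt pass.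

Definition mark_known : prog :=
  PFor xk vn
    (PIf (is_zero known (var xk))
       (PIf (BNLe (var vt) (NMul (NConst 2) (NGet load (var xk))))
          (PN known (var xk) (NConst 1))
          (PR rdiag (var xk) RZero))
       PSkip).

Definition stage : prog :=
  init_rows ;; elim_known ;; elim_unknown ;; rounds ;; mark_known.

Definition complete : prog :=
  PFor xk vn (PN known (var xk) (NConst 0) ;; PR rdiag (var xk) RZero) ;;
  PFor xstage vb stage.

(** The constants are described by a fixed [K] instead of a state, so that they are established once
    and then carried along by [env]. *)
Record constants (n m : nat) (K : nat -> nat -> nat) : Prop := Constants {
  const_n_gt0 : (0 < n)%N;
  const_n : K vn 0 = n;
  const_n2 : K vn2 0 = (n + n)%N;
  const_m : K vm 0 = m;
  const_m1 : K vm1 0 = m.+1;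
  const_nm : K vnm 0 = (n ^ m)%N;
  const_sl : K vsl 0 = (n ^ m %/ (n * n))%N;
  const_b : K vb 0 = bitlen n;
  const_t : K vt 0 = (4 * bitlen n)%N;
  const_t1 : K vt1 0 = (4 * bitlen n).+1;
  const_nn : K vnn 0 = (n * (n + n))%N;
  const_pw : forall l, (l <= m)%N -> K pw l = (n ^ l)%N }.

(** * Correctness of the completion program on one slice *)

Section Specs.
Variables (R : realType) (n m : nat) (K : nat -> nat -> nat).
Hypothesis HK : constants n m K.
Let n_gt0 := const_n_gt0 HK.
Let Kn := const_n HK.
Let Kn2 := const_n2 HK.
Let Kb := const_b HK.
Let Kt := const_t HK.
Let Kt1 := const_t1 HK.
Let Knn := const_nn HK.
Implicit Types s : state R.

Definition env s := forall a i, (0 < a < 12)%N -> nmem s a i = K a i.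

Lemma env_den p s : all (leq 12) (nmods p) -> env s -> env (den p s).
Proof.
move=> /allP ap es a i a12; rewrite nmem_den ?es //.
by apply/negP => /ap; move: a12; lia.
Qed.

Lemma env_frame (mods : seq nat) s s' : env s -> all (leq 12) mods ->
  (forall b i, b \notin mods -> nmem s' b i = nmem s b i) -> env s'.
Proof.
move=> es /allP am fr a i a12; rewrite fr ?es //.
by apply/negP => /am; move: a12; lia.
Qed.

Lemma env_n s : env s -> nmem s vn 0 = n.
Proof. by move->. Qed.

Lemma env_n2 s : env s -> nmem s vn2 0 = (n + n)%N.
Proof. by move->. Qed.

Lemma env_pw s i : env s -> nmem s pw i = K pw i.
Proof. by move->. Qed.

Definition Gmx s : 'M[R]_(n, n + n) := \matrix_(j, i) rmem s rG (j * (n + n) + i).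

Lemma cell_inj (c i j i' j' : nat) : (j < c)%N -> (j' < c)%N ->
  (i * c + j == i' * c + j')%N = (i == i') && (j == j').
Proof.
move=> jc j'c; apply/eqP/andP => [e|[/eqP-> /eqP->]//].
have := congr1 (divn^~ c) e; have := congr1 (modn^~ c) e.
have c0 : (0 < c)%N by exact: leq_ltn_trans jc.
by rewrite /= !modnMDl !modn_small // !divnMDl // !divn_small // !addn0 => -> ->.
Qed.

Lemma beval_rneq0 s e : beval s (rneq0 e) = (reval s e != 0).
Proof. by rewrite /= -eq_le. Qed.

Lemma den_find_pivot s (r : nat) : env s -> nmem s vrow 0 = r ->
  let f := nmem (den find_pivot s) xf 0 in
  (f < n)%N /\ forall j, (j < n)%N ->
    rmem s rG (j * (n + n) + r) != 0 -> rmem s rG (f * (n + n) + r) != 0.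
Proof.
move=> es sr; rewrite /find_pivot den_seq.
pose I k s' := (nmem s' xf 0 < n)%N /\ forall j, (j < k)%N ->
    rmem s rG (j * (n + n) + r) != 0 ->
    rmem s rG (nmem s' xf 0 * (n + n) + r) != 0.
apply: (den_for (I := I)) => //; first by rewrite /= /update /= es.
move=> k s' kn [fn If] sk fr frr; rewrite [den _ _]/= -eq_le.
rewrite sk !fr // frr //= /update /= (env_n2 es) sr.
rewrite /I; case: eqVneq => /= [g0|g0]; split=> //= j; rewrite ltnS leq_eqVlt.
  by move=> /predU1P[->|/If//]; rewrite g0 eqxx.
Qed.

Lemma GmxE s (j : 'I_n) (i : 'I_(n + n)) :
  Gmx s j i = rmem s rG (j * (n + n) + i).
Proof. by rewrite mxE. Qed.

Lemma den_elim_row s (r : 'I_(n + n)) : env s -> nmem s vrow 0 = r ->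
  exists2 f : 'I_n,
    (Gmx s *m delta_mx r (0 : 'I_1) != 0 -> (Gmx s *m delta_mx r (0 : 'I_1)) f 0 != 0) &
    Gmx (den elim_row s) = elimv (Gmx s) f (delta_mx r 0).
Proof.
move=> es sr; have [fn pf] := den_find_pivot es sr.
rewrite /elim_row den_seq; set s1 := den find_pivot s in fn pf *.
have es1 : env s1 by exact: env_den.
have G1 i : rmem s1 rG i = rmem s rG i by rewrite rmem_den.
have r1 : nmem s1 vrow 0 = r by rewrite nmem_den.
set f := nmem s1 xf 0 in fn pf; pose G j i := rmem s rG (j * (n + n) + i).
rewrite den_seq; set s2 := den _ s1.
have G2 i : rmem s2 rG i = rmem s rG i by rewrite rmem_den.
have r2 : nmem s2 vrow 0 = r by rewrite nmem_den.
have es2 : env s2 by exact: env_den.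
have piv2 i : (i < n + n)%N -> rmem s2 rpiv i = G f i.
  pose I k s' := forall i, (i < k)%N -> rmem s' rpiv i = G f i.
  move: i; rewrite -[forall i, _]/(I (n + n)%N s2); apply: den_for => //.
    exact: env_n2.
  move=> k s' kn Ik sk fr frr i; rewrite ltnS leq_eqVlt [den _ _]/= sk /update /=.
  rewrite !fr // frr //= (env_n2 es1) G1.
  by case: (eqVneq i k) => [->|_ /= /Ik].
pose upd j i := G j i - G j r / G f r * G f i.
(* Rows before [k] are updated, as are the first [k'] entries of row [k]. *)
pose J k k' s' := forall j i, (j < n)%N -> (i < n + n)%N ->
  rmem s' rG (j * (n + n) + i) =
    if (j < k)%N || (j == k) && (i < k')%N then upd j i else G j i.
have J3 : J n 0%N (den (PFor xj vn
    (PR rmu (NConst 0) (RDiv (Gget (var xj) (var vrow)) (RGet rpiv (var vrow))) ;;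
     PFor xi vn2
       (PR rG (Gcell (var xj) (var xi))
          (RSub (Gget (var xj) (var xi))
             (RMul (RGet rmu (NConst 0)) (RGet rpiv (var xi))))))) s2).
  apply: (den_for (I := fun k => J k 0%N)) => //; first exact: env_n.
    by move=> j i jn i2 /=; rewrite G2 andbF.
  move=> k s' kn Jk sk fr frr; rewrite den_seq; set s3 := den _ s'.
  have es3 : env s3 by apply: env_den => // a i a12; rewrite fr ?es2 // !inE; lia.
  have mu3 : rmem s3 rmu 0 = G k r / G f r.
    rewrite /s3 /= /update /= sk !fr // r2 (env_n2 es2) Jk // ltnn andbF.
    by rewrite frr // piv2.
  have k3 : nmem s3 xj 0 = k by [].
  have J3 : J k 0%N s3 by move=> j i jn i2; rewrite -Jk // rmem_den.
  have p3 i : (i < n + n)%N -> rmem s3 rpiv i = G f i.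
    by move=> i2; rewrite rmem_den // frr // piv2.
  clearbody s3.
  suff J4 : J k (n + n)%N (den (PFor xi vn2
       (PR rG (Gcell (var xj) (var xi))
          (RSub (Gget (var xj) (var xi))
             (RMul (RGet rmu (NConst 0)) (RGet rpiv (var xi)))))) s3).
    move=> j i jn i2 /=; rewrite J4 // i2 andbT andbF orbF ltnS.
    by rewrite (leq_eqVlt j k) orbC.
  apply: (den_for (I := J k)) => //; first exact: env_n2.
  move=> k' s4 k'n Jk' sk' fr' frr' j i jn i2.
  rewrite [den _ _]/= sk' !fr' // (frr' rmu) // (frr' rpiv) // k3 (env_n2 es3) mu3 p3 //=
    /update /=.
  rewrite cell_inj //; case: (eqVneq j k) => /= [->|jk]; last by rewrite Jk' // (negPf jk).
  rewrite ltnn /= ltnS leq_eqVlt; case: (eqVneq i k') => /= [->|ik];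
    last by rewrite Jk' // eqxx ltnn.
  by rewrite Jk' // eqxx !ltnn.
have delE (A : 'M[R]_(n, n + n)) : A *m delta_mx r (0 : 'I_1) = col r A by rewrite -colE.
exists (Ordinal fn).
  rewrite delE !mxE => /eqP c0; apply: contra_notN c0 => /eqP c0.
  apply/colP=> j; rewrite !mxE; apply/eqP; apply: contraTT isT => gj.
  by have := pf j (ltn_ord j) gj; rewrite c0 eqxx.
apply/matrixP=> j i; rewrite GmxE J3 // ltn_ord /= /elimv !delE !mxE big_ord1 !mxE.
by rewrite /upd /G /= mulrA [X in _ - X * _]mulrC.
Qed.

Definition dvec s : 'rV[R]_n := \row_i rmem s rdiag i.

(** The rows of [X *m extmx M] pair each row [x] of [X] with its product by [M]. The matrix in
    memory keeps this form, so [X] can be read off its left half. *)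
Definition extmx (M : 'M[R]_n) : 'M[R]_(n, n + n) := row_mx 1%:M M.

Lemma extmx_l M i : extmx M *m delta_mx (lshift n i) (0 : 'I_1) = delta_mx i 0.
Proof. by rewrite -colE; apply/colP=> j; rewrite mxE row_mxEl !mxE eqxx andbT. Qed.

Lemma extmx_r M i : extmx M *m delta_mx (rshift n i) (0 : 'I_1) = col i M.
Proof. by rewrite -colE; apply/colP=> j; rewrite mxE row_mxEr mxE. Qed.

Lemma den_elim_ext s (X M : 'M[R]_n) (r : 'I_(n + n)) :
    env s -> nmem s vrow 0 = r -> Gmx s = X *m extmx M ->
  let w := extmx M *m delta_mx r (0 : 'I_1) in
  exists2 f : 'I_n, (X *m w != 0 -> (X *m w) f 0 != 0) &
    Gmx (den elim_row s) = elimv X f w *m extmx M.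
Proof.
move=> es sr GX; have [f pf GE] := den_elim_row es sr; exists f.
  by rewrite mulmxA -GX.
by rewrite GE GX elimvM.
Qed.

Definition slice_addr s (j i : nat) : nat :=
  nmem s base 0 + j * K pw (nmem s xp 0) + i * K pw (nmem s xq 0).

Definition slice s : 'M[R]_n := \matrix_(j, i)
  if j == i then 0 else
  if (nmem s excl j == 0%N) && (nmem s excl i == 0%N) then
    rmem s rout (slice_addr s j i) else 0.

Lemma slice_den p s : all (fun a => a \notin [:: excl; base; xp; xq]) (nmods p) ->
  rout \notin rmods p -> slice (den p s) = slice s.
Proof.
move=> /allP ap rp; have fr a i : a \in [:: excl; base; xp; xq] ->
    nmem (den p s) a i = nmem s a i.
  by move=> ain; apply: nmem_den; apply/negP => /ap; rewrite ain.
by apply/matrixP=> j i; rewrite !mxE /slice_addr !fr // rmem_den.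
Qed.

Lemma dvec_den p s : rdiag \notin rmods p -> dvec (den p s) = dvec s.
Proof. by move=> rp; apply/rowP=> i; rewrite !mxE rmem_den. Qed.

Lemma Gmx_den p s : rG \notin rmods p -> Gmx (den p s) = Gmx s.
Proof. by move=> rp; apply/matrixP=> j i; rewrite !mxE rmem_den. Qed.

Lemma den_init s : env s ->
  Gmx (den init_rows s) = extmx (slice s + diag_mx (dvec s)).
Proof.
move=> es; pose E j i : R := if (i < n)%N then (j == i)%:R else
  if j == (i - n)%N then rmem s rdiag j else
  if (nmem s excl j == 0%N) && (nmem s excl (i - n) == 0%N) then
    rmem s rout (slice_addr s j (i - n)) else 0.
(* Each step fills columns [k'] and [n + k'] of row [k], hence the two ranges of finished
   columns. *)
pose J k k' s' := forall j i, (j < n)%N -> (i < n + n)%N ->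
  (j < k)%N || (j == k) && (i < k')%N || (j == k) && (n <= i < n + k')%N ->
  rmem s' rG (j * (n + n) + i) = E j i.
have Jn : J n 0%N (den init_rows s).
  apply: (den_for (I := fun k => J k 0%N)) => //; first exact: env_n.
    by move=> j i jn i2; rewrite !andbF orbF addn0; lia.
  move=> k s1 kn Jk sk fr frr.
  have es1 : env s1 by exact: env_frame fr.
  suff J4 : J k n (den (PFor xi vn init_entry) s1).
    by move=> j i jn i2 jk; rewrite J4 //; move: jk; lia.
  apply: (den_for (I := J k)) => //; first exact: env_n.
  move=> k' s2 k'n Jk' sk' fr' frr' j i jn i2 jk.
  have es2 : env s2 by exact: env_frame fr'.
  have k2 : nmem s2 xk 0 = k by rewrite fr'.
  have fr2 a i' : a \notin [:: xi; xk] -> nmem s2 a i' = nmem s a i'.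
    by rewrite !inE negb_or => /andP[/negPf a1 /negPf a2]; rewrite fr' ?fr //= !inE ?a1 ?a2.
  have frr2 a i' : a != rG -> rmem s2 a i' = rmem s a i'.
    by move=> /negPf a1; rewrite frr' ?frr //= !inE a1.
  have -> : den init_entry s2 = State (nmem s2)
     (update (update (rmem s2) rG (k * (n + n) + k') (E k k'))
        rG (k * (n + n) + (n + k')) (E k (n + k'))).
    rewrite /E k'n ltnNge leq_addr addKn /init_entry.
    rewrite [den _ _]/= -eqn_leq sk' k2 (env_n es2) (env_n2 es2).
    case: eqVneq => /= [<-|_]; first by rewrite /update /= frr2.
    by rewrite !fr2 // /update /= frr2 // !env_pw // !leqn0; case: ifP.
  rewrite /= /update /= !cell_inj //; try lia.
  case: (eqVneq j k) => [jE|jk'] /=; last by apply: Jk' => //; lia.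
  rewrite jE; case: (eqVneq i (n + k')) => [->//|i1].
  case: (eqVneq i k') => [->//|i0].
  by rewrite -jE; apply: Jk' => //; lia.
apply/matrixP=> j i; rewrite GmxE Jn ?ltn_ord // /E -(splitK i).
case: (split i) => i' /=; first by rewrite ltn_ord row_mxEl !mxE.
rewrite ltnNge leq_addr addKn row_mxEr !mxE /=.
case: (eqVneq (j : nat) i') => [/val_inj->|ji]; first by rewrite eqxx add0r mulr1n.
have -> : (j == i') = false by exact/negbTE.
by rewrite mulr0n addr0.
Qed.

Lemma elimv_mul0 (X : 'M[R]_n) f w (v : 'cV_n) : X *m v = 0 -> elimv X f w *m v = 0.
Proof.
by have /submxP[B ->] := elimv_sub X f w; rewrite -mulmxA => ->; rewrite mulmx0.
Qed.

Lemma sub_elimv_mx p (A : 'M[R]_(p, n)) (X : 'M[R]_n) f w :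
  (A <= X)%MS -> A *m w = 0 -> (A <= elimv X f w)%MS.
Proof.
move=> AX Aw; apply/row_subP=> i; apply: sub_elimv; first exact: submx_trans (row_sub _ _) AX.
by rewrite -row_mul Aw row0.
Qed.

Lemma col_add_diag (T : 'M[R]_n) (e : 'rV_n) i :
  col i (T + diag_mx e) = col i T + e 0 i *: delta_mx i 0.
Proof.
apply/colP=> j; rewrite !mxE andbT; case: eqVneq => [->|_]; last by rewrite mulr0n mulr0.
by rewrite mulr1n mulr1.
Qed.

Definition unknowns s : {set 'I_n} := [set i : 'I_n | nmem s known i == 0%N].

Lemma unknowns_den p s : known \notin nmods p -> unknowns (den p s) = unknowns s.
Proof. by move=> kp; apply/setP=> i; rewrite !inE nmem_den. Qed.

(** At a known coordinate the error is 0, so the eliminated column is a column of [T] and the kernel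
    of [T] survives. *)
Lemma den_elim_known s (T : 'M[R]_n) e :
    env s -> Gmx s = extmx (T + diag_mx e) ->
    (forall i, i \notin unknowns s -> e 0 i = 0) ->
  exists X : 'M[R]_n,
    [/\ Gmx (den elim_known s) = X *m extmx (T + diag_mx e), (kermx T <= X)%MS &
        forall i, i \notin unknowns s -> X *m col i (T + diag_mx e) = 0].
Proof.
move=> es GE e0; set M := T + _ in GE *.
pose I k s' := exists X : 'M[R]_n,
    [/\ Gmx s' = X *m extmx M, (kermx T <= X)%MS &
        forall i : 'I_n, (i < k)%N -> i \notin unknowns s -> X *m col i M = 0].
suff [X [GX kX X0]] : I n (den elim_known s).
  by exists X; split=> // i; exact: X0.
apply: (den_for (I := I)) => //; first exact: env_n.
  exists 1%:M; split=> //; last by rewrite submx1.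
  by rewrite mul1mx -GE.
move=> k s' kn [X [GX kX X0]] sk fr frr; pose k' := Ordinal kn.
have es' : env s' by exact: env_frame fr.
have s'k : nmem s' known k = nmem s known k by rewrite fr.
have kE : (k' \in unknowns s) = (nmem s known k == 0%N) by rewrite inE.
rewrite [den _ _]/= sk s'k leqn0 -kE; case: ifP => [kZ|/negbT kZ].
  exists X; split=> // i; rewrite ltnS leq_eqVlt => /predU1P[ik|/X0//].
  by rewrite (_ : i = k') ?kZ //; exact/val_inj.
set s1 := nset s' vrow 0 _.
have es1 : env s1 by apply: env_frame es' (erefl : all (leq 12) [:: vrow]) _ => b i;
  rewrite inE /= /update => /negPf->.
have r1 : nmem s1 vrow 0 = rshift n k'.
  by rewrite /s1 /= /update /= (env_n es') (env_n2 es') modn_small ?ltn_add2l.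
have [f pf GE1] := den_elim_ext es1 r1 (GX : Gmx s1 = _).
rewrite extmx_r in pf GE1.
exists (elimv X f (col k' M)); split; first exact: GE1.
  apply: sub_elimv_mx => //; rewrite col_add_diag e0 // scale0r addr0.
  by rewrite colE mulmxA mulmx_ker mul0mx.
move=> i; rewrite ltnS leq_eqVlt => /predU1P[ik _|ik iZ].
  by rewrite (_ : i = k') ?mul_elimv //; exact/val_inj.
by apply: elimv_mul0; exact: X0.
Qed.

Lemma mul_add_delta (X M : 'M[R]_n) c k j i :
  (X *m (M + c *: delta_mx k k)) j i =
  (X *m M) j i + c * (if i == k then X j k else 0).
Proof.
rewrite mulmxDr -scalemxAr mxE [(c *: _ : 'M_n) j i]mxE; congr (_ + c * _).
rewrite mxE (bigD1 k) //= big1 ?addr0 => [|l /negPf lk]; rewrite mxE ?eqxx ?lk ?mulr0 //=.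
by case: ifP; rewrite ?mulr1 ?mulr0.
Qed.

Lemma den_shear s (X M : 'M[R]_n) (k : 'I_n) :
    env s -> nmem s xk 0 = k -> Gmx s = X *m extmx M -> dvec s 0 k = 0 ->
  exists c f,
    [/\ Gmx (den shear s) = X *m extmx (M + c *: delta_mx k k),
        dvec (den shear s) = dvec s + c *: delta_mx 0 k &
        col k X != 0 -> X f k != 0 /\ (X *m col k (M + c *: delta_mx k k)) f 0 = 0].
Proof.
move=> es sk GX dk; rewrite /shear den_seq; set s1 := den (PN _ _ _) s.
have es1 : env s1 by exact: env_den.
have r1 : nmem s1 vrow 0 = k by rewrite /= /update /= sk.
have [fn pf] := den_find_pivot es1 r1; rewrite den_seq.
set s2 := den find_pivot s1 in fn pf *; pose f := Ordinal fn.
have es2 : env s2 by exact: env_den.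
have GE j i : rmem s2 rG (j * (n + n) + i) = rmem s rG (j * (n + n) + i).
  by rewrite rmem_den.
have XE (j : 'I_n) : rmem s rG (j * (n + n) + k) = X j k.
  have := congr1 (fun A : 'M_(n, n + n) => A j (lshift n k)) GX.
  by rewrite GmxE /= => ->; rewrite mul_mx_row row_mxEl mulmx1.
have YE (j i : 'I_n) : rmem s rG (j * (n + n) + (n + i)) = (X *m M) j i.
  have := congr1 (fun A : 'M_(n, n + n) => A j (rshift n i)) GX.
  by rewrite GmxE /= => ->; rewrite mul_mx_row row_mxEr.
pose c := - ((X *m M) f k / X f k).
rewrite den_seq; set s3 := den (PR _ _ _) s2.
have es3 : env s3 by exact: env_den.
have k3 : nmem s3 xk 0 = k by rewrite !nmem_den.
have d3 i : rmem s3 rdiag i = if i == k :> nat then c else rmem s rdiag i.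
  have k2 : nmem s2 xk 0 = k by rewrite !nmem_den.
  rewrite /= /update /= k2 (env_n2 es2) (env_n es2) !GE.
  by rewrite -[nmem s2 xf 0]/(f : nat) XE YE sub0r; case: eqP => // _; rewrite !rmem_den.
have G3 i : rmem s3 rG i = rmem s rG i by rewrite !rmem_den.
clearbody s3; pose J j s' := forall j' i, (j' < n)%N -> (i < n + n)%N ->
  rmem s' rG (j' * (n + n) + i) =
    if (j' < j)%N && (i == n + k)%N
    then rmem s rG (j' * (n + n) + i) + c * rmem s rG (j' * (n + n) + k)
    else rmem s rG (j' * (n + n) + i).
set p := PFor _ _ _; have Jn : J n (den p s3).
  apply: (den_for (I := J)) => //; first exact: env_n.
    by move=> j' i _ _; exact: G3.
  move=> j s' jn Jj sj fr frr j' i j'n i2.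
  rewrite [den _ _]/= sj !fr // (frr rdiag) // k3 (env_n es3) (env_n2 es3) d3 eqxx.
  rewrite /= /update /= !Jj // ?ltn_add2l // ?ltnn /=; last by rewrite ltn_addl.
  rewrite cell_inj //; last by rewrite ltn_add2l.
  rewrite ltnS (leq_eqVlt j' j).
  case: (eqVneq j' j) => [->|_] /=; last by case: eqVneq => [->|_]; rewrite ?andbF.
  by case: eqVneq => [->|_]; rewrite ?andbF ?ltnn.
exists c, f; split.
- apply/matrixP=> j i; rewrite GmxE Jn // ltn_ord mul_mx_row mulmx1 /= -(splitK i).
  case: (split i) => i' /=.
    rewrite row_mxEl (_ : (i' == n + k :> nat)%N = false).
      have := congr1 (fun A : 'M_(n, n + n) => A j (lshift n i')) GX.
      by rewrite GmxE /= => ->; rewrite mul_mx_row row_mxEl mulmx1.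
    by apply/negbTE; have := ltn_ord i'; lia.
  rewrite row_mxEr mul_add_delta eqn_add2l YE XE (_ : (i' == k :> nat) = (i' == k)) //.
  by case: ifP; rewrite ?mulr0 ?addr0.
- apply/rowP=> i; rewrite !mxE rmem_den // d3; case: (eqVneq i k) => [->|ik].
    by rewrite eqxx mulr1; move: dk; rewrite mxE => ->; rewrite add0r.
  by rewrite (_ : (i == k :> nat) = false) ?mulr0 ?addr0 //; exact/negbTE.
move=> ck; have Xf : X f k != 0.
  apply: contraNneq ck => Xf0; apply/eqP/colP=> j; rewrite !mxE.
  apply/eqP; apply: contraTT isT => Xj.
  have := pf j (ltn_ord j); rewrite -[rmem s1 rG]/(rmem s rG) XE => /(_ Xj).
  by rewrite -[nmem s2 xf 0]/(f : nat) XE Xf0 eqxx.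
split=> //; rewrite colE mulmxA -colE mxE mul_add_delta eqxx.
by rewrite mulNr divfK // subrr.
Qed.

Lemma den_elim_row_at s (X M : 'M[R]_n) (k : 'I_n) :
    env s -> nmem s vrow 0 = k -> Gmx s = X *m extmx M ->
  exists2 f : 'I_n, (col k X != 0 -> X f k != 0) &
    Gmx (den elim_row s) = elimv X f (delta_mx k 0) *m extmx M.
Proof.
move=> es sk GX; have rk : nmem s vrow 0 = lshift n k by [].
have [f] := den_elim_ext es rk GX; rewrite extmx_l => pf GE; exists f => //.
by rewrite colE => /pf; rewrite -colE mxE.
Qed.

Lemma den_set_ycol s (k : 'I_n) : env s -> nmem s xk 0 = k ->
  nmem (den (PN vrow (NConst 0) (NMod ycol (var vn2))) s) vrow 0 = rshift n k.
Proof.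
move=> es sk; rewrite /= /update /= sk (env_n es) (env_n2 es).
by rewrite modn_small // ltn_add2l.
Qed.

(** When the diagonal entry making [y_k] vanish at the pivot does not make it
    vanish everywhere, [x_k] and [y_k] are independent on the row space. *)
Lemma shear_independent (X X1 : 'M[R]_n) k f (c : 'cV_n) :
    X f k != 0 -> (X *m c) f 0 = 0 -> X *m c != 0 ->
    (forall h : 'rV_n, (h <= X)%MS -> h *m delta_mx k 0 = 0 :> 'M_1 -> (h <= X1)%MS) ->
  X1 *m c != 0.
Proof.
move=> Xf cf c0 sub1; apply: contra c0 => /eqP X1c.
apply/eqP/colP=> j; rewrite [RHS]mxE.
(* The multiple of the pivot row cancels coordinate [k] and leaves the product with [c] unchanged,
   since that product is 0 at row [f]. *)
pose h := row j X - (X j k / X f k) *: row f X.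
have hX : (h <= X)%MS by rewrite addmx_sub ?row_sub // eqmx_opp scalemx_sub ?row_sub.
have /submxP[B hB] : (h <= X1)%MS.
  apply: sub1 => //; apply/matrixP=> a b; rewrite !ord1 -colE !mxE.
  by rewrite divfK ?subrr.
have : (h *m c) 0 0 = 0 by rewrite hB -mulmxA X1c mulmx0 mxE.
by rewrite mulmxBl -scalemxAl -!row_mul; move: (X *m c) cf => A; rewrite !mxE => ->;
  rewrite mulr0 subr0.
Qed.

(** [b] records whether coordinate [k] is given up. The surviving vectors are described so that a
    kernel vector of the unknown matrix survives as soon as it vanishes at the coordinates given
    up. *)
Lemma den_elim_unknown_step s (X M : 'M[R]_n) (k : 'I_n) :
    env s -> nmem s xk 0 = k -> Gmx s = X *m extmx M -> dvec s 0 k = 0 ->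
  exists c (b : bool) X',
    let M' := M + c *: delta_mx k k in
    [/\ Gmx (den elim_unknown_step s) = X' *m extmx M',
        dvec (den elim_unknown_step s) = dvec s + c *: delta_mx 0 k,
        (X' <= X)%MS /\ X' *m col k M' = 0,
        forall h : 'rV_n, (h <= X)%MS -> (b -> h 0 k = 0) ->
          (h 0 k = 0 -> h *m col k M' = 0 :> 'M_1) -> (h <= X')%MS &
        (\rank X' + 2 * b <= \rank X)%N].
Proof.
move=> es sk GX dk; have [c [f [GS dS pS]]] := den_shear es sk GX dk.
set M' := M + _ in GS pS; exists c.
rewrite /elim_unknown_step den_seq; set s1 := den shear s in GS dS *.
have es1 : env s1 by exact: env_den.
have k1 : nmem s1 xk 0 = k by rewrite nmem_den.
rewrite [dvec (den _ s1)]dvec_den // dS.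
rewrite den_seq; have r2 := den_set_ycol es1 k1; set s2 := den _ s1 in r2 *.
have es2 : env s2 by exact: env_den.
have [] := den_find_pivot es2 r2.
rewrite den_seq; set s3 := den find_pivot s2 => fn pf.
have es3 : env s3 by exact: env_den.
have k3 : nmem s3 xk 0 = k by rewrite !nmem_den.
have G3 : Gmx s3 = X *m extmx M' by rewrite Gmx_den // Gmx_den.
have d3 : dvec s3 = dvec s1 by rewrite dvec_den // dvec_den.
have YE (j : 'I_n) : rmem s2 rG (j * (n + n) + rshift n k) = (X *m col k M') j 0.
  have := congr1 (fun A : 'M_(n, n + n) => A j (rshift n k)) GS.
  rewrite GmxE -[rmem s1 rG]/(rmem s2 rG) => ->.
  by rewrite mul_mx_row row_mxEr [in RHS]colE mulmxA -colE [in RHS]mxE.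
have cond : beval s3 (rneq0 (Gget (var xf) (var vrow))) =
    (X *m col k M' != 0).
  rewrite beval_rneq0 /= (env_n2 es3) (_ : nmem s3 vrow 0 = rshift n k); last first.
    by rewrite nmem_den.
  rewrite rmem_den // -[nmem s3 xf 0]/(Ordinal fn : nat) YE.
  apply/idP/idP; first by apply: contraNneq => ->; rewrite mxE.
  move=> /eqP nz; apply: contra_notN nz => /eqP f0; apply/colP=> j; rewrite [RHS]mxE.
  apply/eqP; apply: contraTT isT => gj.
  have := pf j (ltn_ord j); rewrite YE => /(_ gj).
  by rewrite -[nmem s3 xf 0]/(Ordinal fn : nat) YE f0 eqxx.
rewrite den_if cond; clearbody s3; case: eqVneq => [c0|cn0].
  by exists false, X; rewrite muln0 addn0 submx_refl; split.
rewrite den_seq; set s4 := den _ s3.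
have es4 : env s4 by exact: env_den.
have r4 : nmem s4 vrow 0 = k by rewrite /s4 /= /update /= k3.
have [f5 pf5 G5] := den_elim_row_at es4 r4 (G3 : Gmx s4 = _).
rewrite den_seq; set s5 := den elim_row s4 in G5 *.
have es5 : env s5 by exact: env_den.
have k5 : nmem s5 xk 0 = k by rewrite nmem_den.
rewrite den_seq; have r6 := den_set_ycol es5 k5; set s6 := den _ s5 in r6 *.
have es6 : env s6 by exact: env_den.
set X1 := elimv _ _ _ in G5.
have [f7 pf7 G7] := den_elim_ext es6 r6 (G5 : Gmx s6 = _).
(* Coordinate [k] counts as given up only if it does not already vanish on [X]; in that case both
   eliminations lower the rank. *)
rewrite extmx_r in pf7 G7; exists (col k X != 0), (elimv X1 f7 (col k M')).
have sX1 : (X1 <= X)%MS by exact: elimv_sub.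
have keep1 (h : 'rV_n) : (h <= X)%MS -> h *m delta_mx k 0 = 0 :> 'M_1 -> (h <= X1)%MS.
  exact: sub_elimv.
split.
- exact: G7.
- by [].
- by split; [exact: submx_trans (elimv_sub _ _ _) sX1 | exact: mul_elimv].
- move=> h hX hb hc; have hk : h 0 k = 0.
    have [Xk0|/hb//] := eqVneq (col k X) 0; have /col_sub0/(_ Xk0) := hX.
    by move/colP/(_ 0); rewrite !mxE.
  apply: sub_elimv (hc hk); apply: keep1 => //.
  by apply/matrixP=> a b; rewrite !ord1 -colE !mxE.
have := rank_elimv_ge X f5 (delta_mx k 0).
have [Xk0|Xk0] := eqVneq (col k X) 0.
  by move=> _; rewrite muln0 addn0 mxrankS // (submx_trans (elimv_sub _ _ _)).
have lt1 : (\rank X1 < \rank X)%N.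
  apply: rank_elimv_lt; rewrite -colE // => _; rewrite mxE; exact: pf5.
have [Xf cf] := pS Xk0.
have lt2 : (\rank (elimv X1 f7 (col k M')) < \rank X1)%N.
  by apply: rank_elimv_lt => //; exact: shear_independent Xf cf cn0 keep1.
by move=> _; lia.
Qed.

Definition diag_ok s (T : 'M[R]_n) :=
  forall i, dvec s 0 i = if i \in unknowns s then 0 else T i i.

Definition errv s (T : 'M[R]_n) : 'rV[R]_n := \row_i (dvec s 0 i - T i i).

Lemma errvE s T i : errv s T 0 i = dvec s 0 i - T i i.
Proof. by rewrite mxE. Qed.

Lemma add_diagE (T : 'M[R]_n) (e : 'rV_n) i j :
  (T + diag_mx e) i j = T i j + (if i == j then e 0 i else 0).
Proof. by rewrite !mxE; case: eqP. Qed.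

Definition slice_ok s (T : 'M[R]_n) := forall i j, i != j -> slice s i j = T i j.

Lemma slice_add_diag s T : slice_ok s T ->
  slice s + diag_mx (dvec s) = T + diag_mx (errv s T).
Proof.
move=> sT; apply/matrixP=> i j; rewrite !add_diagE errvE.
have [->|ij] := eqVneq i j; last by rewrite sT.
by rewrite [slice s j j]mxE eqxx add0r addrC subrK.
Qed.

(** Let [u] be the rank of [T] intersected with the unknown coordinates. Then [\rank X + 2 * #|I| <=
    \rank X0 <= u + \rank (kermx T)], whereas [X] contains the kernel vectors vanishing on [I], so
    that [\rank (kermx T) <= \rank X + #|I|]. Together these give [#|I| <= u]. *)
Lemma den_elim_unknown s (T X0 : 'M[R]_n) :
    env s -> T^T = T -> (forall i, i \notin unknowns s -> dvec s 0 i = T i i) ->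
    (forall i, i \in unknowns s -> dvec s 0 i = 0) ->
    Gmx s = X0 *m extmx (T + diag_mx (errv s T)) -> (kermx T <= X0)%MS ->
    (forall i, i \notin unknowns s -> X0 *m col i (T + diag_mx (errv s T)) = 0) ->
  let s' := den elim_unknown s in
  exists X (I : {set 'I_n}),
    [/\ Gmx s' = X *m extmx (T + diag_mx (errv s' T)),
        X *m (T + diag_mx (errv s' T)) = 0,
        forall i, i \notin unknowns s -> errv s' T 0 i = 0,
        (kermx T :&: kermx (coordmx R I) <= X)%MS &
        (#|I| <= \rank (T :&: coordmx R (unknowns s))%MS)%N].
Proof.
move=> es symT dk du GX0 kX0 X00; lazy zeta; set Z := unknowns s in dk du X00 *.
have rX0 : (\rank X0 <= \rank (T :&: coordmx R Z)%MS + \rank (kermx T))%N.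
  apply: rank_sub_known; apply: sub_coordmx => i j jZ.
  have := X00 j jZ; rewrite col_add_diag mxE dk // subrr scale0r addr0 colE mulmxA -colE.
  by move/colP/(_ i); rewrite !mxE.
pose J k s' := exists X (I : {set 'I_n}),
    [/\ Gmx s' = X *m extmx (T + diag_mx (errv s' T)),
        forall i : 'I_n, (i < k)%N || (i \notin Z) ->
          X *m col i (T + diag_mx (errv s' T)) = 0,
        forall i : 'I_n, (i \notin Z -> dvec s' 0 i = T i i) /\
          (i \in Z -> (k <= i)%N -> dvec s' 0 i = 0),
        (forall i, i \in I -> (i < k)%N) /\ (kermx T :&: kermx (coordmx R I) <= X)%MS &
        (\rank X + 2 * #|I| <= \rank X0)%N].
suff [X [I [GX X_0 d_0 [_ NX] rX]]] : J n (den elim_unknown s).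
  exists X, I; split=> //.
  - apply/matrixP=> i j; have := X_0 j; rewrite ltn_ord => /(_ isT)/colP/(_ i).
    by rewrite colE mulmxA -colE mxE => ->; rewrite !mxE.
  - by move=> i iZ; rewrite mxE; case: (d_0 i) => -> //; rewrite subrr.
  have := rank_ker_free T I; have := mxrankS NX; move: rX rX0.
  by move: (\rank _) (\rank _) (\rank _) (\rank _) (\rank _) => *; lia.
apply: (den_for (I := J)) => //; first exact: env_n.
  exists X0, set0; split=> //; last by rewrite cards0 addn0.
    by split; [exact: dk | move=> iZ _; exact: du].
  by split=> [i|]; rewrite ?inE ?(submx_trans (capmxSl _ _)).
move=> k s' kn [X [I [GX X_0 d_0 [Ik NX] rX]]] sk fr frr; pose k' := Ordinal kn.
have es' : env s' by exact: env_frame fr.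
have kE : (k' \in Z) = (nmem s' known k == 0%N) by rewrite inE fr.
rewrite den_if [beval _ _]/= sk leqn0 -kE; case: ifP => [kZ|/negbT kZ]; last first.
  exists X, I; split=> // [i|i|].
  - rewrite ltnS leq_eqVlt => /orP[/predU1P[ik|ik]|iZ]; apply: X_0; rewrite ?ik ?iZ ?orbT //.
    by rewrite (_ : i = k') ?kZ ?orbT //; exact/val_inj.
  - by case: (d_0 i) => d1 d2; split=> // iZ ki; apply: d2 => //; exact: ltnW.
  - by split=> // i /Ik /leqW.
have dk' : dvec s' 0 k' = 0 by case: (d_0 k') => _; apply.
have [c [b [X' [GX' dX' [sX' kX'] hX' rX']]]] := den_elim_unknown_step es' (sk : _ = k' :> nat)
  GX dk'.
set s1 := den elim_unknown_step s' in GX' dX' *.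
have dE i : dvec s1 0 i = dvec s' 0 i + (if i == k' then c else 0).
  by rewrite dX'; move: (dvec s') => v; rewrite !mxE eqxx; case: eqP => _; rewrite ?mulr1 ?mulr0.
(* A change of the guess by [c] is a change of the error by [c], so the matrix keeps the form [T]
   plus a diagonal error. *)
have eE : T + diag_mx (errv s' T) + c *: delta_mx k' k' = T + diag_mx (errv s1 T).
  apply/matrixP=> i j; rewrite add_diagE [LHS]mxE add_diagE !errvE dE.
  rewrite -addrA; congr (_ + _); rewrite !mxE -mulrb.
  have [->|ij] := eqVneq i j.
    by case: eqP => _; rewrite ?mulr1 ?mulr0 ?addr0 // addrAC.
  have -> : (i == k') && (j == k') = false.
    by apply: contraNF ij => /andP[/eqP-> /eqP->].
  by rewrite mulr0 addr0.
rewrite eE in GX' kX' hX'.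
clear eE; clearbody s1; rewrite -[J _ _]/(J k.+1 s1).
exists X', (if b then k' |: I else I); split.
- exact: GX'.
- move=> i; have [->//|ik] := eqVneq i k'.
  have ik' : (i == k :> nat) = false by exact/negbTE.
  rewrite ltnS leq_eqVlt ik' => /= iP.
  have -> : col i (T + diag_mx (errv s1 T)) = col i (T + diag_mx (errv s' T)).
    by rewrite !col_add_diag !errvE dE (negPf ik) addr0.
  have /submxP[B ->] := sX'; rewrite -mulmxA.
  by rewrite [X *m _]X_0 ?mulmx0.
- move=> i; case: (d_0 i) => d1 d2; rewrite dE; split=> [iZ|iZ ki].
    by rewrite d1 // (_ : (i == k') = false) ?addr0 //; apply: contraNF iZ => /eqP->.
  rewrite d2 // ?(ltnW ki) // (_ : (i == k') = false) ?addr0 //.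
  by apply/eqP=> ik; move: ki; rewrite ik /= ltnn.
- split=> [i|].
    case: b {rX' hX'} => [|/Ik/leqW//]; rewrite !inE => /predU1P[->|/Ik/leqW//].
    by rewrite ltnSn.
  apply/row_subP=> j; set h := row j _.
  have hT : h *m T = 0.
    by apply/sub_kermxP; rewrite (submx_trans (row_sub _ _)) ?capmxSl.
  have hI i : i \in (if b then k' |: I else I) -> h 0 i = 0.
    have : h *m coordmx R (if b then k' |: I else I) = 0.
      by apply/sub_kermxP; rewrite (submx_trans (row_sub _ _)) ?capmxSr.
    by move=> /eqP/mul_coordmx0P hI iI; have /colP/(_ 0) := hI i iI; rewrite !mxE.
  have hX : (h <= X)%MS.
    apply: submx_trans NX; rewrite sub_capmx; apply/andP; split; first exact/sub_kermxP.
    apply/sub_kermxP/eqP/mul_coordmx0P=> i iI; apply/colP=> a; rewrite ord1 [LHS]mxE [RHS]mxE hI //.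
    by case: (b); rewrite ?inE ?iI ?orbT.
  have hk : b -> h 0 k' = 0 by move=> bT; apply: hI; rewrite bT !inE eqxx.
  apply: hX' => // hk0; rewrite col_add_diag mulmxDr -scalemxAr.
  rewrite (_ : h *m col k' T = 0) ?add0r; last by rewrite colE mulmxA hT mul0mx.
  have -> : h *m delta_mx k' 0 = 0 :> 'M_1.
    by rewrite -colE; apply/colP=> a; rewrite ord1 [LHS]mxE [RHS]mxE hk0.
  exact: scaler0.
by move: rX rX'; rewrite (fun_if (fun A : {set 'I_n} => #|A|)) cardsU1; case: (b);
  case: (k' \notin I) => /=; lia.
Qed.

Lemma den_pivot_test s (r : 'I_(n + n)) : env s -> nmem s vrow 0 = r ->
  beval (den find_pivot s) (rneq0 (Gget (var xf) (var vrow))) = (col r (Gmx s) != 0).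
Proof.
move=> es sr; have [fn pf] := den_find_pivot es sr.
have ef : env (den find_pivot s) by exact: env_den.
have Gf i : rmem (den find_pivot s) rG i = rmem s rG i by rewrite rmem_den.
have rf : nmem (den find_pivot s) vrow 0 = r by rewrite nmem_den.
rewrite beval_rneq0; move: (den find_pivot s) ef Gf rf fn pf => s1 ef Gf rf fn pf.
rewrite [reval _ _]/= (env_n2 ef) Gf rf; set f := nmem s1 xf 0 in fn pf *.
have GE (j : 'I_n) : rmem s rG (j * (n + n) + r) = (col r (Gmx s)) j 0 by rewrite !mxE.
rewrite -[f in X in X != 0]/(Ordinal fn : nat) GE.
apply/idP/idP; first by apply: contraNneq => ->; rewrite mxE.
move=> /eqP nz; apply: contra_notN nz => /eqP f0; apply/colP=> j; rewrite [RHS]mxE.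
apply/eqP; apply: contraTT isT => gj; have := pf j (ltn_ord j).
by rewrite GE => /(_ gj); rewrite -[f]/(Ordinal fn : nat) GE f0 eqxx.
Qed.

Lemma col_extmx_l (X M : 'M[R]_n) k : col (lshift n k) (X *m extmx M) = col k X.
Proof. by rewrite colE -mulmxA extmx_l -colE. Qed.

Definition loads s (i : 'I_n) := nmem s load i.

(** [ld] holds the loads at the start of the pass; those in memory already count the picks in [C]. A
    coordinate picked at one level is therefore examined again at the next, but its column is 0 by
    then and it is skipped. *)
Lemma den_pass_step s e (X X0 M : 'M[R]_n) (Z C : {set 'I_n}) ld l (k : 'I_n) :
    env s -> nmem s xk 0 = k -> nmem s xlevel 0 = l -> (l < 4 * bitlen n)%N ->
    Z = unknowns s -> Gmx s = X *m extmx M -> pass_inv e Z X0 ld l k X C ->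
    (forall i, loads s i = (ld i + (i \in C))%N) ->
  exists X' C', let s' := den pass_step s in
    [/\ Gmx s' = X' *m extmx M, pass_inv e Z X0 ld l k.+1 X' C' &
        forall i, loads s' i = (ld i + (i \in C'))%N].
Proof.
move=> es sk sl lt ZE GX pi ldE; lazy zeta.
have kE : (k \in Z) = (nmem s known k == 0%N) by rewrite ZE inE.
have lk : nmem s load k = (ld k + (k \in C))%N := ldE k.
rewrite /pass_step den_if.
rewrite [beval s _](_ : _ = (k \in Z) && ((ld k + (k \in C))%N == l)); last first.
  by rewrite /= sk sl leqn0 -kE lk -eqn_leq.
have skip : ~~ ((k \in Z) && (ld k + (k \in C) == l)%N && (col k X != 0)) ->
    pass_inv e Z X0 ld l k.+1 X C.
  move=> nk; apply: pass_skip => // kZ ldk; apply/eqP.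
  have [/(pass_pick pi)[_ _ -> _]//|kC] := boolP (k \in C).
  by move: nk; rewrite kZ (negPf kC) addn0 ldk eqxx negbK.
case: ifP => [/andP[kZ /eqP ldk]|nk]; last first.
  by exists X, C; split=> //; apply: skip; rewrite nk.
rewrite den_seq; set s1 := den (PN _ _ _) s.
have es1 : env s1 by exact: env_den.
have r1 : nmem s1 vrow 0 = lshift n k by rewrite /s1 /= /update /= sk.
have G1 : Gmx s1 = X *m extmx M by rewrite Gmx_den.
rewrite den_seq; have tst := den_pivot_test es1 r1.
rewrite G1 col_extmx_l in tst; set s2 := den find_pivot s1 in tst *.
have es2 : env s2 by exact: env_den.
have r2 : nmem s2 vrow 0 = k by rewrite nmem_den.
have G2 : Gmx s2 = X *m extmx M by rewrite Gmx_den.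
have k2 : nmem s2 xk 0 = k by rewrite !nmem_den.
have ld2 i : loads s2 i = (ld i + (i \in C))%N by rewrite -ldE /loads !nmem_den.
rewrite den_if tst; clearbody s2.
case: (boolP (col k X != 0)) => ck; last first.
  by exists X, C; split=> //; apply: skip; rewrite (negPf ck) andbF.
rewrite den_seq; set s3 := den _ s2.
have es3 : env s3 by exact: env_den.
have [f pf GE] := den_elim_row_at es3 (r2 : nmem s3 vrow 0 = k) (G2 : Gmx s3 = _).
have kC : k \notin C by apply: contra ck => /(pass_pick pi)[_ _ -> _].
rewrite (negPf kC) addn0 in ldk.
have [pi' _] := pass_add pi kZ ldk (pf ck).
exists (elimv X f (delta_mx k 0)), (k |: C); split=> // i.
rewrite /loads nmem_den // /s3 /= /update /= k2 [nmem s2 load k]ld2 (negPf kC).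
rewrite !inE (_ : (i == k :> nat) = (i == k)) //; case: eqP => [->|_]; last exact: ld2.
by rewrite (es2 vt1 0%N) // Kt1 ldk addn0 modn_small ?ltnS // addn1.
Qed.

Lemma den_rounds s (T X : 'M[R]_n) e (Z : {set 'I_n}) :
    env s -> Z = unknowns s -> Gmx s = X *m extmx (T + diag_mx e) ->
    (forall i, i \notin Z -> e 0 i = 0) -> X *m (T + diag_mx e) = 0 ->
    (forall S : {set 'I_n}, (8 * \rank (T :&: coordmx R S)%MS <= #|S|)%N) ->
  load_inv e Z X (4 * bitlen n) (loads (den rounds s)).
Proof.
move=> es ZE GX e0 X0 inc; set M := T + _ in GX X0.
rewrite /rounds den_seq; set p1 := PFor xk vn _; set s1 := den p1 s.
have ld1 i : loads s1 i = 0%N.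
  pose I k s' := forall i, (i < k)%N -> nmem s' load i = 0%N.
  suff : I n s1 by move/(_ i (ltn_ord i)).
  apply: (den_for (I := I)) => //; first exact: env_n.
  move=> k s' kn Ik sk fr frr j; rewrite ltnS leq_eqVlt /= /update /= sk.
  by case: (eqVneq j k) => //= _ /Ik.
have es1 : env s1 by exact: env_den.
rewrite den_seq; set p2 := PFor xr vnn _; set s2 := den p2 s1.
have ld2 i : loads s2 i = 0%N by rewrite /loads nmem_den // -[RHS](ld1 i).
have es2 : env s2 by exact: env_den.
have sv2 a : (a < n * (n + n))%N -> rmem s2 rsave a = rmem s rG a.
  pose I k s' := forall a, (a < k)%N -> rmem s' rsave a = rmem s rG a.
  move: a; rewrite -[forall a, _]/(I (n * (n + n))%N s2).
  apply: (den_for (I := I)) => //; first by rewrite es1.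
  move=> k s' kn Ik sk fr frr j; rewrite ltnS leq_eqVlt /= /update /= sk frr // rmem_den //.
  by case: (eqVneq j k) => [->//|_ /= /Ik].
have Z2 : Z = unknowns s2 by rewrite ZE !unknowns_den.
clearbody s2; pose L r s' := load_inv e Z X r (loads s').
rewrite -[load_inv _ _ _ _ _]/(L (4 * bitlen n)%N (den (PFor xround vt pass) s2)).
apply: (den_for (I := L)) => //; first by rewrite es2.
  exact: load_inv0.
move=> r s' rt Lr sr fr frr.
have es' : env s' by exact: env_frame fr.
have Z' : Z = unknowns s' by rewrite Z2; apply/setP=> i; rewrite !inE fr.
have sv' a : (a < n * (n + n))%N -> rmem s' rsave a = rmem s rG a.
  by move=> an; rewrite frr // sv2.
rewrite /pass den_seq; set p3 := PFor xr vnn _; set s3 := den p3 s'.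
have es3 : env s3 by exact: env_den.
have G3 : Gmx s3 = X *m extmx M.
  pose I k s' := forall a, (a < k)%N -> rmem s' rG a = rmem s rG a.
  have I3 : I (n * (n + n))%N s3.
    apply: (den_for (I := I)) => //; first by rewrite es'.
    move=> k s4 kn Ik sk fr4 frr4 j; rewrite ltnS leq_eqVlt /= /update /= sk frr4 // sv' //.
    by case: (eqVneq j k) => [->//|_ /= /Ik].
  rewrite -GX; apply/matrixP=> j i; rewrite !mxE I3 //.
  by have := ltn_ord j; have := ltn_ord i; nia.
have Z3 : Z = unknowns s3 by rewrite Z' unknowns_den.
pose ld := loads s'; have ld3 i : loads s3 i = (ld i + (i \in set0))%N.
  by rewrite /loads nmem_den // inE addn0.
clearbody s3; set s4 := den _ s3.
pose J l k s' := exists X' C, [/\ Gmx s' = X' *m extmx M,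
   pass_inv e Z X ld l k X' C & forall i, loads s' i = (ld i + (i \in C))%N].
suff [X' [C [_ pi ldE]]] : J (4 * bitlen n)%N 0%N s4.
  by apply: (load_invS (C := C) Lr pi) => // i; rewrite -ldE.
apply: (den_for (I := fun l => J l 0%N)) => //; first by rewrite es3.
  by exists X, set0; split=> //; exact: pass_start e0 X0 inc ld.
move=> l s5 lt J5 sl fr5 frr5.
have es5 : env s5 by exact: env_frame fr5.
have Z5 : Z = unknowns s5 by rewrite Z3; apply/setP=> i; rewrite !inE fr5.
suff [X' [C [GX' pi ldE]]] : J l n (den (PFor xk vn pass_step) s5).
  by exists X', C; split=> //; exact: pass_level e0 X0 inc _ _ _ _ pi.
apply: (den_for (I := J l)) => //; first exact: env_n.
move=> k s6 kn [X6 [C6 [G6 pi6 ld6]]] sk fr6 frr6.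
have es6 : env s6 by exact: env_frame fr6.
have l6 : nmem s6 xlevel 0 = l by rewrite fr6.
have Z6 : Z = unknowns s6 by rewrite Z5; apply/setP=> i; rewrite !inE fr6.
exact: (den_pass_step (k := Ordinal kn) es6 sk l6 lt Z6 G6 pi6 ld6).
Qed.

Lemma den_mark_known s (i : 'I_n) : env s ->
  let hit := (nmem s known i == 0%N) && (2 * bitlen n <= loads s i)%N in
  let miss := (nmem s known i == 0%N) && (loads s i < 2 * bitlen n)%N in
  nmem (den mark_known s) known i = (if hit then 1%N else nmem s known i) /\
  dvec (den mark_known s) 0 i = (if miss then 0 else dvec s 0 i).
Proof.
move=> es; set hit := _ && _; set miss := _ && _; lazy zeta.
pose new j := if (nmem s known j == 0%N) && (2 * bitlen n <= nmem s load j)%N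
  then 1%N else nmem s known j.
pose newd j := if (nmem s known j == 0%N) && (nmem s load j < 2 * bitlen n)%N
  then 0 else rmem s rdiag j.
pose I k s' := forall j, (nmem s' known j = if (j < k)%N then new j else nmem s known j) /\
  (rmem s' rdiag j = if (j < k)%N then newd j else rmem s rdiag j).
suff /(_ i)[] : I n (den mark_known s) by rewrite ltn_ord => -> dE; split=> //; rewrite !mxE.
apply: (den_for (I := I)) => //; first exact: env_n.
move=> k s' kn Ik sk fr frr j.
have es' : env s' by exact: env_frame fr.
have [] := Ik k; rewrite ltnn => kk dk.
rewrite !den_if [beval _ _]/= sk kk leqn0.
have lk : nmem s' load k = nmem s load k by rewrite fr.
have [k1 d1] := Ik j; case: (eqVneq j k) => [->|jk]; last first.
  have -> : (j < k.+1)%N = (j < k)%N by rewrite ltnS leq_eqVlt (negPf jk).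
  case: ifP => _; rewrite /= ?k1 ?d1 //.
  case: ifP => _; rewrite /= /update /= ?sk (negPf jk) /= ?k1 ?d1 //.
rewrite ltnS leqnn /new /newd.
have -> : beval s' (BNLe (var vt) (NMul (NConst 2) (NGet load (var xk)))) =
    (2 * bitlen n <= nmem s load k)%N.
  by rewrite /= sk lk (es' vt 0%N) // Kt; lia.
case: eqP => _; last by rewrite /= /update /= kk dk.
by case: leqP => _; rewrite /= /update /= ?sk ?eqxx ?kk ?dk.
Qed.

Lemma den_stage s (T : 'M[R]_n) : env s -> T^T = T ->
    (forall S : {set 'I_n}, (8 * \rank (T :&: coordmx R S)%MS <= #|S|)%N) ->
    slice_ok s T -> diag_ok s T ->
  diag_ok (den stage s) T /\
  (2 * #|unknowns (den stage s)| <= #|unknowns s|)%N.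
Proof.
move=> es symT inc sT dT; set Z := unknowns s.
rewrite /stage den_seq; have := den_init es; set s1 := den init_rows s => G1.
have es1 : env s1 by exact: env_den.
have e1 : slice s1 = slice s by apply: slice_den.
have d1 : dvec s1 = dvec s by apply: dvec_den.
have u1 : unknowns s1 = Z by apply: unknowns_den.
have sT1 : slice_ok s1 T by move=> i j; rewrite e1; exact: sT.
rewrite -e1 -d1 (slice_add_diag sT1) in G1.
have er1 i : i \notin unknowns s1 -> errv s1 T 0 i = 0.
  by rewrite u1 errvE d1 dT => /negPf->; rewrite subrr.
rewrite den_seq; have [X2 [G2 kX2 X20]] := den_elim_known es1 G1 er1.
set s2 := den elim_known s1 in G2 *.
have es2 : env s2 by exact: env_den.
have d2 : dvec s2 = dvec s by rewrite -d1; apply: dvec_den.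
have u2 : unknowns s2 = Z by rewrite -u1; apply: unknowns_den.
have er2 : errv s1 T = errv s2 T by apply/rowP=> i; rewrite !errvE d1 d2.
rewrite er2 u1 -u2 in G2 X20.
rewrite den_seq; have [||X3 [I [G3 X30 e3 NX Iu]]] := den_elim_unknown es2 symT _ _ G2 kX2 X20.
- by move=> i; rewrite u2 d2 dT => /negPf->.
- by move=> i; rewrite u2 d2 dT => ->.
set s3 := den elim_unknown s2 in G3 X30 e3 *; rewrite u2 in e3 Iu.
have es3 : env s3 by exact: env_den.
have u3 : unknowns s3 = Z by rewrite -u2; apply: unknowns_den.
rewrite den_seq; have linv := den_rounds es3 (esym u3) G3 e3 X30 inc.
set s4 := den rounds s3 in linv *.
have es4 : env s4 by exact: env_den.
have u4 : unknowns s4 = Z by rewrite -u3; apply: unknowns_den.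
have d4 : dvec s4 = dvec s3 by apply: dvec_den.
have nb : (n < 2 ^ bitlen n)%N by exact: trunc_log_ltn.
have [right few] := load_end symT inc nb linv NX Iu.
clearbody s4; have mk i := den_mark_known i es4.
have kZ (i : 'I_n) : (nmem s4 known i == 0%N) = (i \in Z) by rewrite -u4 inE.
have u5 : unknowns (den mark_known s4) = [set i in Z | (loads s4 i < 2 * bitlen n)%N].
  apply/setP=> i; rewrite [LHS]inE [RHS]inE; have [-> _] := mk i.
  rewrite kZ; move: (kZ i); case: (i \in Z) => kE; last exact: kE.
  by case: leqP => _; last exact: kE.
split; last by rewrite u5.
move=> i; rewrite u5 inE; have [_ ->] := mk i; rewrite kZ.
case: ifP => // /negbT; rewrite negb_and -leqNgt d4 => iP.
apply/eqP; rewrite -subr_eq0 -errvE; apply/eqP.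
have [iZ|iZ] := boolP (i \in Z); last exact: e3.
by apply: right; move: iP; rewrite ?iZ.
Qed.

(** Each stage at least halves the set of unknown coordinates and [n < 2 ^ bitlen n], so none is
    left; [diag_ok] is then a statement about the whole diagonal. *)
Lemma den_complete s (T : 'M[R]_n) : env s -> T^T = T ->
    (forall S : {set 'I_n}, (8 * \rank (T :&: coordmx R S)%MS <= #|S|)%N) ->
    slice_ok s T ->
  forall i : 'I_n, rmem (den complete s) rdiag i = T i i.
Proof.
move=> es symT inc sT; rewrite /complete den_seq; set s1 := den _ s.
have es1 : env s1 by exact: env_den.
have e1 : slice s1 = slice s by exact: slice_den.
have [k1 d1] : (forall i : 'I_n, nmem s1 known i = 0%N) /\ forall i : 'I_n, rmem s1 rdiag i = 0.
  pose I k s' := forall i, (i < k)%N -> nmem s' known i = 0%N /\ rmem s' rdiag i = 0.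
  suff In : I n s1 by split=> i; case: (In i (ltn_ord i)).
  apply: (den_for (I := I)) => //; first exact: env_n.
  move=> k s' kn Ik sk fr frr j; rewrite ltnS leq_eqVlt /= /update /= sk.
  by case: (eqVneq j k) => //= _ /Ik.
clearbody s1; pose I k s' := [/\ slice s' = slice s, diag_ok s' T &
  (2 ^ k * #|unknowns s'| <= n)%N].
have [_ dT un] : I (bitlen n) (den (PFor xstage vb stage) s1).
  apply: (den_for (I := I)) => //; first by rewrite es1.
    split=> // [i|]; last by rewrite mul1n (leq_trans (max_card _)) // card_ord.
    by rewrite !mxE inE [nmem _ _ _]k1 eqxx [LHS]d1.
  move=> k s' kb [e' d' u'] sk fr frr.
  have es' : env s' by exact: env_frame fr.
  have sT' : slice_ok s' T by move=> i j; rewrite e'; exact: sT.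
  have [d2 u2] := den_stage es' symT inc sT' d'.
  have e2 : slice (den stage s') = slice s' by exact: slice_den.
  move: (den stage s') d2 u2 e2 => s2 d2 u2 e2; split; first by rewrite -e' -e2.
    exact: d2.
  by apply: leq_trans u'; rewrite expnS mulnAC mulnC leq_mul2l u2 orbT.
move=> i; have := dT i; rewrite mxE => ->.
case: ifP => // iu; have nb : (n < 2 ^ bitlen n)%N by exact: trunc_log_ltn.
have : (0 < #|unknowns (den (PFor xstage vb stage) s1)|)%N by apply/card_gt0P; exists i.
by move: un nb; move: #|_| (2 ^ _)%N => u p; nia.
Qed.

End Specs.

Local Close Scope ring_scope.

(** * Slices of a tensor *)

Section Digits.
Variable n : nat.
Hypothesis n_gt0 : 0 < n.

Definition dig (a l : nat) : nat := (a %/ n ^ l) %% n.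

Definition digsum (k : nat) (f : nat -> nat) : nat := \sum_(l < k) f l * n ^ l.

Lemma expn_n_gt0 k : 0 < n ^ k. Proof. by rewrite expn_gt0 n_gt0. Qed.

Lemma digD x c h t : h < t -> dig (x + c * n ^ t) h = dig x h.
Proof.
move=> ht; rewrite /dig -(subnK ht) expnD expnS !mulnA addnC.
by rewrite divnMDl ?expn_n_gt0 // modnMDl.
Qed.
Hint Resolve expn_n_gt0 : core.
Lemma dig_mod x l h : h < l -> dig (x %% n ^ l) h = dig x h.
Proof.
by move=> hl; rewrite [in RHS](divn_eq x (n ^ l)) addnC digD.
Qed.

Lemma digsum_lt k f : (forall l, l < k -> f l < n) -> digsum k f < n ^ k.
Proof.
elim: k => [|k IH] fn; first by rewrite /digsum big_ord0.
rewrite /digsum big_ord_recr /= expnS.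
have := IH (fun l lk => fn l (ltnW lk)); have := fn k (ltnSn k); rewrite /digsum.
by move: (\sum_(_ < _) _) (n ^ k) => s p; nia.
Qed.

Lemma dig_digsum k f l : (forall l, l < k -> f l < n) -> l < k ->
  dig (digsum k f) l = f l.
Proof.
elim: k => [//|k IH] fn; rewrite ltnS leq_eqVlt => /predU1P[->|lk].
  rewrite /digsum big_ord_recr /= -/(digsum k f) /dig addnC divnMDl //.
  by rewrite divn_small ?addn0 ?modn_small ?fn // digsum_lt // => j /leqW /fn.
rewrite /digsum big_ord_recr /= -/(digsum k f) digD // IH // => j /leqW; exact: fn.
Qed.

Lemma digsum_dig k a : a < n ^ k -> digsum k (dig a) = a.
Proof.
move=> ak; rewrite -[RHS](modn_small ak) => {ak}.
elim: k => [|k IH]; first by rewrite /digsum big_ord0 modn1.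
rewrite /digsum big_ord_recr /= -/(digsum k _) IH.
rewrite [in RHS](divn_eq a (n ^ k)) [in RHS](divn_eq (a %/ n ^ k) n) mulnDl -mulnA -expnS.
rewrite -addnA modnMDl [RHS]modn_small; first by rewrite addnC.
have : dig a k < n by rewrite /dig ltn_mod.
have : a %% n ^ k < n ^ k by rewrite ltn_mod.
rewrite /dig expnS; move: ((a %/ n ^ k) %% n) (a %% n ^ k) (n ^ k) => x y z; nia.
Qed.

(** Insertion of a digit 0 at position [l] in base [n], the higher digits moving up; [del0] deletes
    a digit. They number the base addresses of slices, whose digits at the two free positions are
    0. *)
Definition ins0 (l x : nat) : nat := x %% n ^ l + x %/ n ^ l * n ^ l.+1.
Definition del0 (l x : nat) : nat := x %% n ^ l + x %/ n ^ l.+1 * n ^ l.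

Lemma ins0_lt l x t : l <= t -> x < n ^ t -> ins0 l x < n ^ t.+1.
Proof.
move=> lt xt; have : x %/ n ^ l < n ^ (t - l) by rewrite ltn_divLR // -expnD subnK.
have : x %% n ^ l < n ^ l by rewrite ltn_mod.
have tE : n ^ t = n ^ (t - l) * n ^ l by rewrite -expnD subnK.
rewrite /ins0 !expnS tE => xl /(leq_mul (leqnn (n * n ^ l))).
have := leq_mul n_gt0 (leqnn (n ^ l)).
by move: (x %% n ^ l) (x %/ n ^ l) (n ^ l) (n ^ (t - l)) xl => a b c d; nia.
Qed.

Lemma dig_ins0 l x : dig (ins0 l x) l = 0.
Proof.
rewrite /dig /ins0 addnC expnS mulnA divnMDl // [x %% _ %/ _]divn_small ?ltn_mod //.
by rewrite addn0 modnMl.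
Qed.

Lemma dig_ins0_lt l x h : h < l -> dig (ins0 l x) h = dig x h.
Proof. by move=> hl; rewrite /ins0 digD ?dig_mod // ltnW. Qed.

Lemma dig_del0_lt l x h : h < l -> dig (del0 l x) h = dig x h.
Proof. by move=> hl; rewrite /del0 digD ?dig_mod. Qed.

Lemma del0_lt l x t : l <= t -> x < n ^ t.+1 -> del0 l x < n ^ t.
Proof.
move=> lt xt; have : x %/ n ^ l.+1 < n ^ (t - l).
  by rewrite ltn_divLR // -expnD addnS subnK.
have : x %% n ^ l < n ^ l by rewrite ltn_mod.
have tE : n ^ t = n ^ l * n ^ (t - l) by rewrite -expnD subnKC.
rewrite /del0 tE.
by move: (x %% n ^ l) (x %/ n ^ l.+1) (n ^ l) (n ^ (t - l)) => a b c d; nia.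
Qed.

Lemma ins0K l x : dig x l = 0 -> ins0 l (del0 l x) = x.
Proof.
move=> x0; rewrite /ins0 /del0; set y := x %% _ + _.
have -> : y %% n ^ l = x %% n ^ l by rewrite /y addnC modnMDl modn_mod.
have -> : y %/ n ^ l = x %/ n ^ l.+1.
  by rewrite /y addnC divnMDl // [x %% _ %/ _]divn_small ?addn0 // ltn_mod.
rewrite [in RHS](divn_eq x (n ^ l)) [in RHS](divn_eq (x %/ n ^ l) n).
by rewrite [(x %/ n ^ l) %% n]x0 addn0 -divnMA -expnSr -mulnA -expnS addnC.
Qed.

End Digits.

Section Slices.
Variables (R : realType) (n m : nat).
Hypothesis n_gt0 : 0 < n.

Definition ord_dig (a l : nat) : 'I_n := Ordinal (ltn_pmod (a %/ n ^ l) n_gt0).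

Definition slice_tuple (a p q : nat) (i j : 'I_n) : m.-tuple 'I_n :=
  [tuple if l == p :> nat then i else if l == q :> nat then j else ord_dig a l | l < m].

Definition vals (X : m.-tuple 'I_n) : {set 'I_n} := [set x in X].

Definition rest_vals (a p q : nat) : {set 'I_n} :=
  [set ord_dig a (val l) | l in [set l : 'I_m | (l != p :> nat) && (l != q :> nat)]].

Lemma addressE (X : m.-tuple 'I_n) (x0 : 'I_n) :
  address X = digsum n m (fun l => nth x0 X l).
Proof. by apply: eq_bigr => j _; rewrite (tnth_nth x0). Qed.

Lemma address_lt (X : m.-tuple 'I_n) : address X < n ^ m.
Proof. by rewrite (addressE X (Ordinal n_gt0)) digsum_lt. Qed.

Lemma dig_address (X : m.-tuple 'I_n) (l : 'I_m) : ord_dig (address X) l = tnth X l.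
Proof.
apply/val_inj; rewrite /= -/(dig n _ _) (addressE X (Ordinal n_gt0)) dig_digsum //.
by rewrite -tnth_nth.
Qed.

Lemma address_inj : injective (@address n m).
Proof. by move=> X Y XY; apply: eq_from_tnth => l; rewrite -!dig_address XY. Qed.

Lemma vals_uniq (X : m.-tuple 'I_n) : m <= #|vals X| -> uniq X.
Proof.
rewrite cardsE => mX; apply/card_uniqP/eqP.
by rewrite eqn_leq card_size size_tuple.
Qed.

Section Fixed.
Variables (a p q : nat).
Hypotheses (pm : p < m) (qm : q < m) (pq : p != q).

Lemma address_slice i j : a < n ^ m -> dig n a p = 0 -> dig n a q = 0 ->
  address (slice_tuple a p q i j) = a + i * n ^ p + j * n ^ q.
Proof.
move=> am ap aq; rewrite -[in RHS](digsum_dig n_gt0 am) /address /digsum.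
rewrite (bigD1 (Ordinal pm)) //= (bigD1 (Ordinal qm)) 1?eq_sym //= !tnth_mktuple eqxx.
rewrite [in RHS](bigD1 (Ordinal pm)) //= [in RHS](bigD1 (Ordinal qm)) 1?eq_sym //=.
rewrite (negPf pq) eqxx ap aq !mul0n !add0n.
rewrite [X in _ + (_ + X)](eq_bigr (fun l : 'I_m => dig n a l * n ^ l)); first by lia.
by move=> l /andP[lp lq]; rewrite tnth_mktuple ifN // ifN.
Qed.

Lemma vals_slice i j : vals (slice_tuple a p q i j) = i |: (j |: rest_vals a p q).
Proof.
apply/setP=> x; rewrite !inE; apply/tnthP/idP.
  case=> l ->; rewrite tnth_mktuple; case: ifPn => [_|lp]; first by rewrite eqxx.
  case: ifPn => [_|lq]; first by rewrite eqxx orbT.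
  by rewrite imset_f ?orbT // inE lp lq.
case/or3P=> [/eqP->|/eqP->|/imsetP[l]].
- by exists (Ordinal pm); rewrite tnth_mktuple eqxx.
- by exists (Ordinal qm); rewrite tnth_mktuple /= eq_sym (negPf pq) eqxx.
by rewrite inE => /andP[lp lq] ->; exists l; rewrite tnth_mktuple (negPf lp) (negPf lq).
Qed.

Lemma card_rest_vals : #|rest_vals a p q| <= m - 2.
Proof.
apply: leq_trans (leq_imset_card _ _) _.
rewrite (_ : [set l : 'I_m | _] = ~: [set Ordinal pm; Ordinal qm]); last first.
  by apply/setP=> l; rewrite !inE negb_or.
have := cardsC [set Ordinal pm; Ordinal qm]; rewrite cards2 card_ord.
rewrite (_ : (Ordinal pm != Ordinal qm)) //=; move: #|~: _| => z; lia.
Qed.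

Local Open Scope ring_scope.
Variables (k : nat) (T : tensor R n m) (v : 'I_k -> 'rV[R]_n) (w : 'I_k -> R).
Hypothesis TE : forall X : m.-tuple 'I_n, T X = \sum_(i < k) w i * tpower (v i) m X.

Definition slice_mx (A : {set 'I_n}) : 'M[R]_n := \matrix_(j, i)
  if (j \in A) && (i \in A) then T (slice_tuple a p q j i) else 0.

(** Each rank-one term of [T] restricts to a rank-one term of the slice; its coefficient takes in
    the coordinates of [v l] at the fixed positions. *)
Lemma slice_mxE (A : {set 'I_n}) : exists c : 'rV[R]_k,
  slice_mx A = (span_mx v *m coordmx R A)^T *m diag_mx c *m (span_mx v *m coordmx R A).
Proof.
exists (\row_l (w l * \prod_(h < m | (h != p :> nat) && (h != q :> nat)) v l 0 (ord_dig a h))).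
apply/matrixP=> j i; rewrite mxE [RHS]mxE.
under [in RHS]eq_bigr => l _ do rewrite mul_mx_diag [(\matrix_(_, _) _) _ _]mxE
  [(_^T) j l]mxE !mul_coordmxE [span_mx v l j]mxE [span_mx v l i]mxE [(\row__ _) 0 l]mxE.
case: (j \in A) => /=; last by rewrite big1 // => l _; rewrite !mul0r.
case: (i \in A) => /=; last by rewrite big1 // => l _; rewrite mulr0.
rewrite TE; apply: eq_bigr => l _; rewrite /tpower (bigD1 (Ordinal pm)) //=.
rewrite (bigD1 (Ordinal qm)) 1?eq_sym //= !tnth_mktuple /= eqxx (eq_sym q) (negPf pq) eqxx.
rewrite [X in _ * (_ * (_ * X))](eq_bigr (fun h : 'I_m => v l 0 (ord_dig a h))); last first.
  by move=> h /andP[hp hq]; rewrite tnth_mktuple ifN // ifN.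
by rewrite mulrCA -!mulrA; do 2! congr (_ * _); rewrite mulrC.
Qed.

Lemma slice_mx_tr (A : {set 'I_n}) : (slice_mx A)^T = slice_mx A.
Proof.
have [c ->] := slice_mxE A; move: (span_mx v *m _) => B.
by rewrite !trmx_mul trmxK tr_diag_mx mulmxA.
Qed.

(** Vectors of the cleared slice lift to vectors of the span supported on [S :|: ~: A], which has at
    most [#|S| + m - 2] elements. For positive rank [x] this yields [#|S| > (3 * m + 2) * x], and
    the coefficient is at least 8 as [m] is at least 2. *)
Lemma slice_mx_incoherent (A : {set 'I_n}) :
    (forall S : {set 'I_n}, (0 < \rank (span_mx v :&: coordmx R S)%MS)%N ->
      (4 * m * \rank (span_mx v :&: coordmx R S)%MS < #|S|)%N) ->
    (1 < m)%N -> (#|~: A| <= m - 2)%N ->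
  forall S : {set 'I_n}, (8 * \rank (slice_mx A :&: coordmx R S)%MS <= #|S|)%N.
Proof.
move=> inc m1 Am S; set W := (_ :&: _)%MS.
have [c ME] := slice_mxE A.
have /submxP[B WE] : (W <= span_mx v *m coordmx R A)%MS.
  by rewrite (submx_trans (capmxSl _ _)) // ME submxMl.
have WS : W *m coordmx R S = W by apply/sub_coordmxP; exact: capmxSr.
pose W2 := B *m span_mx v.
have WW2 : W = W2 *m coordmx R A by rewrite WE mulmxA.
have sub2 : (W2 <= span_mx v :&: coordmx R (S :|: ~: A))%MS.
  rewrite sub_capmx submxMl /=; apply: sub_coordmx => i j.
  rewrite !inE negb_or negbK => /andP[jS jA].
  have /matrixP/(_ i j) := WS; rewrite mul_coordmxE (negPf jS).
  by rewrite WW2 mul_coordmxE jA.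
have le2 : (\rank W <= \rank (span_mx v :&: coordmx R (S :|: ~: A))%MS)%N.
  by apply: leq_trans (mxrankS sub2); rewrite WW2 mxrankM_maxl.
have [->|W0] := posnP (\rank W); first by rewrite muln0.
have := inc _ (leq_trans W0 le2); have := cardsU S (~: A); have := cardsC A.
move: Am W0 le2; rewrite !card_ord.
move: (\rank W) (\rank _) #|S| #|_ :|: _| #|~: A| #|_ :&: _| => x y z t r u; nia.
Qed.

End Fixed.
End Slices.

(** * Programs running the completion over all slices *)

Definition digit_exp (e l : nexp) : nexp := NMod (NDiv e (NGet pw l)) (var vn).

Definition mark_excluded : prog :=
  PFor xk vn (PN excl (var xk) (NConst 0)) ;;
  PFor xh vm
    (PIf (BAnd (BNot (neq (var xh) (var xp))) (BNot (neq (var xh) (var xq))))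
       (PN excl (digit_exp (var base) (var xh)) (NConst 1)) PSkip).

(** [xz] is set to the exempted value, and to [n] if there is none. *)
Definition exempt : prog :=
  PN xz (NConst 0) (var vn) ;;
  PIf (BAnd (BNot (BNLe (var vm) (var xv)))
         (BAnd (BNot (neq (var xv) (var xp))) (BNot (neq (var xv) (var xq)))))
    (PN xz (NConst 0) (digit_exp (var base) (var xv)) ;;
     PN excl (var xz) (NConst 0))
    PSkip.

(** Under an exemption only the entry of the exempted value is written: the off-diagonal entries
    then used have more repetitions, so the other diagonal values obtained need not be correct. *)
Definition write_diag : prog :=
  PFor xk vn
    (PIf (BAnd (is_zero excl (var xk))
            (BNot (BAnd (BNot (neq (var xz) (var vn))) (BNot (neq (var xz) (var xk))))))
       (PR rout (addr_exp (var xk) (var xk)) (RGet rdiag (var xk)))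
       PSkip).

Definition slice_run : prog := mark_excluded ;; exempt ;; complete ;; write_diag.

(** The reduction modulo [vnm] does not change the addresses computed here, which are below [n ^ m];
    it makes the expression [small]. *)
Definition insert_exp (e l : nexp) : nexp :=
  NMod
    (NAdd (NMod e (NGet pw l))
       (NMul (NDiv e (NGet pw l)) (NGet pw (NAdd l (NConst 1)))))
    (var vnm).

Definition slice_loop : prog :=
  PFor xsl vsl
    (PN base (NConst 0) (insert_exp (var xsl) (var xp)) ;;
     PN base (NConst 0) (insert_exp (var base) (var xq)) ;;
     PFor xv vm1 slice_run).

Definition sweep : prog :=
  PFor xp vm (PFor xq vm (PIf (BNLe (var xq) (var xp)) PSkip slice_loop)).

Definition fill : prog := PFor xsweep vm sweep.

Section Fill.
Variables (R : realType) (n m : nat) (K : nat -> nat -> nat).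
Hypothesis HK : constants n m K.
Let n_gt0 := const_n_gt0 HK.
Implicit Types s : state R.
Variables (k : nat) (T : tensor R n m) (v : 'I_k -> 'rV[R]_n) (w : 'I_k -> R).
Hypothesis TE : forall X : m.-tuple 'I_n, T X = (\sum_(i < k) w i * tpower (v i) m X)%R.
Hypothesis incT : forall S : {set 'I_n}, 0 < \rank (span_mx v :&: coordmx R S)%MS ->
  4 * m * \rank (span_mx v :&: coordmx R S)%MS < #|S|.

Definition slice_env s (a p q : nat) :=
  [/\ nmem s base 0 = a, nmem s xp 0 = p & nmem s xq 0 = q].

Lemma slice_env_den prg s a p q :
  all (fun x => x \notin [:: base; xp; xq]) (nmods prg) ->
  slice_env s a p q -> slice_env (den prg s) a p q.
Proof.
move=> /allP np [sb sp sq].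
have fr x : x \in [:: base; xp; xq] -> nmem (den prg s) x 0 = nmem s x 0.
  by move=> xb; rewrite nmem_den //; apply/negP=> /np; rewrite xb.
by rewrite /slice_env !fr.
Qed.

Lemma den_mark_excluded s a p q : env K s -> slice_env s a p q ->
  forall i : 'I_n, nmem (den mark_excluded s) excl i = (i \in rest_vals m n_gt0 a p q).
Proof.
move=> es se; rewrite /mark_excluded den_seq; set s1 := den _ s.
have es1 : env K s1 by exact: (env_den HK).
have se1 : slice_env s1 a p q by exact: slice_env_den.
have ex1 (i : 'I_n) : nmem s1 excl i = 0.
  pose I j s' := forall i, i < j -> nmem s' excl i = 0.
  suff : I n s1 by move/(_ i (ltn_ord i)).
  apply: (den_for (I := I)) => //; first exact: (env_n HK es).
  move=> j s' jn Ij sj fr frr i'; rewrite ltnS leq_eqVlt /= /update /= sj.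
  by case: (eqVneq i' j) => //= _ /Ij.
clearbody s1; pose J j s' := forall i : 'I_n, nmem s' excl i =
  [exists l : 'I_m, [&& l < j, l != p :> nat, l != q :> nat & ord_dig n_gt0 a l == i]].
have Jm : J m (den (PFor xh vm
    (PIf (BAnd (BNot (neq (var xh) (var xp))) (BNot (neq (var xh) (var xq))))
       (PN excl (digit_exp (var base) (var xh)) (NConst 1)) PSkip)) s1).
  apply: (den_for (I := J)) => //; first by rewrite es1 // (const_m HK).
    by move=> i; rewrite [LHS]ex1 (introF existsP) // => -[l]; rewrite ltn0.
  move=> j s' jm Ij sj fr frr i.
  have [sb sp sq] := se1.
  rewrite den_if [beval _ _]/= -!eqn_leq sj !fr // sp sq.
  have jE : [exists l : 'I_m, [&& l < j.+1, l != p :> nat, l != q :> nat & ord_dig n_gt0 a l ==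
    i]] =
     [&& j != p, j != q & ord_dig n_gt0 a j == i] ||
     [exists l : 'I_m, [&& l < j, l != p :> nat, l != q :> nat & ord_dig n_gt0 a l == i]].
    apply/existsP/orP => [[l /and4P[lj lp lq li]]|[/and3P[jp jq ji]|/existsP[l]]].
    - move: lj; rewrite ltnS leq_eqVlt => /predU1P[<-|lj]; first by rewrite lp lq li; left.
      by right; apply/existsP; exists l; rewrite lj lp lq li.
    - by exists (Ordinal jm); rewrite ltnSn jp jq.
    - by move=> /and4P[lj lp lq li]; exists l; rewrite (leqW lj) lp lq li.
  rewrite jE; have [jp|jp] := eqVneq j p; first by rewrite /= /update /= Ij.
  have [jq|jq] := eqVneq j q; first by rewrite /= /update /= Ij.
  rewrite /= /update /= sj (fr base) // (fr vn) // (fr pw) // sb (env_n HK es1) (env_pw _ es1).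
  rewrite (const_pw HK) ?(ltnW jm) // -/(dig n a j) eq_sym.
  rewrite -[dig n a j]/(ord_dig n_gt0 a j : nat) (_ : (_ == i :> nat) = (ord_dig n_gt0 a j ==
    i)) //.
  by case: eqP => //= _; rewrite Ij.
move=> i; rewrite Jm; congr nat_of_bool; apply/existsP/imsetP => [[l /and4P[_ lp lq /eqP li]]|[l]].
  by exists l; rewrite ?inE ?lp.
by rewrite inE => /andP[lp lq] ->; exists l; rewrite ltn_ord lp lq eqxx.
Qed.

Definition exempted (a p q h : nat) : nat :=
  if [&& h < m, h != p & h != q] then dig n a h else n.

Lemma den_exempt s a p q h : env K s -> slice_env s a p q -> nmem s xv 0 = h ->
    h <= m ->
    (forall i : 'I_n, nmem s excl i = (i \in rest_vals m n_gt0 a p q)) ->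
  let z := exempted a p q h in
  nmem (den exempt s) xz 0 = z /\
  forall i : 'I_n, (nmem (den exempt s) excl i == 0) =
    (i \notin rest_vals m n_gt0 a p q) || (i == z :> nat).
Proof.
move=> es [sb sp sq] sv hm ex; lazy zeta; rewrite /exempt den_seq den_if.
set s1 := den (PN _ _ _) s.
have es1 : env K s1 by exact: (env_den HK).
have fr x j : x != xz -> nmem s1 x j = nmem s x j by move=> /negPf xx; rewrite /s1 /= /update xx.
have z1 : nmem s1 xz 0 = n by rewrite /s1 /= /update /= (env_n HK es).
clearbody s1; rewrite [beval _ _](_ : _ = [&& h < m, h != p & h != q]); last first.
  by rewrite [LHS]/= -!eqn_leq -ltnNge !fr // sv sp sq (es vm 0) // (const_m HK).
rewrite /exempted; case: ifP => hc; last first.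
  split=> [//|i]; rewrite [den PSkip s1]/= fr // ex.
  by rewrite (_ : (i == n :> nat) = false) ?orbF ?eqb0 //; have := ltn_ord i; lia.
rewrite den_seq; set s2 := den (PN _ _ _) s1.
have z2 : nmem s2 xz 0 = dig n a h.
  rewrite /s2 [LHS]/= /update /= !fr // sb sv (env_n HK es) (env_pw _ es).
  by rewrite (const_pw HK).
have e2 j : nmem s2 excl j = nmem s excl j by rewrite /s2 /= /update /= fr.
clearbody s2; split; first by rewrite /= /update /=.
move=> i; rewrite /= /update /= z2 e2 ex; case: (i == dig n a h :> nat).
  by rewrite orbT.
by rewrite orbF eqb0.
Qed.

Definition written s (i : nat) : bool :=
  (nmem s excl i == 0) && ((nmem s xz 0 == n) || (nmem s xz 0 == i)).

Lemma den_write_diag s a p q : env K s -> slice_env s a p q -> p < m -> q < m ->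
  let addr i := a + i * n ^ p + i * n ^ q in
  (forall i, i < n -> written s i ->
    rmem (den write_diag s) rout (addr i) = rmem s rdiag i) /\
  (forall x, (forall i, i < n -> written s i -> x != addr i) ->
    rmem (den write_diag s) rout x = rmem s rout x).
Proof.
move=> es [sb sp sq] pm qm addr.
pose I j s' := (forall i, i < j -> written s i -> rmem s' rout (addr i) = rmem s rdiag i) /\
  (forall x, (forall i, i < j -> written s i -> x != addr i) -> rmem s' rout x = rmem s rout x).
rewrite -[_ /\ _]/(I n (den write_diag s)).
apply: (den_for (I := I)) => //; first exact: (env_n HK es).
move=> j s' jn [I1 I2] sj fr frr.
rewrite den_if [beval _ _](_ : _ = written s j); last first.
  rewrite [LHS]/= -!eqn_leq sj !fr // (env_n HK es) leqn0 -negb_or negbK.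
  by [].
have dE : den (PR rout (addr_exp (var xk) (var xk)) (RGet rdiag (var xk))) s' =
    State (nmem s') (update (rmem s') rout (addr j) (rmem s rdiag j)).
  rewrite /= sj !fr // sb sp sq frr // (env_pw _ es) (env_pw _ es).
  by rewrite !(const_pw HK) ?(ltnW pm) ?(ltnW qm).
have addr_inj i : (addr i == addr j) = (i == j).
  apply/eqP/eqP => [|->//]; rewrite /addr -!addnA => /addnI.
  by rewrite -!mulnDr => /eqP; rewrite eqn_pmul2r ?addn_gt0 ?expn_gt0 ?n_gt0 // => /eqP.
case: ifP => wj; last first.
  split=> [i|x xP] /=; last by apply: I2 => i ij; apply: xP; exact: leqW.
  rewrite ltnS leq_eqVlt => /predU1P[->|]; [by rewrite wj | exact: I1].
rewrite dE; split=> [i|x xP]; rewrite [rmem _]/= /update /=.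
  rewrite addr_inj ltnS leq_eqVlt; case: eqP => [->//|_] /=; exact: I1.
rewrite (negPf (xP j (ltnSn j) wj)); apply: I2 => i ij; apply: xP; exact: leqW.
Qed.

Definition right s (X : m.-tuple 'I_n) := rmem s rout (address X) = T X.

(** [m - #|vals X|] measures the repetitions in [X]; this is the induction hypothesis on their
    number. *)
Definition good r s := forall X : m.-tuple 'I_n, m <= #|vals X| + r -> right s X.

Definition target (a p q h i : nat) : bool :=
  ((exempted a p q h == n) || (exempted a p q h == i)).

(** Let [Q] be the set of values at the fixed positions. Without exemption, an off-diagonal entry of
    the cleared slice has two values outside [Q] and a target one; with a value of [Q] exempted, it
    has at least one and the target none. Either way it has fewer repetitions than the target, so it
    is known when the target has at most [r.+1]. *)
Lemma den_slice_run s a p q h r :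
    env K s -> slice_env s a p q -> nmem s xv 0 = h -> h <= m ->
    p < m -> q < m -> p != q -> a < n ^ m -> dig n a p = 0 -> dig n a q = 0 ->
    good r s ->
  (forall X, m <= #|vals X| + r.+1 -> right s X -> right (den slice_run s) X) /\
  (forall i : 'I_n,
    (i \notin rest_vals m n_gt0 a p q) || (i == exempted a p q h :> nat) ->
    target a p q h i ->
    m <= #|vals (slice_tuple m n_gt0 a p q i i)| + r.+1 ->
    right (den slice_run s) (slice_tuple m n_gt0 a p q i i)).
Proof.
move=> es se sh hm pm qm pq am ap aq gs.
set Q := rest_vals m n_gt0 a p q; set z := exempted a p q h.
pose tup := slice_tuple m n_gt0 a p q.
have addrE (i j : 'I_n) : address (tup i j) = a + i * n ^ p + j * n ^ q.
  exact: address_slice.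
have valsE (i j : 'I_n) : vals (tup i j) = i |: (j |: Q) by exact: vals_slice.
rewrite /slice_run den_seq; have := den_mark_excluded es se; set s1 := den _ s => ex1.
have es1 : env K s1 by exact: (env_den HK).
have se1 : slice_env s1 a p q by exact: slice_env_den.
have sh1 : nmem s1 xv 0 = h by rewrite nmem_den.
have out1 x : rmem s1 rout x = rmem s rout x by rewrite rmem_den.
clearbody s1; rewrite den_seq; have [z2 ex2] := den_exempt es1 se1 sh1 hm ex1.
rewrite -/z in z2 ex2; set s2 := den exempt s1 in z2 ex2 *.
have es2 : env K s2 by exact: (env_den HK).
have se2 : slice_env s2 a p q by exact: slice_env_den.
have out2 x : rmem s2 rout x = rmem s rout x by rewrite rmem_den.
clearbody s2; rewrite den_seq; set s3 := den complete s2.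
have es3 : env K s3 by exact: (env_den HK).
have se3 : slice_env s3 a p q by exact: slice_env_den.
have out3 x : rmem s3 rout x = rmem s rout x by rewrite rmem_den.
have z3 : nmem s3 xz 0 = z by rewrite nmem_den.
have ex3 (i : 'I_n) : (nmem s3 excl i == 0) = (i \notin Q) || (i == z :> nat).
  by rewrite nmem_den.
have wE (i : 'I_n) : written s3 i = ((i \notin Q) || (i == z :> nat)) && target a p q h i.
  by rewrite /written ex3 z3.
(* A single written entry with at most [r.+1] repetitions shows that the whole off-diagonal part is
   known, so every written value is then correct; otherwise all writes concern entries with more
   repetitions. *)
have diag3 (i0 : 'I_n) : written s3 i0 -> m <= #|vals (tup i0 i0)| + r.+1 ->
    forall i : 'I_n, written s3 i -> rmem s3 rdiag i = T (tup i i).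
  rewrite wE => /andP[u0 t0] b0 i; rewrite wE => /andP[ui _].
  pose A := [set i : 'I_n | (i \notin Q) || (i == z :> nat)].
  pose M := slice_mx n_gt0 a p q T A.
  have -> : T (tup i i) = M i i by rewrite mxE inE ui.
  apply: (den_complete HK) => //; first exact: (slice_mx_tr n_gt0 a pm qm pq TE).
    apply: (slice_mx_incoherent n_gt0 a pm qm pq TE incT).
      by have := pm; have := qm; move/eqP: pq; lia.
    apply: leq_trans (card_rest_vals n_gt0 a pm qm pq); apply: subset_leq_card.
    by apply/subsetP=> x; rewrite !inE negb_or negbK => /andP[].
  move=> j j' jj'; rewrite !mxE (negPf jj') !inE !ex2; case: ifP => // /andP[uj uj'].
  have [sb sp sq] := se2; rewrite /slice_addr sb sp sq.
  rewrite !(const_pw HK) ?(ltnW pm) ?(ltnW qm) // out2 -addrE; apply: gs.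
  apply: leq_trans b0 _; rewrite addnS -addSn leq_add2r !valsE setUA setUid.
  have [zn|zn] := eqVneq z n.
    have nz (x : 'I_n) : (x == z :> nat) = false by rewrite zn; have := ltn_ord x; lia.
    move: u0 uj uj'; rewrite !nz !orbF => u0 uj uj'.
    by rewrite !cardsU1 u0 !inE negb_or jj' uj uj'.
  have i0z : z = i0 by apply/eqP; move: t0; rewrite /target -/z (negPf zn).
  have [i0Q|i0Q] := boolP (i0 \in Q); last first.
    rewrite !cardsU1 i0Q !inE negb_or jj'.
    have nq (x : 'I_n) : (x \notin Q) || (x == z :> nat) -> x \notin Q.
      by rewrite i0z => /orP[//|/eqP/val_inj->].
    by rewrite (nq _ uj) (nq _ uj').
  have -> : i0 |: Q = Q by apply/setUidPr; rewrite sub1set.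
  rewrite -add1n; have [jQ|jQ] := boolP (j \in Q); last first.
    by rewrite cardsU1 !inE negb_or jj' jQ leq_add2l subset_leq_card // subsetUr.
  have j'Q : j' \notin Q.
    apply: contra jj' => j'Q; move: uj uj'; rewrite jQ j'Q /= => /eqP jz /eqP j'z.
    by apply/eqP/val_inj; rewrite /= jz.
  have -> : j |: (j' |: Q) = j' |: Q by apply/setUidPr; rewrite sub1set !inE jQ orbT.
  by rewrite cardsU1 j'Q.
have [w1 w2] := den_write_diag es3 se3 pm qm.
split=> [X bX rX|i ui ti bi]; last first.
  have wi : written s3 i by rewrite wE ui.
  by rewrite /right addrE w1 // (diag3 i wi bi i wi).
have [/existsP[i /andP[wi /eqP Xi]]|/existsPn nX] :=
    boolP [exists i : 'I_n, written s3 i && (X == tup i i)].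
  by rewrite /right Xi addrE w1 // (diag3 i wi _ i wi) // -Xi.
rewrite /right w2 ?out3 // => i iN wi.
have := nX (Ordinal iN); rewrite wi /=; apply: contra => /eqP Xi.
by apply/eqP/address_inj => //; rewrite Xi addrE.
Qed.
End Fill.

(** * Sweeps *)

Section Sweeps.
Variables (R : realType) (n m : nat) (K : nat -> nat -> nat).
Hypothesis HK : constants n m K.
Let n_gt0 := const_n_gt0 HK.
Implicit Types s : state R.
Variables (k : nat) (T : tensor R n m) (v : 'I_k -> 'rV[R]_n) (w : 'I_k -> R).
Hypothesis TE : forall X : m.-tuple 'I_n, T X = (\sum_(i < k) w i * tpower (v i) m X)%R.
Hypothesis incT : forall S : {set 'I_n}, 0 < \rank (span_mx v :&: coordmx R S)%MS ->
  4 * m * \rank (span_mx v :&: coordmx R S)%MS < #|S|.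

(** An entry can lie on the diagonals of several slices and be written repeatedly; this says that an
    entry of the level under construction, once right, is not spoiled. *)
Definition keeps r s s' := good T r s ->
  forall X, m <= #|vals X| + r.+1 -> right T s X -> right T s' X.

Lemma keeps_good r s s' : keeps r s s' -> good T r s -> good T r s'.
Proof. by move=> ks gs X bX; apply: ks (gs X bX) => //; rewrite addnS leqW. Qed.

Lemma keeps_trans r s1 s2 s3 : keeps r s1 s2 -> keeps r s2 s3 -> keeps r s1 s3.
Proof. by move=> k12 k23 g1 X bX rX; apply: k23 => //; [exact: keeps_good k12 g1 | exact: k12]. Qed.

Section Loops.
Variables (r : nat) (x a : nat) (p : prog) (s : state R) (N : nat).
Hypotheses (xp : x \notin nmods p) (aN : nmem s a 0 = N).
Definition loop_state s' j := nmem s' x 0 = j /\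
  forall b i, b \notin x :: nmods p -> nmem s' b i = nmem s b i.
Hypothesis step : forall s' j, j < N -> loop_state s' j -> keeps r s' (den p s').

Lemma keeps_for : keeps r s (den (PFor x a p) s).
Proof.
pose I (_ : nat) s' := keeps r s s'; rewrite -/(I N _).
apply: (den_for (I := I)) => // j s' jN Ij sj fr _.
exact: keeps_trans Ij (step jN (conj sj fr)).
Qed.

Lemma right_for X j : j < N -> good T r s -> m <= #|vals X| + r.+1 ->
    (forall s', loop_state s' j -> good T r s' -> right T (den p s') X) ->
  right T (den (PFor x a p) s) X.
Proof.
move=> jN gs bX hit; pose I j' s' := good T r s' /\ (j < j' -> right T s' X).
suff [_ ] : I N (den (PFor x a p) s) by apply.
apply: (den_for (I := I)) => // j' s' j'N [gs' Ij] sj fr _.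
have kp := step j'N (conj sj fr).
split; first exact: keeps_good kp gs'.
rewrite ltnS leq_eqVlt => /predU1P[jj|jj]; last exact: (kp gs' X bX (Ij jj)).
by apply: hit gs'; split=> //; rewrite sj.
Qed.
End Loops.

(** A value [i] occurring at a fixed position [l] is treated by the iteration [xv = l], which
    exempts it; any other value by the last iteration, [xv = m], which exempts none. *)
Lemma slice_rounds r s a p q :
    env K s -> slice_env s a p q -> p < q -> q < m ->
    a < n ^ m -> dig n a p = 0 -> dig n a q = 0 -> good T r s ->
  keeps r s (den (PFor xv vm1 slice_run) s) /\
  forall i : 'I_n, m <= #|vals (slice_tuple m n_gt0 a p q i i)| + r.+1 ->
    right T (den (PFor xv vm1 slice_run) s) (slice_tuple m n_gt0 a p q i i).
Proof.
move=> es se pq qm am ap aq gs.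
have pm := ltn_trans pq qm; have npq : p != q by rewrite ltn_eqF.
have N1 : nmem s vm1 0 = m.+1 by rewrite es // (const_m1 HK).
have run s' j : j < m.+1 -> loop_state xv slice_run s s' j -> good T r s' ->
    let t := den slice_run s' in
    keeps r s' t /\
    forall i : 'I_n,
      (i \notin rest_vals m n_gt0 a p q) || (i == exempted n m a p q j :> nat) ->
      target n m a p q j i ->
      m <= #|vals (slice_tuple m n_gt0 a p q i i)| + r.+1 ->
      right T t (slice_tuple m n_gt0 a p q i i).
  move=> jm [sj fr] gs'.
  have es' : env K s' by exact: (env_frame HK es _ fr).
  have se' : slice_env s' a p q by case: se => *; split; rewrite fr.
  have [kp hit] := den_slice_run HK TE incT es' se' sj jm pm qm npq am ap aq gs'.
  by split=> // _; exact: kp.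
split.
  by apply: keeps_for N1 _ => // s' j jm ls gs'; apply: (run s' j jm ls gs').1.
move=> i bi; have step s' j : j < m.+1 -> loop_state xv slice_run s s' j ->
    keeps r s' (den slice_run s').
  by move=> jm ls gs'; apply: (run s' j jm ls gs').1.
have [/imsetP[l]|iQ] := boolP (i \in rest_vals m n_gt0 a p q).
  rewrite inE => /andP[lp lq] il.
  apply: (right_for _ N1 step (ltnW (ltn_ord l))) => // s' ls gs'.
  have zE : exempted n m a p q l = i by rewrite /exempted ltn_ord lp lq il.
  apply: (run s' l (ltnW (ltn_ord l)) ls gs').2 => //.
    by rewrite zE eqxx orbT.
  by rewrite /target zE eqxx orbT.
apply: (right_for _ N1 step (ltnSn m)) => // s' ls gs'.
apply: (run s' m (ltnSn m) ls gs').2; rewrite ?iQ //.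
by rewrite /target /exempted ltnn eqxx.
Qed.

Definition repeats (X : m.-tuple 'I_n) p q :=
  forall l h : 'I_m, l = p :> nat -> h = q :> nat -> tnth X l = tnth X h.

Lemma den_slice_loop r s p q :
    env K s -> nmem s xp 0 = p -> nmem s xq 0 = q -> p < q -> q < m -> good T r s ->
  keeps r s (den slice_loop s) /\ forall X : m.-tuple 'I_n, repeats X p q ->
    m <= #|vals X| + r.+1 -> right T (den slice_loop s) X.
Proof.
move=> es sp sq pq qm gs; rewrite /slice_loop; set body := (X in PFor _ _ X).
have pm := ltn_trans pq qm.
(* Two digits of a base address are 0, so there are [n ^ (m - 2)] of them. *)
have nE : n ^ m = n ^ (m - 2) * (n * n) by rewrite mulnA -!expnSr; congr (_ ^ _); lia.
have N1 : nmem s vsl 0 = n ^ (m - 2).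
  by rewrite es // (const_sl HK) nE mulnK // muln_gt0 n_gt0.
have run s' j : j < n ^ (m - 2) -> loop_state xsl body s s' j -> good T r s' ->
    let a := ins0 n q (ins0 n p j) in let t := den body s' in
    keeps r s' t /\
    forall i : 'I_n, m <= #|vals (slice_tuple m n_gt0 a p q i i)| + r.+1 ->
      right T t (slice_tuple m n_gt0 a p q i i).
  move=> jN [sj fr] gs' a.
  have es' : env K s' by exact: (env_frame HK es _ fr).
  have b_lt : ins0 n p j < n ^ m.-1.
    by rewrite (_ : m.-1 = (m - 2).+1) ?ins0_lt //; lia.
  have a_lt : a < n ^ m by rewrite -(ltn_predK qm) ins0_lt //; lia.
  rewrite /body den_seq; set s1 := den (PN _ _ _) s'.
  have s1b : nmem s1 base 0 = ins0 n p j.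
    rewrite /s1 [LHS]/= /update /= sj (fr xp) // sp !(env_pw _ es') (es' vnm) //.
    rewrite !(const_pw HK) ?(const_nm HK) ?addn1 ?(ltnW pm) //.
    by rewrite modn_small // (leq_trans b_lt) // leq_pexp2l ?leq_pred.
  have es1 : env K s1 by exact: (env_den HK).
  have fr1 x i : x != base -> nmem s1 x i = nmem s' x i.
    by move=> /negPf xb; rewrite /s1 /= /update xb.
  have gs1 : good T r s1 by [].
  have kp1 : forall X, right T s' X -> right T s1 X by [].
  clearbody s1; rewrite den_seq; set s2 := den (PN _ _ _) s1.
  have s2b : nmem s2 base 0 = a.
    rewrite /s2 [LHS]/= /update /= s1b !fr1 // (fr xq) // sq !(env_pw _ es') (es' vnm) //.
    by rewrite !(const_pw HK) ?(const_nm HK) ?addn1 ?(ltnW qm) // modn_small.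
  have es2 : env K s2 by exact: (env_den HK).
  have fr2 x i : x != base -> nmem s2 x i = nmem s' x i.
    by move=> xb; rewrite -fr1 // /s2 /= /update (negPf xb).
  have gs2 : good T r s2 by [].
  have kp2 : forall X, right T s' X -> right T s2 X by exact: kp1.
  clearbody s2.
  have se2 : slice_env s2 a p q by split; [exact: s2b|rewrite fr2 ?fr..].
  have ap : dig n a p = 0 by rewrite /a dig_ins0_lt // dig_ins0.
  have aq : dig n a q = 0 by rewrite /a dig_ins0.
  have [kp hit] := slice_rounds es2 se2 pq qm a_lt ap aq gs2.
  by split=> // _ X bX /kp2 rX; exact: kp gs2 X bX rX.
have step s' j : j < n ^ (m - 2) -> loop_state xsl body s s' j ->
    keeps r s' (den body s').
  by move=> jm ls gs'; apply: (run s' j jm ls gs').1.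
split; first by apply: keeps_for N1 step.
(* The base of the slice through [X] has the digits of [X] except for 0 at [p] and [q]. Deleting
   position [q] and then [p] undoes the insertions, made in the opposite order, and gives the
   iteration that visits this slice. *)
move=> X Xpq bX; pose f l := if (l == p) || (l == q) then 0 else dig n (address X) l.
have fn l : l < m -> f l < n by move=> _; rewrite /f; case: ifP => // _; rewrite ltn_mod.
pose b := digsum n m f; pose c := del0 n q b; pose a := del0 n p c.
have digb l : l < m -> dig n b l = f l by move=> lm; rewrite dig_digsum.
have bq : dig n b q = 0 by rewrite digb // /f eqxx orbT.
have b_lt : b < n ^ m by exact: digsum_lt.
have c_lt : c < n ^ (m - 2).+1.
  rewrite (_ : (m - 2).+1 = m.-1); last by lia.
  by apply: del0_lt => //; rewrite ?(ltn_predK qm) //; lia.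
have cp : dig n c p = 0 by rewrite dig_del0_lt // digb // /f eqxx.
have a_lt : a < n ^ (m - 2) by apply: del0_lt => //; lia.
have bE : ins0 n q (ins0 n p a) = b by rewrite /a ins0K // ins0K.
pose i := tnth X (Ordinal pm).
have XE : X = slice_tuple m n_gt0 b p q i i.
  apply: eq_from_tnth => l; rewrite tnth_mktuple.
  case: eqP => [lp|/eqP lp]; first by rewrite /i; congr tnth; exact: val_inj.
  case: eqP => [lq|/eqP lq]; first by rewrite /i; symmetry; exact: Xpq.
  apply/val_inj; rewrite -(dig_address n_gt0) /= -/(dig n b l) digb //.
  by rewrite /f (negPf lp) (negPf lq).
apply: (right_for _ N1 step a_lt) => // s' ls gs'.
have := (run s' a a_lt ls gs').2 i; rewrite bE -XE; exact.
Qed.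

(** An index with distinct entries is right from the start; any other repeats a value at some
    positions [p < q], so it lies on the diagonal of a slice visited for that pair. *)
Lemma den_sweep r s : env K s -> good T r s -> good T r.+1 (den sweep s).
Proof.
move=> es gs; rewrite /sweep; set inner := PIf _ _ _; set mid := PFor xq _ _.
have N1 : nmem s vm 0 = m by rewrite es // (const_m HK).
have run s1 p : p < m -> loop_state xp mid s s1 p ->
    [/\ nmem s1 vm 0 = m,
      forall s2 q, q < m -> loop_state xq inner s1 s2 q -> keeps r s2 (den inner s2) &
      forall (q : nat) (X : m.-tuple 'I_n), p < q -> q < m ->
      repeats X p q ->
      m <= #|vals X| + r.+1 ->
      forall s2, loop_state xq inner s1 s2 q -> good T r s2 -> right T (den inner s2) X].
  move=> pm [s1p fr1]; have es1 : env K s1 by exact: (env_frame HK es _ fr1).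
  have sub s2 q : q < m -> loop_state xq inner s1 s2 q -> good T r s2 ->
     p < q -> keeps r s2 (den slice_loop s2) /\
       forall X : m.-tuple 'I_n, repeats X p q ->
    m <= #|vals X| + r.+1 -> right T (den slice_loop s2) X.
    move=> qm [s2q fr2] gs2 pq; have es2 : env K s2 by exact: (env_frame HK es1 _ fr2).
    by apply: den_slice_loop => //; rewrite fr2.
  have bE s2 q : loop_state xq inner s1 s2 q -> den inner s2 = if q <= p then s2 else den
    slice_loop s2.
    by move=> [s2q fr2]; rewrite /inner den_if [beval _ _]/= s2q fr2 // s1p.
  split=> [|s2 q qm ls|q X pq qm Xpq bX s2 ls gs2]; first by rewrite es1 // (const_m HK).
    rewrite (bE _ _ ls); case: leqP => [_ _ //|pq gs2]; exact: ((sub s2 q qm ls gs2 pq).1 gs2).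
  by rewrite (bE _ _ ls) leqNgt pq; apply: (sub s2 q qm ls gs2 pq).2.
have step s1 p : p < m -> loop_state xp mid s s1 p -> keeps r s1 (den mid s1).
  by move=> pm ls; have [N2 st _] := run s1 p pm ls; exact: (keeps_for _ N2 st).
move=> X bX; have [uX|nuX] := boolP (uniq X).
  have kp := keeps_for (isT : xp \notin nmods mid) N1 step.
  apply: (kp gs X bX); apply: gs; rewrite cardsE.
  by rewrite (card_uniqP uX) size_tuple leq_addr.
have /existsP[p /existsP[q /andP[pq /eqP Xpq]]] :
    [exists p : 'I_m, exists q : 'I_m, (p < q) && (tnth X p == tnth X q)].
  apply: contraR nuX => /existsPn nX; apply/tuple_uniqP => p q Xpq.
  apply/val_inj; case: (ltngtP p q) => // lt.
    by have /existsPn/(_ q) := nX p; rewrite lt Xpq eqxx.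
  by have /existsPn/(_ p) := nX q; rewrite lt Xpq eqxx.
apply: (right_for _ N1 step (ltn_ord p)) => // s1 ls1 gs1.
have [N2 st hit] := run s1 p (ltn_ord p) ls1.
apply: (right_for _ N2 st (ltn_ord q)) => // s2 ls2 gs2.
by apply: (hit q X pq) => // l h /val_inj-> /val_inj->.
Qed.

Lemma den_fill s : env K s -> good T 0 s -> forall X, right T (den fill s) X.
Proof.
move=> es gs X; pose I j s' := good T j s'.
suff gm : I m (den fill s) by apply: gm; exact: leq_addl.
apply: (den_for (I := I)) => //; first by rewrite es // (const_m HK).
move=> j s' jm gs' sj fr _; have es' : env K s' by exact: (env_frame HK es _ fr).
exact: den_sweep gs'.
Qed.

End Sweeps.

(** * Running time *)

Fixpoint loop_deg (d : nat -> nat) (p : prog) : nat :=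
  match p with
  | PN _ _ _ | PR _ _ _ | PSkip => 0
  | PSeq p q | PIf _ p q => maxn (loop_deg d p) (loop_deg d q)
  | PFor _ a p => d a + loop_deg d p
  end.

(** Doubling [c] at each level of nesting absorbs the [+ 1] in [loop_weight]. *)
Lemma loop_weight_le val cs p (c n l : nat) (d e : nat -> nat) :
    0 < c -> 0 < n -> 0 < l -> well_scoped cs p ->
    {in cs, forall a, val a <= c * n ^ d a * l ^ e a} ->
  loop_weight val p <= (2 * c) ^ loop_deg (fun=> 1) p * n ^ loop_deg d p * l ^ loop_deg e p.
Proof.
move=> c0 n0 l0 + va; pose B p1 := (2 * c) ^ loop_deg (fun=> 1) p1 * n ^ loop_deg d p1 * l ^
  loop_deg e p1.
rewrite -/(B p).
have c20 : 0 < 2 * c by rewrite muln_gt0.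
have seq p1 p2 : (well_scoped cs p1 -> loop_weight val p1 <= B p1) ->
    (well_scoped cs p2 -> loop_weight val p2 <= B p2) ->
    well_scoped cs p1 && well_scoped cs p2 ->
    maxn (loop_weight val p1) (loop_weight val p2) <= B (PSeq p1 p2).
  move=> l1 l2 /andP[/l1 {}l1 /l2 {}l2]; rewrite geq_max (leq_trans l1) ?(leq_trans l2) //.
    by rewrite /B !leq_mul // leq_pexp2l //= leq_maxr.
  by rewrite /B !leq_mul // leq_pexp2l //= leq_maxl.
elim: p => //= [p IHp q IHq|b p IHp q IHq|x a p IH]; [exact: seq|exact: seq|].
case/and4P=> acs _ _ /IH; have := va a acs.
have : 0 < loop_weight val p by exact: loop_weight_gt0.
rewrite /B /= !expnD expn1.
have : 0 < n ^ d a * l ^ e a by rewrite muln_gt0 !expn_gt0 n0 l0.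
move: (loop_weight val p) (val a) ((2 * c) ^ _) (n ^ d a) (n ^ loop_deg d p) (l ^ e a) (l ^
  loop_deg e p).
move=> w u A b D E F BE w0 uB wA.
apply: (@leq_trans (2 * c * (b * E) * w)); last first.
  by rewrite (_ : 2 * c * A * (b * D) * (E * F) = 2 * c * (b * E) * (A * D * F)) ?leq_mul //; lia.
have : u * w <= c * (b * E) * w by rewrite leq_mul2r mulnA uB orbT.
have : 1 <= c * (b * E) * w by rewrite !muln_gt0 c0 w0; move: BE; rewrite muln_gt0 => ->.
by move: (c * (b * E)) => z; nia.
Qed.

Definition deg_n (a : nat) : nat :=
  if a \in [:: vn; vn2] then 1 else if a == vnn then 2 else 0.
Definition deg_l (a : nat) : nat := (a \in [:: vm; vm1; vb; vt]).

(** The deepest nest consists of exempted position, stage, round and level, each bounded by a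
    multiple of [m.+1 * bitlen n], and then of coordinate, row and column of an elimination, each
    bounded by [n] or [n + n]; hence the exponents 4 and 3. *)
Lemma rounds_weight val n m :
    0 < n -> val vn = n -> val vn2 = n + n -> val vm = m -> val vm1 = m.+1 ->
    val vb = bitlen n -> val vt = 4 * bitlen n -> val vnn = n * (n + n) ->
  loop_weight val (PFor xv vm1 slice_run) <=
  8 ^ loop_deg (fun=> 1) (PFor xv vm1 slice_run) * n ^ 3 * (m.+1 * bitlen n) ^ 4.
Proof.
move=> n0 En En2 Em Em1 Eb Et Enn.
have b0 : 0 < bitlen n by [].
apply: leq_trans (@loop_weight_le val [:: vn; vn2; vm; vm1; vb; vt;
  vnn] _ 4 n (m.+1 * bitlen n) deg_n deg_l _ _ _ _ _) _ => //.
  move=> a; rewrite !inE.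
  by do ?[case/orP]; move/eqP->; rewrite ?En ?En2 ?Em ?Em1 ?Eb ?Et ?Enn /= ?expn1 ?expn0
    ?expnS; nia.
Qed.

Definition scalars : prog :=
  PN vn (NConst 0) (NGet 0 (NConst 0)) ;;
  PN vn2 (NConst 0) (NAdd (var vn) (var vn)) ;;
  PN vm (NConst 0) (NGet 0 (NConst 1)) ;;
  PN vm1 (NConst 0) (NAdd (var vm) (NConst 1)) ;;
  PN vnn (NConst 0) (NMul (var vn) (var vn2)) ;;
  PN pw (NConst 0) (NConst 1).

Definition powers : prog :=
  PFor xh vm (PN pw (NAdd (var xh) (NConst 1)) (NMul (NGet pw (var xh)) (var vn))).

(** Repeated halving brings a positive [n] to 0 in [bitlen n] steps, and [n] iterations are enough
    for that. *)
Definition bit_length : prog :=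
  PN vb (NConst 0) (NConst 0) ;;
  PN xz (NConst 0) (var vn) ;;
  PFor xk vn
    (PIf (BNLe (NConst 1) (var xz))
       (PN xz (NConst 0) (NDiv (var xz) (NConst 2)) ;;
        PN vb (NConst 0) (NAdd (var vb) (NConst 1)))
       PSkip).

Definition derived : prog :=
  PN vnm (NConst 0) (NGet pw (var vm)) ;;
  PN vsl (NConst 0) (NDiv (var vnm) (NMul (var vn) (var vn))) ;;
  PN vt (NConst 0) (NMul (NConst 4) (var vb)) ;;
  PN vt1 (NConst 0) (NAdd (var vt) (NConst 1)).

Definition tables : prog := powers ;; bit_length ;; derived.

Definition copy_input : prog := PFor xr vnm (PR rout (var xr) (RGet rin (var xr))).

Definition main : prog := copy_input ;; fill.

Definition tensor_completion : cmd :=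
  CSeq (compile scalars) (CSeq (compile tables) (compile main)).

(** There are [n ^ m %/ (n * n)] slices per pair of positions, each of weight [n ^ 3] up to powers
    of [m.+1 * bitlen n], which makes [n ^ m.+1]. The loops over sweeps and over the two positions
    raise the exponent 4 to 7, and 16 absorbs the [+ 1] of four nested loops. *)
Lemma main_weight val n m :
    0 < n -> val vn = n -> val vn2 = n + n -> val vm = m -> val vm1 = m.+1 ->
    val vb = bitlen n -> val vt = 4 * bitlen n -> val vnn = n * (n + n) ->
    val vnm = n ^ m -> val vsl = n ^ m %/ (n * n) ->
  loop_weight val main <=
  16 * 8 ^ loop_deg (fun=> 1) (PFor xv vm1 slice_run) * n ^ m.+1 * (m.+1 * bitlen n) ^ 7.
Proof.
move=> n0 En En2 Em Em1 Eb Et Enn Enm Esl.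
have := rounds_weight n0 En En2 Em Em1 Eb Et Enn; set rnds := PFor xv vm1 _.
have := loop_weight_gt0 val rnds; set C := 8 ^ _; set l := m.+1 * _.
have C0 : 0 < C by rewrite expn_gt0.
have lm : m < l by rewrite /l leq_pmulr.
have sl_le : n ^ m %/ (n * n) * n ^ 2 <= n ^ m by rewrite -mulnn leq_trunc_div.
have E0 : 0 < n ^ m by rewrite expn_gt0 n0.
rewrite /main /copy_input /fill /sweep /slice_loop -/rnds.
clearbody rnds C l => W0 WC; rewrite /= Enm Esl Em.
move: (loop_weight val rnds) W0 WC => W W0 WC; rewrite [maxn 1 W](maxn_idPr W0) (maxn_idPr W0).
pose w := C * n ^ m.+1 * l ^ 4.
have l0 : 0 < l by exact: leq_ltn_trans lm.
have w0 : 0 < w by rewrite /w !muln_gt0 C0 !expn_gt0 n0 l0.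
have slW : n ^ m %/ (n * n) * W <= w.
  rewrite (leq_trans (leq_mul (leqnn _) WC)) // /w [n ^ m.+1]expnS [n ^ 3]expnSr.
  by have := leq_mul sl_le (leqnn (C * n * l ^ 4)); move: (n ^ m) (n ^ 2) (l ^ 4) (_ %/ _) =>
    *; nia.
have nw : n ^ m <= w.
  rewrite /w [n ^ m.+1]expnS; have : 0 < n * C * l ^ 4 by rewrite !muln_gt0 n0 C0 ?expn_gt0 l0.
  by move: (n ^ m) (l ^ 4) => *; nia.
have step x y : 0 < y -> x <= y -> m * x + 1 <= 2 * l * y by nia.
rewrite (_ : 16 * C * n ^ m.+1 * l ^ 7 = 2 * l * (2 * l * (2 * l * (2 * w)))); last first.
  have -> : l ^ 7 = l * (l * (l * l ^ 4)) by rewrite -!expnS.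
  by rewrite /w; move: (n ^ m.+1) (l ^ 4) => *; lia.
clearbody w; rewrite geq_max; apply/andP; split.
  have grow y : y <= 2 * l * y by rewrite leq_pmull // muln_gt0.
  by do 3![apply: leq_trans (grow _)]; rewrite muln1; move: w0 nw; lia.
do 2![apply: (step); first by rewrite !muln_gt0 l0 w0].
apply: (step); first by rewrite muln_gt0 w0.
by rewrite geq_max; lia.
Qed.

Lemma bitlen_gt n : n < 2 ^ bitlen n.
Proof. exact: trunc_log_ltn. Qed.

Lemma bitlen_leq n : 0 < n -> bitlen n <= n.
Proof. by move=> n0; exact: leq_trans (ltn_expl _ _) (trunc_logP _ _). Qed.

Lemma bitlen_lt n k : 0 < n -> (k < bitlen n) = (1 <= n %/ 2 ^ k).
Proof.
move=> n0; rewrite divn_gt0 ?expn_gt0 // /bitlen ltnS; apply/idP/idP => [kt|].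
  exact: leq_trans (leq_pexp2l _ kt) (trunc_logP _ n0).
exact: trunc_log_max.
Qed.

Section Word.
Variables (n m : nat).
Hypothesis n_gt0 : 0 < n.
(** Enough bits for [n ^ m], for the matrix size [n * (n + n)], and for the counters bounded in
    terms of [m] and [bitlen n]. *)
Definition word : nat := 4 * (m.+1 * bitlen n).

Lemma word_gt0 : 0 < word. Proof. by rewrite /word. Qed.

Lemma pow2_word k x : x < 2 ^ k -> k <= word -> x < 2 ^ word.
Proof. by move=> xk kw; apply: leq_trans xk _; rewrite leq_pexp2l. Qed.

Lemma word_pow l : l <= m -> n ^ l < 2 ^ word.
Proof.
case: l => [|l] lm; first exact: (@pow2_word 1).
apply: (@pow2_word (bitlen n * l.+1)); first by rewrite expnM ltn_exp2r // bitlen_gt.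
by rewrite /word; nia.
Qed.

Lemma word_n : n < 2 ^ word.
Proof. by apply: pow2_word (bitlen_gt n) _; rewrite /word; nia. Qed.

Lemma word_nn : n * (n + n) < 2 ^ word.
Proof.
apply: (@pow2_word (bitlen n + bitlen n).+1); last by rewrite /word /bitlen; nia.
by rewrite expnS expnD; have := bitlen_gt n; move: (2 ^ bitlen n) => x; nia.
Qed.

Lemma word_m : m.+1 < 2 ^ word.
Proof. by apply: pow2_word (ltn_expl m.+1 (ltnSn 1)) _; rewrite /word /bitlen; nia. Qed.

Lemma word_t : (4 * bitlen n).+1 < 2 ^ word.
Proof.
apply: (@pow2_word (4 * bitlen n)); last by rewrite /word; nia.
rewrite /bitlen mulnS expnD; have := ltn_expl (4 * trunc_log 2 n) (ltnSn 1).
by move: (2 ^ (4 * _)) => x; lia.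
Qed.
End Word.

Section Tables.
Variables (R : realType) (n m : nat).
Hypothesis n_gt0 : 0 < n.
Implicit Types s : state R.

Definition scalars_ok s :=
  [/\ nmem s vn 0 = n, nmem s vn2 0 = n + n, nmem s vm 0 = m, nmem s vm1 0 = m.+1 &
      nmem s vnn 0 = n * (n + n)] /\ nmem s pw 0 = 1.

Lemma den_scalars s : nmem s 0 0 = n -> nmem s 0 1 = m ->
  safe (word n m) scalars s /\ scalars_ok (den scalars s).
Proof.
move=> sn sm; have wn := word_n m n_gt0; have wnn := word_nn m n_gt0; have wm := word_m m n_gt0.
have w1 : 1 < 2 ^ word n m by exact: leq_ltn_trans wm.
split; last by do ![split]; rewrite /= /update /= ?sn ?sm ?addn1.
rewrite /= /update /= ?sn ?sm ?addn1; do ![split] => //; try lia.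
  by apply: leq_ltn_trans wnn; nia.
Qed.

Local Notation W := (word n m).

Lemma den_powers s : scalars_ok s ->
  safe W powers s /\ forall l, l <= m -> nmem (den powers s) pw l = n ^ l.
Proof.
move=> [[sn _ sm _ _] p0]; pose I k s' := forall l, l <= k -> nmem s' pw l = n ^ l.
apply: (safe_for (I := I)) sm _ _ => //; first by move=> l; rewrite leqn0 => /eqP->.
move=> k s' km Ik sk fr.
have vE : neval s' (NMul (NGet pw (var xh)) (var vn)) = n ^ k.+1.
  by rewrite /= sk (fr vn) // sn Ik // -expnSr.
split; first by rewrite /safe vE word_pow.
move=> l lk; rewrite /= in vE; rewrite /= /update /= vE sk addn1.
by case: eqP => [->//|] ?; apply: Ik; lia.
Qed.

Lemma den_bit_length s : nmem s vn 0 = n ->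
  safe W bit_length s /\ nmem (den bit_length s) vb 0 = bitlen n.
Proof.
move=> sn; rewrite /bit_length !den_seq; set s1 := den _ s; set s2 := den _ s1.
have s2n : nmem s2 vn 0 = n by [].
have s2z : nmem s2 xz 0 = n by [].
have s2b : nmem s2 vb 0 = 0 by [].
have s1W : safe W (PN xz (NConst 0) (var vn)) s1 by rewrite /= /update /= sn word_n.
set lp := PFor _ _ _.
suff [lpW lpb] : safe W lp s2 /\ nmem (den lp s2) vb 0 = bitlen n.
  split=> //; split; [by rewrite /safe expn_gt0 | by split].
clearbody s2; pose I k s' := nmem s' vb 0 = minn k (bitlen n) /\ nmem s' xz 0 = n %/ 2 ^ k.
suff [lpW [Ib _]] : safe W lp s2 /\ I n (den lp s2).
  by rewrite Ib (minn_idPr _) // bitlen_leq.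
apply: (safe_for (I := I)) s2n _ _ => //; first by split; rewrite /= /update /= ?s2b ?s2z
  ?min0n ?divn1.
move=> k s' kn [Ib Iz] sk fr.
have bE : beval s' (BNLe (NConst 1) (var xz)) = (k < bitlen n).
  by rewrite bitlen_lt //= Iz.
rewrite den_if /safe -/safe bE; case: ltnP => kb; split=> //.
- rewrite /= /update /= Iz Ib (minn_idPl (ltnW kb)).
  split; last by rewrite addn1 (leq_ltn_trans kn) ?word_n.
  by rewrite (leq_ltn_trans (leq_div _ _)) // (leq_ltn_trans (leq_div _ _)) ?word_n.
- rewrite /I /= /update /= Iz Ib (minn_idPl (ltnW kb)) (minn_idPl kb) addn1.
  by rewrite -divnMA -expnSr.
rewrite /I /= /update /= Iz Ib (minn_idPr kb) (minn_idPr (leqW kb)).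
have := bitlen_lt k n_gt0; rewrite ltnNge kb => /esym/negbT; rewrite -ltnNge ltnS leqn0 => /eqP->.
have := bitlen_lt k.+1 n_gt0; rewrite ltnNge (leqW kb) => /esym/negbT.
by rewrite -ltnNge ltnS leqn0 => /eqP->.
Qed.

Lemma den_tables s : scalars_ok s ->
  safe W tables s /\ constants n m (nmem (den tables s)).
Proof.
move=> ss; have [sn _ sm _ _] := ss.1.
have [pwW pwE] := den_powers ss; rewrite /tables den_seq.
set s1 := den powers s in pwE *.
have fr1 a i : a \notin nmods powers -> nmem s1 a i = nmem s a i by exact: nmem_den.
suff [sf cs] : safe W (bit_length;; derived) s1 /\ constants n m (nmem (den (bit_length;;
  derived) s1)) by [].
clearbody s1; have s1n : nmem s1 vn 0 = n by rewrite fr1.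
have [blW blE] := den_bit_length s1n; rewrite den_seq; set s2 := den bit_length s1 in blE *.
have fr2 a i : a \notin nmods bit_length -> nmem s2 a i = nmem s1 a i by exact: nmem_den.
suff [sf cs] : safe W derived s2 /\ constants n m (nmem (den derived s2)) by [].
clearbody s2.
have fr a i : a \notin nmods (PSeq powers bit_length) -> nmem s2 a i = nmem s a i.
  by rewrite mem_cat negb_or => /andP[a1 a2]; rewrite fr2 // fr1.
have p2 l : l <= m -> nmem s2 pw l = n ^ l by move=> lm; rewrite fr2 // pwE.
have [s2n s2n2 s2m s2m1 s2nn] := ss.1.
have vnE : nmem s2 vn 0 = n by rewrite fr.
have vmE : nmem s2 vm 0 = m by rewrite fr.
split.
  rewrite /= /update /= vnE vmE p2 // blE.
  have := word_t m n_gt0; have wnm := word_pow n_gt0 (leqnn m); move=> wt.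
  split=> //; split; first exact: leq_ltn_trans (leq_div _ _) wnm.
  by split; rewrite ?addn1 //; exact: ltnW.
by split=> //; rewrite /= /update /= ?vnE ?vmE ?blE ?p2 ?addn1 // fr.
Qed.
End Tables.

Definition weight_const : nat := 16 * 8 ^ loop_deg (fun=> 1) (PFor xv vm1 slice_run).
(** The 4 is the factor in [word]; the other factor of [word] raises the exponent 7 of the weights
    to 8. *)
Definition time_const : nat :=
  4 * (overhead scalars + overhead tables + overhead main) * weight_const.

Lemma tables_weight val n m : 0 < n -> val vn = n -> val vm = m ->
  loop_weight val tables <= weight_const * n ^ m.+1 * (m.+1 * bitlen n) ^ 7.
Proof.
move=> n0 En Em; rewrite /tables /bit_length /powers [loop_weight _ _]/= En Em.
have c0 : 2 <= weight_const by have := expn_gt0 8 (loop_deg (fun=> 1) (PFor xv vm1 slice_run));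
  rewrite /weight_const; move: (8 ^ _) => x /=; lia.
have n1 : n <= n ^ m.+1 by rewrite expnS leq_pmulr // expn_gt0 n0.
have m1 : m.+1 <= (m.+1 * bitlen n) ^ 7 by rewrite expnS -mulnA leq_pmulr // muln_gt0 expn_gt0.
have : 2 * n * m.+1 <= weight_const * n ^ m.+1 * (m.+1 * bitlen n) ^ 7 by rewrite !leq_mul.
by apply: leq_trans; rewrite !geq_max; do ![apply/andP; split]; nia.
Qed.

(** The three phases are timed separately because loop bounds must be constant during a phase, while
    each phase computes bounds for the next. *)
Lemma exec_tensor_completion (R : realType) n m k (T : tensor R n m)
    (v : 'I_k -> 'rV[R]_n) (w : 'I_k -> R) s :
    0 < n ->
    (forall X : m.-tuple 'I_n, T X = (\sum_(i < k) w i * tpower (v i) m X)%R) ->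
    (forall S : {set 'I_n}, 0 < \rank (span_mx v :&: coordmx R S)%MS ->
      4 * m * \rank (span_mx v :&: coordmx R S)%MS < #|S|) ->
    multilinear_input T s ->
  exists (s' : state R) (t : nat),
    [/\ exec s tensor_completion s' t, full_output T s' & t <= soft_bound time_const 8 n m.+1].
Proof.
move=> n0 TE incT [sN sR]; have W0 := word_gt0 n m.
have [sn sm] : nmem s 0 0 = n /\ nmem s 0 1 = m by rewrite !sN.
have ws : word_sized (word n m) s.
  move=> a i; rewrite sN; have := word_n m n0; have := word_m m n0.
  by do ![case: ifP => _]; lia.
have [sf1 ok1] := den_scalars n0 sn sm.
have [ws1 [t1 e1 l1]] := @exec_den R _ W0 [::] (fun=> 0) scalars s isT (fun _ => ltac:(by []))
  ws sf1.
have rin1 i : rmem (den scalars s) rin i = rmem s rin i by exact: rmem_den.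
set s1 := den scalars s in ok1 ws1 e1 rin1; clearbody s1.
have [sf2 HK] := den_tables n0 ok1.
have [ws2 [t2 e2 l2]] := @exec_den R _ W0 [:: vn; vm] (fun a => nmem s1 a 0) tables s1 isT (fun
  _ _ => erefl) ws1 sf2.
have rin2 i : rmem (den tables s1) rin i = rmem s rin i by rewrite -rin1; exact: rmem_den.
set s2 := den tables s1 in HK ws2 e2 rin2; clearbody s2.
(* The main phase stores only small values, so its safety reduces to positivity of the four moduli
   it uses. *)
have [sf3 _] : safe (word n m) main s2 /\ word_sized (word n m) (den main s2).
  apply: (@small_safe R _ W0 (iota 1 10) [:: vn; vn2; vnm; vt1]) => //; first exact/allP.
  move=> a; rewrite !inE; do ?[case/orP]; move/eqP->.
  - by rewrite (const_n HK).
  - by rewrite (const_n2 HK) addn_gt0 n0.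
  - by rewrite (const_nm HK) expn_gt0 n0.
  - by rewrite (const_t1 HK).
have [_ [t3 e3 l3]] := @exec_den R _ W0 (iota 1 10) (fun a => nmem s2 a 0) main s2 isT (fun _ _
  => erefl) ws2 sf3.
exists (den main s2), (t1 + (t2 + t3)); split.
- by apply: ExecSeq e1 _; exact: ExecSeq e2 e3.
- move=> X; rewrite /main den_seq.
  have es : env (nmem s2) (den copy_input s2).
    by apply: (env_den HK) => //.
  (* Without repetitions an index is multilinear, so the copied input starts the induction. *)
  apply: (den_fill HK TE incT es) => {}X; rewrite addn0 => /vals_uniq uX.
  rewrite /right -sR // -rin2.
  pose I j (s' : state R) := forall i, i < j -> rmem s' rout i = rmem s2 rin i.
  suff : I (n ^ m) (den copy_input s2) by apply; exact: address_lt.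
  apply: (den_for (I := I)) => //; first exact: const_nm HK.
  move=> j s' jN Ij sj _ frr i; rewrite ltnS leq_eqVlt [rmem _]/= /update /= sj frr //.
  by case: eqP => [->//|_] /= /Ij.
have [[o1 _ o3 _ _] _] := ok1.
have w2 := tables_weight (val := fun a => nmem s1 a 0) n0 o1 o3.
have w3 : loop_weight ((nmem s2)^~ 0) main <= weight_const * n ^ m.+1 * (m.+1 * bitlen n) ^ 7.
  by case: HK => *; apply: main_weight.
have w1 : loop_weight (fun=> 0) scalars <= weight_const * n ^ m.+1 * (m.+1 * bitlen n) ^ 7.
  by rewrite (leq_trans _ w3) // loop_weight_gt0.
move: l1 l2 l3 w1 w2 w3; rewrite /soft_bound /time_const /word [(_ * _) ^ 8]expnS.
move: (loop_weight _ scalars) (loop_weight _ tables) (loop_weight _ main) => x1 x2 x3.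
move: (overhead scalars) (overhead tables) (overhead main) weight_const => p1 p2 p3 c.
move: (n ^ m.+1) (m.+1 * bitlen n) => N l; move: (l ^ 7) => L l1 l2 l3 w1 w2 w3.
have le o x t : t <= 4 * l * (o * x) -> x <= c * N * L -> t <= 4 * l * (o * (c * N * L)).
  by move=> tx xw; rewrite (leq_trans tx) // !leq_mul.
have := le _ _ _ l1 w1; have := le _ _ _ l2 w2; have := le _ _ _ l3 w3.
lia.
Qed.

Local Open Scope ring_scope.

Theorem theorem1p2 (R : realType) :
  exists (P : cmd) (C c : nat),
    forall (n m k r : nat) (T : tensor R n m)
           (v : 'I_k -> 'rV[R]_n) (w : 'I_k -> R) (mu : R),
      (0 < n)%N ->
      symmetric_tensor T ->
      (forall i, w i != 0) ->
      (forall X : m.-tuple 'I_n, T X = \sum_(i < k) w i * tpower (v i) m X) ->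
      incoherent mu (span_mx v) ->
      \rank (span_mx v) = r ->
      4 * mu * r%:R * m%:R / n%:R < 1 ->
      forall s : state R, multilinear_input T s ->
        exists (s' : state R) (t : nat),
          [/\ exec s P s' t, full_output T s' & (t <= soft_bound C c n m.+1)%N].
Proof.
exists tensor_completion, time_const, 8%N.
move=> n m k r T v w mu n0 _ _ TE inc <- small s inp.
apply: exec_tensor_completion inp => // S S0.
exact: (incoherent_rank inc small).
Qed.
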